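(* For any sequence $p_n\in[0,1]$ such that $\limsup_{n\to\infty} np_n<\infty$, with high probability $G\sim\mathbb{G}(n,p_n)$ has an $o(1)$-almost-internal bisection and an $o(1)$-almost-external bisection. That is, there is a sequence $\varepsilon_n\to 0$ such that with probability tending to $1$ as $n\to\infty$, $G$ has an $\varepsilon_n$-almost-internal bisection and an $\varepsilon_n$-almost-external bisection. In both cases, the desired bisections can be found via a randomised algorithm whose expected runtime is linear in $n$.
   Context: $\mathbb{G}(n,p)$ is the binomial random graph on a fixed set of $n$ vertices, in which each of the $\binom n2$ possible edges is included with probability $p$ independently. A bisection of a graph is a red-blue colouring of its vertices in which the numbers of red and blue vertices are equal (or differ by one, if the total number of vertices is odd). A red-blue colouring of an $n$-vertex graph is $\varepsilon$-almost-internal if all but (at most) $\varepsilon n$ vertices have at least half of their neighbours in the same colour as themselves; it is $\varepsilon$-almost-external if all but (at most) $\varepsilon n$ vertices have at least half of their neighbours in the opposite colour. *)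

(* Defs.v *)
From HB Require Import structures.
From mathcomp Require Import all_boot all_order all_algebra.
From mathcomp Require Import all_classical all_reals all_analysis.

Set Implicit Arguments.
Unset Strict Implicit.
Unset Printing Implicit Defensive.

Import Order.TTheory GRing.Theory Num.Theory.
Import numFieldNormedType.Exports.

Local Open Scope classical_set_scope.
Local Open Scope ring_scope.

(** * Graphs and the binomial random graph *)

Definition pairs (n : nat) : {set {set 'I_n}} := [set e : {set 'I_n} | #|e| == 2%N]%SET.

(* A graph on 'I_n is its edge set; only subsets of [pairs n] are ever used. *)
Definition graph (n : nat) := {set {set 'I_n}}.

Definition adj n (E : graph n) (u v : 'I_n) : bool := [set u; v]%SET \in E.

Definition gnp_weight (R : realType) n (p : R) (E : graph n) : R :=
  \prod_(e in pairs n) (if e \in E then p else 1 - p).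

Definition gnp_prob (R : realType) n (p : R) (A : pred (graph n)) : R :=
  \sum_(E in powerset (pairs n) | A E) gnp_weight p E.

(** * Bisections *)

Definition colouring (n : nat) := {ffun 'I_n -> bool}.  (* true = red *)

Definition bisection n (chi : colouring n) : bool :=
  let red := #|[pred v | chi v]| in
  let blue := #|[pred v | ~~ chi v]| in
  ((red == blue + odd n) || (blue == red + odd n))%N.

Definition deg n (E : graph n) (v : 'I_n) : nat := #|[pred u | adj E v u]|.

Definition same_deg n (E : graph n) (chi : colouring n) (v : 'I_n) : nat :=
  #|[pred u | adj E v u && (chi u == chi v)]|.

Definition opp_deg n (E : graph n) (chi : colouring n) (v : 'I_n) : nat :=
  #|[pred u | adj E v u && (chi u != chi v)]|.

Definition almost_internal (R : realType) n (eps : R) (E : graph n)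
    (chi : colouring n) : bool :=
  #|[pred v | ~~ (deg E v <= 2 * same_deg E chi v)%N]|%:R <= eps * n%:R.

Definition almost_external (R : realType) n (eps : R) (E : graph n)
    (chi : colouring n) : bool :=
  #|[pred v | ~~ (deg E v <= 2 * opp_deg E chi v)%N]|%:R <= eps * n%:R.

Definition internal_bisection (R : realType) n (eps : R) (E : graph n)
    (chi : colouring n) : bool :=
  bisection chi && almost_internal eps E chi.

Definition external_bisection (R : realType) n (eps : R) (E : graph n)
    (chi : colouring n) : bool :=
  bisection chi && almost_external eps E chi.

(** * Randomised algorithms: while-programs on a word RAM

    A program uses finitely many registers and a random-access memory, all
    holding [w]-bit words. Each elementary command costs one unit of time; the
    expressions in it are of constant size, being part of the fixed program. *)

Inductive binop := OAdd | OSub | OMul | ODiv | OMod | OLt.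

Inductive expr :=
| EConst (k : nat)
| EReg (x : nat)
| EMem (a : expr)
| EBin (o : binop) (e1 e2 : expr).

Inductive cmd :=
| CSkip
| CAssign (x : nat) (e : expr)
| CStore (a e : expr)
| CSample (x : nat) (e : expr)  (* x := uniform element of {0, ..., e - 1} *)
| CSeq (c1 c2 : cmd)
| CIf (e : expr) (c1 c2 : cmd)
| CWhile (e : expr) (c : cmd).

Record state := State { regs : nat -> nat; mem : nat -> nat }.

Definition upd (f : nat -> nat) (x v : nat) : nat -> nat :=
  fun y => if y == x then v else f y.

Definition eval_op (o : binop) (a b : nat) : nat :=
  match o with
  | OAdd => a + b
  | OSub => a - b  (* truncated at 0 *)
  | OMul => a * b
  | ODiv => a %/ b
  | OMod => a %% b
  | OLt => (a < b)%N
  end%N.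

(* Arithmetic is reduced to words of [w] bits. *)
Fixpoint eval_expr (w : nat) (s : state) (e : expr) : nat :=
  match e with
  | EConst k => k %% 2 ^ w
  | EReg x => regs s x
  | EMem a => mem s (eval_expr w s a)
  | EBin o e1 e2 => eval_op o (eval_expr w s e1) (eval_expr w s e2) %% 2 ^ w
  end%N.

(* The stack of commands that remain to be executed, and the current state;
   the computation has halted when the stack is empty. *)
Definition config := (seq cmd * state)%type.

Definition halted (cf : config) : bool := nilp cf.1.

(* One step of computation: the next configuration is uniformly distributed
   over the (nonempty) list [step w cf]. *)
Definition step (w : nat) (cf : config) : seq config :=
  let: (stack, s) := cf in
  match stack with
  | [::] => [:: cf]
  | c :: k =>
    match c with
    | CSkip => [:: (k, s)]
    | CAssign x e => [:: (k, State (upd (regs s) x (eval_expr w s e)) (mem s))]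
    | CStore a e =>
        [:: (k, State (regs s) (upd (mem s) (eval_expr w s a) (eval_expr w s e)))]
    | CSample x e =>
        [seq (k, State (upd (regs s) x i) (mem s))
           | i <- iota 0 (maxn 1 (eval_expr w s e))]
    | CSeq c1 c2 => [:: (c1 :: c2 :: k, s)]
    | CIf e c1 c2 => [:: ((if eval_expr w s e != 0%N then c1 else c2) :: k, s)]
    | CWhile e c' => [:: (if eval_expr w s e != 0%N then c' :: c :: k else k, s)]
    end
  end.

(* Probability that the configuration reached from [cf] after [t] steps
   satisfies [Q]. *)
Fixpoint run_prob (R : realType) (w t : nat) (Q : pred config) (cf : config)
    : R :=
  if t is t'.+1 then
    (\sum_(cf' <- step w cf) run_prob R w t' Q cf') / (size (step w cf))%:R
  else (Q cf)%:R.

(* Probability that the computation from [cf] halts in a state satisfying [Q]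
   (the limit is over a bounded nondecreasing sequence). *)
Definition halt_prob (R : realType) (w : nat) (Q : pred state) (cf : config)
    : R :=
  limn (fun t => run_prob R w t (fun cf' => halted cf' && Q cf'.2) cf).

(* Expected number of steps, as the sum over t of the probability that step
   t + 1 is executed; it is +oo if the computation fails to halt with positive
   probability. *)
Definition expected_time (R : realType) (w : nat) (cf : config) : \bar R :=
  (\sum_(0 <= t <oo) (run_prob R w t (fun cf' => ~~ halted cf') cf)%:E)%E.

(** * Input and output of graph algorithms *)

(* Words of c * (floor (log_2 n) + 1) bits. *)
Definition word_bits (c n : nat) : nat := (c * (trunc_log 2 n).+1)%N.

Definition nbrs n (E : graph n) (u : 'I_n) : seq nat :=
  [seq val v | v <- enum 'I_n & adj E u v].

(* Adjacency lists: cells 0, ..., n hold offsets, and the neighbours of vertex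
   u are stored from the address in cell u up to the one in cell u + 1
   (excluded). *)
Definition graph_words n (E : graph n) : seq nat :=
  let lists := [seq nbrs E u | u <- enum 'I_n] in
  mkseq (fun i => n.+1 + sumn (take i (map size lists)))%N n.+1
    ++ flatten lists.

(* Register 0 initially holds n; other registers and unused cells hold 0. *)
Definition initial (A : cmd) n (E : graph n) : config :=
  ([:: A], State (upd (fun _ => 0%N) 0%N n) (nth 0%N (graph_words E))).

(* On halting, vertex v is red if cell v is nonzero, and blue otherwise. *)
Definition output n (s : state) : colouring n :=
  [ffun v : 'I_n => mem s v != 0%N].

(* Probability, over both G ~ G(n,p) and the random choices of [A], that [A]
   halts with a colouring [chi] such that [good G chi]. *)
Definition success_prob (R : realType) (A : cmd) (c n : nat) (p : R)
    (good : graph n -> colouring n -> bool) : R :=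
  \sum_(E in powerset (pairs n))
    gnp_weight p E
    * halt_prob R (word_bits c n) (fun s => good E (output n s)) (initial A E).

(* Expected running time of [A], over both G ~ G(n,p) and the random choices. *)
Definition average_time (R : realType) (A : cmd) (c n : nat) (p : R) : \bar R :=
  (\sum_(E in powerset (pairs n))
    (gnp_weight p E)%:E * expected_time R (word_bits c n) (initial A E))%E.

(* [3 <= c] guarantees that every graph on n vertices fits in memory: all the
   entries and addresses of its adjacency lists are words. *)
Definition found_in_linear_time (R : realType) (p : nat -> R)
    (good : forall n, graph n -> colouring n -> bool) : Prop :=
  exists (A : cmd) (c : nat),
    [/\ (3 <= c)%N,
        (fun n => success_prob A c (p n) (good n)) @ \oo --> (1 : R)
      & exists K : R, forall n, (0 < n)%N ->
          (average_time A c n (p n) <= (K * n%:R)%:E)%E].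

(* Main.v *)
Require Import Defs.
From HB Require Import structures.
From mathcomp Require Import all_boot all_order all_algebra.
From mathcomp Require Import all_classical all_reals all_analysis.
From mathcomp Require Import zify ring lra.
From mathcomp Require Import fintype finset.

Set Implicit Arguments.
Unset Strict Implicit.
Unset Printing Implicit Defensive.

Import Order.TTheory GRing.Theory Num.Theory.
Import numFieldNormedType.Exports.

(** Idea of the proof.

    Dynamics. Let [L = levels n] tend to infinity very slowly, and split the
    vertices into [k = L ^ 2] classes by their index. Colour the vertices by the
    parity of their index and recolour them in steps: in step [t], every unhappy
    vertex of class [t %% k] changes its colour. A neighbour is bad if it has the
    unwanted colour (the opposite one for internal bisections, the same one for
    external bisections; the flag [ext] tells which), and a vertex is unhappy if
    more than half of its neighbours are bad. Vertices that have degree above [L]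
    or a neighbour in their own class are frozen and never move; with high
    probability there are O(n / L) of them. Adjacent vertices never move in the same step, so every
    move lowers the number of bad edges. The process stops after the first sweep
    of [k] steps in which the vertices that moved have total degree at most
    [n / L]. An unfrozen vertex that is unhappy at that time has a neighbour that
    moved in the last sweep ([card_ready_sweep]), so there are at most [n / L].

    Linear time. A move of [v] is propagated by inspecting the neighbours of [v],
    and degrees are not bounded, so a linear number of moves is not enough. We
    weigh the edges by a potential that is at least the squared degree, up to a
    constant, near every vertex, and that varies by a factor of at most
    [1 + 1 / deg v] from one edge at [v] to another. Then the majority at an
    unhappy vertex is bad also with weights, so each move of [v] lowers the total
    weight of the bad edges by at least the potential of [v]
    ([energy_flip1]), which pays for the inspections that it causes
    ([flip_cost_le]). The least such potential is a maximum over simple paths: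
    the squared degree of the first vertex, damped by a factor [d / d.+1] for
    each vertex of degree [d] on the way. Its total over all edges has linear
    mean: high degrees are so rare that their influence, which reaches a
    logarithmic distance only, is negligible ([Ex_potential_le], a first moment
    computation). This bound does not depend on [L], so the mean total
    cost of all moves is linear, uniformly in the number of sweeps.

    Balance. Differences between two runs spread only through unfrozen vertices,
    by one edge per step; so adding or removing an edge affects the colours of at
    most [2 * (L + 2) ^ t] vertices after [t] steps ([edge_influence]), and the
    number of red vertices has variance [O(n * (L + 2) ^ (2 * t))] by the
    Efron--Stein inequality. Exchanging the vertices [2 * i] and [2 * i + 1]
    preserves the classes and the random graph, and complements the initial
    colouring, so the mean number of red vertices is nearly [n / 2]
    ([mean_red]). With high probability there are at most [L ^ 2 + 1] sweeps, so
    [t <= 2 * L ^ 4], and the colouring is balanced up to [n / L ^ 3]; recolouring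
    that many vertices makes a bisection and disturbs O(n / L) vertices.

    Algorithm. The program makes no random choices. For each class it keeps a
    linked list of the vertices that may have become unhappy. Its abstract
    counterpart is [process_state], which is shown to follow the dynamics
    ([tracks_sweep]); [wp_program] verifies the program against it, and
    [program_spec] collects what is needed about its output and running time. *)

(** * Random subsets of a finite set *)

Section ProductExpectation.

Local Open Scope ring_scope.

Variables (R : realType) (T : finType) (p : R).
Implicit Types (P E : {set T}) (f g : {set T} -> R).

Definition wgt P E : R := \prod_(e in P) (if e \in E then p else 1 - p).

Definition Ex P f : R := \sum_(E in powerset P) wgt P E * f E.

Lemma wgt_setU1 P e E : e \notin P -> E \subset P ->
  wgt (e |: P) (e |: E) = p * wgt P E.
Proof.
move=> eP EP; rewrite /wgt big_setU1 //= setU11; congr (_ * _).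
apply: eq_bigr => x xP; rewrite !inE; case: eqP => // xe.
by rewrite -xe xP in eP.
Qed.

Lemma wgt_setU1_notin P e E : e \notin P -> E \subset P ->
  wgt (e |: P) E = (1 - p) * wgt P E.
Proof.
move=> eP EP; rewrite /wgt big_setU1 //=.
by rewrite (negbTE (contra (subsetP EP e) eP)).
Qed.

Lemma Ex_setU1 P e f : e \notin P ->
  Ex (e |: P) f = p * Ex P (fun E => f (e |: E)%SET) + (1 - p) * Ex P f.
Proof.
move=> eP; rewrite /Ex (bigID (fun E : {set T} => e \in E)) /=; congr (_ + _).
  rewrite (reindex_onto (fun E : {set T} => e |: E)%SET (fun E => E :\ e)%SET).
    rewrite mulr_sumr; apply: eq_big => E.
      rewrite !inE eqxx /= andbT; apply/andP/idP => [[EP /eqP <-]|EP].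
        by rewrite subDset.
      have eE : e \notin E by apply: contra (subsetP EP e) eP.
      split; first exact: setUS.
      by rewrite setU1K.
    rewrite !inE eqxx /= andbT => /andP[EP /eqP EE].
    have EP' : E \subset P by rewrite -EE subDset.
    by rewrite wgt_setU1 // mulrA.
  by move=> E /andP[_ eE]; rewrite setD1K.
rewrite mulr_sumr; apply: eq_big => E.
  rewrite !inE; apply/andP/idP => [[EP eE]|EP].
    apply/fintype.subsetP => x xE; move/fintype.subsetP: EP => /(_ x xE).
    by rewrite !inE => /orP[/eqP xe|//]; rewrite -xe xE in eE.
  split; first by apply: fintype.subset_trans EP _; exact: subsetUr.
  by apply: contra (fintype.subsetP EP e) eP.
rewrite !inE => /andP[EP eE].
have EP' : E \subset P.
  apply/fintype.subsetP => x xE; move/fintype.subsetP: EP => /(_ x xE).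
  by rewrite !inE => /orP[/eqP xe|//]; rewrite -xe xE in eE.
by rewrite wgt_setU1_notin // mulrA.
Qed.

Lemma Ex_set0 f : Ex set0 f = f set0.
Proof.
rewrite /Ex powerset0 big_set1 /wgt big1 ?mul1r // => e.
by rewrite inE.
Qed.

Lemma set_ind_setU1 (Q : {set T} -> Prop) :
  Q set0 -> (forall P e, e \notin P -> Q P -> Q (e |: P)%SET) ->
  forall P, Q P.
Proof.
move=> Q0 QS P; have [m] := ubnP #|P|; elim: m P => // m IH P /ltnSE Pm.
have [->//|[e eP]] := set_0Vmem P.
rewrite -(setD1K eP); apply: QS; first by rewrite !inE eqxx.
by apply: IH; apply: leq_trans Pm; rewrite (cardsD1 e P) eP.
Qed.

(** The coordinates are independent, so the mean of a product of functions of
single coordinates is the product of their means. *)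
Lemma Ex_prod P (g : T -> bool -> R) :
  Ex P (fun E => \prod_(e in P) g e (e \in E))
  = \prod_(e in P) (p * g e true + (1 - p) * g e false).
Proof.
elim/set_ind_setU1: P => [|P e eP IH].
  by rewrite Ex_set0 !big_set0.
rewrite Ex_setU1 // big_setU1 //= -IH [RHS]mulrDl; congr (_ + _).
  rewrite -mulrA; congr (_ * _); rewrite /Ex mulr_sumr.
  apply: eq_bigr => E; rewrite inE => EP; rewrite mulrCA; congr (_ * _).
  rewrite big_setU1 //= !inE eqxx /=; congr (_ * _).
  apply: eq_bigr => x xP; rewrite !inE; case: eqP => // xe.
  by rewrite -xe xP in eP.
rewrite -mulrA; congr (_ * _); rewrite /Ex mulr_sumr.
apply: eq_bigr => E; rewrite inE => EP; rewrite mulrCA; congr (_ * _).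
rewrite big_setU1 //=.
by rewrite (negbTE (contra (fintype.subsetP EP e) eP)).
Qed.

Lemma eq_Ex P f g : (forall E, E \subset P -> f E = g E) -> Ex P f = Ex P g.
Proof. by move=> fg; apply: eq_bigr => E; rewrite inE => /fg ->. Qed.

Lemma ExD P f g : Ex P (fun E => f E + g E) = Ex P f + Ex P g.
Proof.
by rewrite /Ex -big_split; apply: eq_bigr => E _; rewrite mulrDr.
Qed.

Lemma ExZ P c f : Ex P (fun E => c * f E) = c * Ex P f.
Proof.
by rewrite /Ex mulr_sumr; apply: eq_bigr => E _; rewrite mulrCA.
Qed.

Lemma Ex_sum (I : finType) (Q : pred I) P (F : I -> {set T} -> R) :
  Ex P (fun E => \sum_(i | Q i) F i E) = \sum_(i | Q i) Ex P (F i).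
Proof.
rewrite /Ex exchange_big /=.
by apply: eq_bigr => E _; rewrite mulr_sumr.
Qed.

Lemma Ex_cst P c : Ex P (fun=> c) = c.
Proof.
rewrite -[RHS]mulr1 -[in LHS](mulr1 c) (ExZ P c (fun=> 1)); congr (_ * _).
elim/set_ind_setU1: P => [|P e eP IH]; first by rewrite Ex_set0.
by rewrite Ex_setU1 // IH; ring.
Qed.

Hypothesis p01 : 0 <= p <= 1.

Lemma wgt_ge0 P E : 0 <= wgt P E.
Proof.
by case/andP: p01 => p0 p1; apply: prodr_ge0 => e _; case: ifP => _ //; rewrite subr_ge0.
Qed.

Lemma le_Ex P f g : (forall E, E \subset P -> f E <= g E) -> Ex P f <= Ex P g.
Proof.
move=> fg; apply: ler_sum => E; rewrite inE => EP.
by apply: ler_wpM2l; [exact: wgt_ge0 | exact: fg].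
Qed.

Lemma Ex_ge0 P f : (forall E, E \subset P -> 0 <= f E) -> 0 <= Ex P f.
Proof. by move=> f0; rewrite -(Ex_cst P 0); apply: le_Ex. Qed.

Lemma Ex_sq_ge P f : Ex P f ^+ 2 <= Ex P (fun E => f E ^+ 2).
Proof.
set m := Ex P f.
have : 0 <= Ex P (fun E => (f E - m) ^+ 2) by apply: Ex_ge0 => E _; exact: sqr_ge0.
have -> : Ex P (fun E => (f E - m) ^+ 2) =
    Ex P (fun E => f E ^+ 2) + ((- 2 * m) * Ex P f + m ^+ 2).
  rewrite -ExZ -[X in _ = _ + (_ + X)](Ex_cst P) -!ExD.
  by apply: eq_Ex => E _; ring.
rewrite -/m; nra.
Qed.

(** Efron--Stein inequality, by induction on the coordinates: conditioning on
one coordinate splits the variance into the average of the two conditional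
variances and the variance of the conditional mean, and the latter is at most
[p] times the squared mean effect of that coordinate. *)
Lemma Ex_variance_le P f b : 0 <= b ->
  (forall e E, e \in P -> E \subset P -> `|f (e |: E)%SET - f (E :\ e)%SET| <= b) ->
  Ex P (fun E => f E ^+ 2) - Ex P f ^+ 2 <= #|P|%:R * p * b ^+ 2.
Proof.
move=> b0; elim/set_ind_setU1: P f => [|P e eP IH] f fb.
  by rewrite !Ex_set0 cards0 !mul0r subrr.
have [p0 p1] := andP p01.
rewrite !Ex_setU1 // cardsU1 eP natrD.
have E1 : Ex P (fun E => f (e |: E)%SET ^+ 2) - Ex P (fun E => f (e |: E)%SET) ^+ 2
    <= #|P|%:R * p * b ^+ 2.
  apply: (IH (fun E => f (e |: E)%SET)) => x E xP EP.
  have -> : (e |: (x |: E) = x |: (e |: E))%SET by rewrite setUCA.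
  have -> : (e |: (E :\ x) = (e |: E) :\ x)%SET.
    apply/setP => y; rewrite !inE; case: (y =P e) => [->|//=].
    by case: (e =P x) => // ex; rewrite ex xP in eP.
  apply: fb; first by rewrite !inE xP orbT.
  exact: setUS.
have E0 : Ex P (fun E => f E ^+ 2) - Ex P f ^+ 2 <= #|P|%:R * p * b ^+ 2.
  apply: IH => x E xP EP; apply: fb; first by rewrite !inE xP orbT.
  by apply: fintype.subset_trans EP _; exact: subsetUr.
have Ed : (Ex P (fun E => f (e |: E)%SET) - Ex P f) ^+ 2 <= b ^+ 2.
  have -> : Ex P (fun E => f (e |: E)%SET) - Ex P f =
      Ex P (fun E => f (e |: E)%SET - f E).
    by rewrite -mulN1r -ExZ -ExD; apply: eq_Ex => E _; ring.
  apply: le_trans (Ex_sq_ge _ _) _; rewrite -(Ex_cst P (b ^+ 2)).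
  apply: le_Ex => E EP; rewrite -[leLHS]real_normK ?num_real //.
  rewrite ler_pXn2r ?nnegrE ?normr_ge0 //.
  have {2}-> : E = (E :\ e)%SET.
    apply/setP => x; rewrite !inE; case: (x =P e) => [->|//] /=.
    by apply/negbTE; apply: contra eP; exact: fintype.subsetP.
  apply: fb; first by rewrite !inE eqxx.
  by apply: fintype.subset_trans EP _; exact: subsetUr.
move: E1 E0 Ed.
set x1 := Ex P (fun E => f (e |: E)%SET ^+ 2).
set x0 := Ex P (fun E => f E ^+ 2).
set y1 := Ex P (fun E => f (e |: E)%SET).
set y0 := Ex P f; set N : R := #|P|%:R => E1 E0 Ed.
have -> : p * x1 + (1 - p) * x0 - (p * y1 + (1 - p) * y0) ^+ 2 =
  p * (x1 - y1 ^+ 2) + (1 - p) * (x0 - y0 ^+ 2) + p * (1 - p) * (y1 - y0) ^+ 2.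
  ring.
have q0 : 0 <= 1 - p by rewrite subr_ge0.
have -> : (1%:R + N) * p * b ^+ 2 =
  p * (N * p * b ^+ 2) + (1 - p) * (N * p * b ^+ 2) + p * b ^+ 2 by ring.
apply: lerD; first by apply: lerD; apply: ler_wpM2l.
rewrite -mulrA; apply: ler_wpM2l => //.
apply: le_trans Ed; rewrite -[leRHS]mul1r; apply: ler_wpM2r; first exact: sqr_ge0.
by rewrite gerBl.
Qed.

Definition Pr P (A : pred {set T}) : R := Ex P (fun E => (A E)%:R).

Lemma markov_Pr P f (A : pred {set T}) a : 0 < a ->
  (forall E, E \subset P -> 0 <= f E) ->
  (forall E, E \subset P -> A E -> a <= f E) -> Pr P A <= Ex P f / a.
Proof.
move=> a0 f0 Af; rewrite ler_pdivlMr // mulrC -ExZ; apply: le_Ex => E EP.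
by case: (boolP (A E)) => AE /=; rewrite ?mulr1 ?mulr0; [exact: Af|exact: f0].
Qed.

(** Chebyshev's inequality about any point [m], with the variance bounded by
the effect [b] of a single coordinate. *)
Lemma chebyshev_Pr P f b m a : 0 <= b -> 0 < a ->
  (forall e E, e \in P -> E \subset P -> `|f (e |: E)%SET - f (E :\ e)%SET| <= b) ->
  Pr P (fun E => a < `|f E - m|) <=
    (#|P|%:R * p * b ^+ 2 + (Ex P f - m) ^+ 2) / a ^+ 2.
Proof.
move=> b0 a0 fb.
apply: (@le_trans _ _ (Ex P (fun E => (f E - m) ^+ 2) / a ^+ 2)).
  apply: markov_Pr; first exact: exprn_gt0.
    by move=> E _; exact: sqr_ge0.
  move=> E _ /ltW aE; rewrite -[leRHS]real_normK ?num_real //.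
  by rewrite ler_pXn2r ?nnegrE ?normr_ge0 ?(ltW a0).
rewrite ler_pM2r ?invr_gt0 ?exprn_gt0 //.
have := Ex_variance_le b0 fb.
have -> : Ex P (fun E => (f E - m) ^+ 2) =
    Ex P (fun E => f E ^+ 2) + ((- 2 * m) * Ex P f + m ^+ 2).
  rewrite -ExZ -[X in _ = _ + (_ + X)](Ex_cst P) -!ExD.
  by apply: eq_Ex => E _; ring.
nra.
Qed.

End ProductExpectation.

(** * The recolouring dynamics *)

Section Dynamics.

Variables (n : nat) (ext : bool) (L k : nat).
Implicit Types (E : graph n) (chi : colouring n) (u v x y : 'I_n).

(** The vertices [2 * i] and [2 * i + 1] share a class, so that the symmetry that
exchanges them preserves the dynamics. *)
Definition cls v : nat := v./2 %% k.

Definition bad chi u v : bool := (chi u == chi v) == ext.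

Definition bad_deg E chi v : nat := #|[pred u | adj E v u && bad chi u v]|.

Definition unhappy E chi v : bool := deg E v < 2 * bad_deg E chi v.

Definition conflict E v : bool := [exists u, adj E v u && (cls u == cls v)].

(** Low degree bounds the speed at which differences spread, and the absence of
conflicts makes the moves of one step independent of each other. *)
Definition frozen E v : bool := (L < deg E v) || conflict E v.

Definition moves E chi c v : bool :=
  [&& cls v == c, ~~ frozen E v & unhappy E chi v].

Definition class_step E chi c : colouring n :=
  [ffun v => chi v (+) moves E chi c v].

Fixpoint col E chi0 t : colouring n :=
  if t is t'.+1 then class_step E (col E chi0 t') (t' %% k) else chi0.

Definition flip1 chi v : colouring n := [ffun x => chi x (+) (x == v)].

Lemma adjC E u v : adj E u v = adj E v u.
Proof. by rewrite /adj finset.setUC. Qed.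

Lemma adj_irr E v : E \subset pairs n -> adj E v v = false.
Proof.
move=> EP; apply/negP => vv; have := fintype.subsetP EP _ vv.
by rewrite /pairs inE finset.setUid cards1.
Qed.

Lemma badC chi u v : bad chi u v = bad chi v u.
Proof. by rewrite /bad (eq_sym (chi u)). Qed.

Lemma bad_flip1 chi v u : u != v -> bad (flip1 chi v) u v = ~~ bad chi u v.
Proof.
rewrite /bad !ffunE eqxx => /negbTE ->; rewrite addbF.
by case: (chi u); case: (chi v); case: ext.
Qed.

Lemma bad_flip1_other chi v x y :
  x != v -> y != v -> bad (flip1 chi v) x y = bad chi x y.
Proof. by rewrite /bad !ffunE => /negbTE -> /negbTE ->; rewrite !addbF. Qed.

Lemma bad_deg_le E chi v : bad_deg E chi v <= deg E v.
Proof.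
apply: subset_leq_card; apply/fintype.subsetP => u.
by rewrite !inE => /andP[].
Qed.

Lemma eq_bad_deg E chi chi' v :
  (forall u, adj E v u -> bad chi u v = bad chi' u v) ->
  bad_deg E chi v = bad_deg E chi' v.
Proof.
move=> h; apply: eq_card => u; rewrite !inE.
by case: (boolP (adj E v u)) => //= /h.
Qed.

Lemma bad_deg_compl E chi chi' v :
  (forall u, adj E v u -> bad chi u v = ~~ bad chi' u v) ->
  bad_deg E chi v + bad_deg E chi' v = deg E v.
Proof.
move=> h; rewrite /deg /bad_deg -(cardID (fun u => bad chi u v) (fun u => adj E v u)).
congr (_ + _); apply: eq_card => u; rewrite !inE /in_mem //=.
by case: (boolP (adj E v u)) => [/h ->|]; rewrite /= ?negbK ?andbT ?andbF.
Qed.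

(** Flipping [v] turns its bad neighbours into good ones and conversely. *)
Lemma unhappy_flip1 E chi v : E \subset pairs n ->
  unhappy E chi v -> ~~ unhappy E (flip1 chi v) v.
Proof.
move=> EP; rewrite /unhappy -(@bad_deg_compl E chi (flip1 chi v) v); first lia.
move=> u uv; rewrite bad_flip1 ?negbK //; apply: contraTneq uv => ->.
by rewrite adj_irr.
Qed.

End Dynamics.

(** * The weighted energy *)

Section Energy.

Local Open Scope ring_scope.

Variables (R : realType) (n : nat) (ext : bool) (E : graph n).
Hypothesis EP : E \subset pairs n.
Variable phi : 'I_n -> R.
Hypothesis phi_ge0 : forall v, 0 <= phi v.
Hypothesis phi_slow : forall v u, adj E v u ->
  (deg E v)%:R * phi u <= (deg E v).+1%:R * phi v.
Implicit Types chi : colouring n.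

Definition bond (u v : 'I_n) : R := Num.max (phi u) (phi v).

(** Every bad edge is counted twice, once from each end. *)
Definition energy chi : R :=
  \sum_x \sum_(y | adj E x y && bad ext chi x y) bond x y.

Lemma bond_ge0 u v : 0 <= bond u v.
Proof. by rewrite /bond le_max phi_ge0. Qed.

Lemma energy_ge0 chi : 0 <= energy chi.
Proof. by apply: sumr_ge0 => x _; apply: sumr_ge0 => y _; exact: bond_ge0. Qed.

Lemma energy_le chi : energy chi <= 2 * \sum_x (deg E x)%:R * phi x.
Proof.
apply: (@le_trans _ _ (\sum_x \sum_(y | adj E x y) (phi x + phi y))).
  apply: ler_sum => x _; rewrite big_mkcondr; apply: ler_sum => y _.
  case: ifP => _; last by rewrite addr_ge0.
  by rewrite /bond ge_max lerDl lerDr !phi_ge0.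
rewrite (eq_bigr (fun x => (deg E x)%:R * phi x + \sum_(y | adj E x y) phi y)); last first.
  move=> x _; rewrite big_split; congr (_ + _).
  by rewrite sumr_const mulr_natl.
rewrite big_split /= mulr_natl mulr2n lerD2l.
rewrite (exchange_big_dep predT) //=; apply: ler_sum => x _.
rewrite (eq_bigl (fun y => adj E x y)); last by move=> y; rewrite adjC.
by rewrite sumr_const mulr_natl.
Qed.

(** The terms that involve [v], apart from the rest, which a flip of [v] does
not change. *)
Lemma energy_split chi v : energy chi =
  2 * \sum_(y | adj E v y && bad ext chi y v) bond v y +
  \sum_(x | x != v) \sum_(y | (y != v) && (adj E x y && bad ext chi x y)) bond x y.
Proof.
rewrite /energy (bigD1 v) //= mulr_natl mulr2n -addrA; congr (_ + _).
  by apply: eq_bigl => y; rewrite badC.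
have -> : \sum_(y | adj E v y && bad ext chi y v) bond v y =
    \sum_(x | x != v) if adj E x v && bad ext chi x v then bond x v else 0.
  rewrite -big_mkcondr /=; apply: eq_big => y.
    rewrite [in RHS]adjC; case: eqP => //= ->.
    by rewrite adj_irr.
  by move=> _; rewrite /bond maxC.
rewrite -big_split; apply: eq_bigr => x xv.
rewrite big_mkcond (bigD1 v) //=; congr (_ + _).
by rewrite big_mkcondr.
Qed.

(** The weights of the edges at [v] differ by a factor of at most
[1 + 1 / deg v], while an unhappy vertex has at least one bad neighbour more
than good ones: the weighted majority is still bad. *)
Lemma energy_flip1 chi v : unhappy ext E chi v ->
  energy (flip1 chi v) + phi v <= energy chi.
Proof.
rewrite /unhappy => un; rewrite !(energy_split _ v).
have -> : \sum_(x | x != v) \sum_(y | (y != v) && (adj E x y && bad ext (flip1 chi v) x y)) bond x y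
  = \sum_(x | x != v) \sum_(y | (y != v) && (adj E x y && bad ext chi x y)) bond x y.
  apply: eq_bigr => x xv; apply: eq_bigl => y.
  by case: (boolP (y == v)) => //= yv; rewrite bad_flip1_other.
rewrite addrAC lerD2r.
set d := deg E v; set b := bad_deg ext E chi v.
have d0 : (0 < d)%N by have := bad_deg_le ext E chi v; rewrite -/d -/b; lia.
set B := \sum_(y | _) _; set B' := \sum_(y | _ && bad ext chi y v) _.
have hB' : b%:R * phi v <= B'.
  have -> : b%:R * phi v = \sum_(y | adj E v y && bad ext chi y v) phi v.
    by rewrite sumr_const mulr_natl.
  by apply: ler_sum => y _; rewrite /bond le_max lexx.
have hB : d%:R * B <= (d - b)%:R * (d.+1%:R * phi v).
  rewrite [in (d - b)%N]/d -(@bad_deg_compl n ext E (flip1 chi v) chi v); last first.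
    move=> u uv; rewrite bad_flip1 //; apply: contraTneq uv => ->.
    by rewrite adj_irr.
  rewrite addnK mulr_sumr.
  have -> : (bad_deg ext E (flip1 chi v) v)%:R * (d.+1%:R * phi v) =
      \sum_(y | adj E v y && bad ext (flip1 chi v) y v) d.+1%:R * phi v.
    by rewrite sumr_const mulr_natl.
  apply: ler_sum => y /andP[vy _].
  rewrite /bond; case: (lerP (phi v) (phi y)) => _; first exact: phi_slow.
  by apply: ler_wpM2r; rewrite // ler_nat.
have bd : (b <= d)%N by exact: bad_deg_le.
have p0 := phi_ge0 v.
have dR : 0 < d%:R :> R by rewrite ltr0n.
rewrite -(ler_pM2l dR).
have H1 : (2 * (d - b) * d.+1 + d)%:R * phi v <= (2 * d * b)%:R * phi v.
  apply: ler_wpM2r => //; rewrite ler_nat.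
  have : (2 * (d - b) <= d.-1)%N by lia.
  move/(leq_mul (leqnn d.+1)); have : (d * d.+1 <= d * (2 * b))%N by rewrite leq_mul //; lia.
  nia.
have H2 : d%:R * (b%:R * phi v) <= d%:R * B' by rewrite ler_pM2l.
move: H1; rewrite natrD !natrM; nra.
Qed.

End Energy.

(** * A slowly varying potential *)

Section Potential.

Local Open Scope ring_scope.

Variables (R : realType) (n : nat).
Implicit Types (E : graph n) (x v u : 'I_n) (l : seq 'I_n).

Definition damping E v : R := (deg E v)%:R / (deg E v).+1%:R.

(** A path is listed backwards: it ends at [x] and its source, whose squared
degree it carries, is [last x l]. *)
Definition path_value E x l : R :=
  (\prod_(v <- x :: l) damping E v) * (deg E (last x l)).+1%:R ^+ 2.

Definition simple_path E x l : bool := path (adj E) x l && uniq (x :: l).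

Definition potential E x : R :=
  \big[Num.max/0]_(j < n.+1)
    \big[Num.max/0]_(t : j.-tuple 'I_n | simple_path E x t) path_value E x t.

Lemma damping_ge0 E v : 0 <= damping E v.
Proof. exact: divr_ge0. Qed.

Lemma damping_le1 E v : damping E v <= 1.
Proof. by rewrite ler_pdivrMr ?ltr0n // mul1r ler_nat. Qed.

Lemma damping_deg E v : (deg E v).+1%:R * damping E v = (deg E v)%:R.
Proof. by rewrite mulrC divfK // pnatr_eq0. Qed.

Lemma path_value_ge0 E x l : 0 <= path_value E x l.
Proof. by rewrite mulr_ge0 ?prodr_ge0 ?exprn_ge0 // => v _; exact: damping_ge0. Qed.

Lemma potential_ge0 E x : 0 <= potential E x.
Proof. exact: bigmax_ge_id. Qed.

Lemma path_value_le E x l : simple_path E x l -> path_value E x l <= potential E x.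
Proof.
move=> xl; have sl : (size l < n.+1)%N.
  have /andP[_ /card_uniqP] := xl; rewrite /= => h.
  by have := max_card (mem (x :: l)); rewrite h card_ord => /ltnW; rewrite ltnS.
apply: le_trans (le_bigmax_cond _ _ (j := Ordinal sl) _) => //=.
exact: (le_bigmax_cond _ (fun t : (size l).-tuple 'I_n => path_value E x t)
  (j := in_tuple l)).
Qed.

Lemma potential_le E x c : 0 <= c ->
  (forall l, simple_path E x l -> path_value E x l <= c) -> potential E x <= c.
Proof.
by move=> c0 h; apply: bigmax_le => // j _; apply: bigmax_le => // t; exact: h.
Qed.

(** A simple path from [u] either extends to [v], or visits [v] and has a tail
that starts there; every factor dropped in the latter case is at most 1. *)
Lemma potential_slow E v u : adj E v u ->
  (deg E v)%:R * potential E u <= (deg E v).+1%:R * potential E v.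
Proof.
move=> vu; have d0 : (0 < deg E v)%N by apply/card_gt0P; exists u.
rewrite -ler_pdivlMl ?ltr0n //.
apply: potential_le => [|l ul]; first by rewrite !mulr_ge0 ?invr_ge0 ?potential_ge0.
rewrite ler_pdivlMl ?ltr0n // -damping_deg -mulrA ler_pM2l ?ltr0n //.
have [vl|vl] := boolP (v \in u :: l); last first.
  have -> : damping E v * path_value E u l = path_value E v (u :: l).
    by rewrite /path_value [in RHS]big_cons mulrA.
  by apply: path_value_le; move: ul; rewrite /simple_path /= vu => /andP[-> ->]; rewrite vl.
apply: (@le_trans _ _ (path_value E u l)).
  by rewrite -[leRHS]mul1r ler_wpM2r ?path_value_ge0 ?damping_le1.
case: (splitPl vl) ul => p1 p2 lv /andP[]; rewrite cat_path lv -cat_cons => /andP[_ pp2].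
rewrite lastI lv cat_rcons cat_uniq => /and3P[_ _ up2].
apply: le_trans (_ : path_value E v p2 <= _); last first.
  by apply: path_value_le; rewrite /simple_path pp2.
rewrite /path_value last_cat lv -cat_cons lastI lv cat_rcons big_cat /=.
rewrite -mulrA -[leRHS]mul1r ler_wpM2r ?path_value_ge0 //.
by apply: prodr_ile1 => i _; rewrite damping_ge0 damping_le1.
Qed.

End Potential.

(** * The mean of the potential *)

Section PathCounting.

Local Open Scope ring_scope.

Variable R : realType.

(** Each factor [d / d.+1] is bounded away from 1 while [d] is small, and
[2 ^+ d] makes up for it when [d] is large. *)
Lemma damping_pow_small (delta : R) : 0 < delta ->
  exists2 s, (0 < s)%N &
    forall d : nat, (d%:R / d.+1%:R) ^+ s <= delta * 2 ^+ d.
Proof.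
move=> dl0.
have [d0 hd0] : exists d0 : nat, 1 <= delta * 2 ^+ d0.
  exists (Num.truncn (delta^-1)).+1.
  rewrite -ler_pdivrMl // mulr1.
  have := truncnS_gt delta^-1 => /ltW /le_trans; apply.
  by rewrite -natrX ler_nat ltnW // ltn_expl.
have c01 : `|d0%:R / d0.+1%:R : R| < 1.
  by rewrite ger0_norm ?divr_ge0 // ltr_pdivrMr ?ltr0n // mul1r ltr_nat.
have := cvgr_lt 0 (cvg_expr c01) _ dl0.
move=> [s0 _ /(_ s0.+1 (leqnSn _))] /= hs.
exists s0.+1 => // d; have q0 : 0 <= d%:R / d.+1%:R :> R by rewrite divr_ge0.
have [dd|dd] := leqP d0 d.
  apply: (@le_trans _ _ 1).
    by apply: exprn_ile1 => //; rewrite ler_pdivrMr ?ltr0n // mul1r ler_nat.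
  by apply: le_trans hd0 _; rewrite ler_wpM2l ?(ltW dl0) // ler_weXn2l // ler1n.
apply: (@le_trans _ _ ((d0%:R / d0.+1%:R) ^+ s0.+1)).
  apply: lerXn2r; rewrite ?nnegrE ?divr_ge0 //.
  rewrite ler_pdivrMr ?ltr0n // mulrAC ler_pdivlMr ?ltr0n // -!natrM ler_nat.
  nia.
apply: (@le_trans _ _ delta).
  by exact: ltW.
by rewrite ler_peMr ?(ltW dl0) // -natrX ler1n expn_gt0.
Qed.

(** [d.+1 ^ m] is at most the falling factorial [m`! * 'C(d + m, m)]. *)
Lemma pow_le_exp2 m d : (d.+1 ^ m <= m`! * 2 ^ (d + m))%N.
Proof.
apply: (@leq_trans ((d + m) ^_ m)).
  elim: m => // m IH; rewrite addnS ffactnSr expnSr.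
  have -> : ((d + m).+1 ^_ m * ((d + m).+1 - m) = d.+1 * (d + m).+1 ^_ m)%N.
    by rewrite mulnC; congr (_ * _)%N; lia.
  rewrite mulnC leq_mul2l; apply/orP; right; apply: leq_trans IH _.
  by rewrite !ffact_prod; apply: leq_prod => i _; lia.
rewrite -bin_ffact mulnC leq_mul2l; apply/orP; right.
have := Pascal 1 1 (d + m); rewrite addn1 => ->.
have hm : (m < (d + m).+1)%N by lia.
rewrite (bigD1 (Ordinal hm)) //= !exp1n !muln1; exact: leq_addr.
Qed.

Variables (n : nat).
Implicit Types (E : graph n) (x v u : 'I_n) (l : seq 'I_n) (e : {set 'I_n}).

Definition hits l e : nat := count (fun v => v \in e) l.

Fixpoint path_edges x l : seq {set 'I_n} :=
  if l is y :: l' then [set x; y]%SET :: path_edges y l' else [::].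

Lemma size_path_edges x l : size (path_edges x l) = size l.
Proof. by elim: l x => //= y l IH x; rewrite IH. Qed.

Lemma path_edges_sub x l e v : e \in path_edges x l -> v \in e -> v \in x :: l.
Proof.
elim: l x => //= y l IH x; rewrite inE => /orP[/eqP ->|/IH h /h h'].
  by rewrite !inE => /orP[] /eqP ->; rewrite eqxx ?orbT.
by rewrite inE h' orbT.
Qed.

Lemma uniq_path_edges x l : uniq (x :: l) -> uniq (path_edges x l).
Proof.
elim: l x => //= y l IH x /andP[xl yl]; rewrite IH // andbT.
apply: contra xl => h; apply: (path_edges_sub h); exact: set21.
Qed.

Lemma path_edges_pairs x l e : uniq (x :: l) -> e \in path_edges x l -> e \in pairs n.
Proof.
elim: l x => //= y l IH x /andP[xl yl]; rewrite inE => /orP[/eqP ->|]; last exact: IH.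
by rewrite inE cards2; move: xl; rewrite inE negb_or => /andP[-> _].
Qed.

Lemma path_edges_in E x l e : path (adj E) x l -> e \in path_edges x l -> e \in E.
Proof.
elim: l x => //= y l IH x /andP[xy yl]; rewrite inE => /orP[/eqP ->//|]; exact: IH.
Qed.

Lemma deg_le_incident E v : (deg E v <= \sum_(e in E) (v \in e))%N.
Proof.
have -> : (\sum_(e in E) (v \in e) = #|[set e in E | v \in e]%SET|)%N.
  rewrite -sum1_card big_mkcond [RHS]big_mkcond /=; apply: eq_bigr => e _.
  by rewrite inE; case: (e \in E) => //=; case: (v \in e).
have inj : {in [pred u | adj E v u] &, injective (fun u => [set v; u]%SET)}.
  move=> u u' _ _ h.
  have : u' \in [set v; u]%SET by rewrite h set22.
  have : u \in [set v; u']%SET by rewrite -h set22.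
  by rewrite !inE => /orP[/eqP->|/eqP->//] /orP[/eqP->|/eqP->].
rewrite /deg -(card_in_imset inj); apply: subset_leq_card.
apply/fintype.subsetP => e /imsetP[u vu ->]; rewrite inE set21 andbT.
by move: vu; rewrite inE.
Qed.

(** An edge counts once for each of its ends on the path. *)
Lemma sum_deg_le E l : E \subset pairs n ->
  (\sum_(v <- l) deg E v <= \sum_(e in pairs n) (e \in E) * hits l e)%N.
Proof.
move=> EP; apply: (@leq_trans (\sum_(v <- l) \sum_(e in E) (v \in e))).
  by apply: leq_sum => v _; exact: deg_le_incident.
rewrite exchange_big /= [X in (_ <= X)%N](bigID (mem E)) /=; apply: leq_trans (leq_addr _ _).
rewrite [X in (_ <= X)%N](eq_bigl (mem E)); last first.
  by move=> e /=; apply: andb_idl; exact: fintype.subsetP.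
apply: leq_sum => e eE; rewrite eE mul1n /hits.
by elim: l => [|v l IH]; rewrite ?big_nil //= big_cons leq_add2l.
Qed.

Lemma hits_le2 l e : uniq l -> e \in pairs n -> (hits l e <= 2)%N.
Proof.
move=> ul; rewrite inE => /eqP <-; rewrite /hits -size_filter.
rewrite -(card_uniqP (filter_uniq _ ul)); apply: subset_leq_card.
by apply/fintype.subsetP => v; rewrite mem_filter => /andP[].
Qed.

Lemma card_hit_le l : (#|[set e in pairs n | (0 < hits l e)%N]%SET| <= size l * n)%N.
Proof.
apply: (@leq_trans #|[set [set w.1; w.2] | w in setX [set v in l] [set: 'I_n]]%SET|).
  apply: subset_leq_card; apply/fintype.subsetP => e; rewrite !inE -has_count.
  move=> /andP[e2 /hasP[v vl ve]].
  have [u uv ->] : exists2 u, u != v & e = [set v; u]%SET.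
    case/cards2P: e2 ve => [a [b [ab ->]]]; rewrite !inE => /orP[] /eqP ->.
      by exists b; rewrite // eq_sym.
    by exists a => //; rewrite finset.setUC.
  by apply/imsetP; exists (v, u); rewrite // in_setX !inE vl.
apply: leq_trans (leq_imset_card _ _) _; rewrite cardsX cardsT card_ord leq_mul2r.
by rewrite cardsE card_size orbT.
Qed.

Variables (p C : R).
Hypothesis p01 : 0 <= p <= 1.
Hypothesis npC : n%:R * p <= C.

(** Expand the degrees into independent edge indicators: an edge of the path
contributes [p] and at most [8 ^+ 2], any other edge that meets the path at
most [1 + 63 p], and there are at most [n] edges at each vertex. *)
Lemma Ex_path_le x l : uniq (x :: l) ->
  Ex p (pairs n) (fun E => (path (adj E) x l)%:R
     * 8 ^+ (\sum_(v <- x :: l) deg E v)%N)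
  <= (64 * p) ^+ (size l) * expR (63 * C) ^+ (size l).+1.
Proof.
move=> ul; have [p0 p1] := andP p01.
pose g e (b : bool) : R :=
  if b then 8 ^+ (hits (x :: l) e) else (e \notin path_edges x l)%:R.
apply: (@le_trans _ _ (Ex p (pairs n) (fun E => \prod_(e in pairs n) g e (e \in E)))).
  apply: le_Ex => // E EP; case: (boolP (path _ _ _)) => pl; last first.
    rewrite mul0r; apply: prodr_ge0 => e _; by rewrite /g; case: ifP.
  rewrite mul1r; apply: (@le_trans _ _ (8 ^+ (\sum_(e in pairs n) (e \in E) * hits (x :: l) e)%N)).
    by rewrite ler_weXn2l ?sum_deg_le // ler1n.
  rewrite -prodrXr; apply: ler_prod => e eP; rewrite exprn_ge0 //= /g.
  case: ifP => eE; first by rewrite mul1n.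
  rewrite mul0n expr0; case: (boolP (e \in path_edges x l)) => // /(path_edges_in pl).
  by rewrite eE.
rewrite Ex_prod.
apply: (@le_trans _ _ (\prod_(e in pairs n)
   ((if e \in path_edges x l then 64 * p else 1) *
    (if (0 < hits (x :: l) e)%N then 1 + 63 * p else 1)))).
  apply: ler_prod => e eP; rewrite /g.
  have h2 := hits_le2 ul eP.
  have h8 : (8 : R) ^+ (hits (x :: l) e) <= 64.
    have -> : (64 : R) = 8 ^+ 2 by rewrite -natrX.
    by rewrite ler_weXn2l // ler1n.
  have h80 : 0 <= (8 : R) ^+ (hits (x :: l) e) by exact: exprn_ge0.
  apply/andP; split.
    by rewrite addr_ge0 // mulr_ge0 // ?subr_ge0 //.
  case: (boolP (e \in path_edges x l)) => /= [epe|_].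
    case: ifP => _; nra.
  case: posnP => [->|_]; first by rewrite expr0; lra.
  nra.
rewrite big_split /=; apply: ler_pM.
- by apply: prodr_ge0 => e _; case: ifP => _ //; rewrite mulr_ge0.
- by apply: prodr_ge0 => e _; case: ifP => _ //; rewrite addr_ge0 // mulr_ge0.
- rewrite -big_mkcondr /= prodr_const.
  have -> : #|[pred e | (e \in pairs n) && (e \in path_edges x l)]| = size l.
    rewrite -(size_path_edges x l) -(card_uniqP (uniq_path_edges ul)).
    apply: eq_card => e; rewrite !inE; apply: andb_idl => epe.
    by have := path_edges_pairs ul epe; rewrite inE.
  by [].
rewrite -big_mkcondr /= prodr_const.
apply: (@le_trans _ _ ((1 + 63 * p) ^+ ((size l).+1 * n))).
  apply: ler_weXn2l; first by rewrite lerDl mulr_ge0.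
  by have := card_hit_le (x :: l); rewrite cardsE.
rewrite mulnC exprM; apply: lerXn2r; rewrite ?nnegrE ?exprn_ge0 ?expR_ge0 //.
  by rewrite addr_ge0 // mulr_ge0.
apply: (@le_trans _ _ (expR (63 * p) ^+ n)).
  apply: lerXn2r; rewrite ?nnegrE ?expR_ge0 ?expR_ge1Dx //.
  by rewrite addr_ge0 // mulr_ge0.
by rewrite -expRM_natl ler_expR mulrCA ler_wpM2l.
Qed.

End PathCounting.

Section PotentialExpectation.

Local Open Scope ring_scope.

Variables (R : realType) (n : nat).
Implicit Types (E : graph n) (x v u : 'I_n) (l : seq 'I_n).

Lemma sum_deg_pow_le E x l : (2 : R) ^+ deg E x * 2 ^+ deg E (last x l)
  * 2 ^+ (\sum_(v <- x :: l) deg E v)%N <= 8 ^+ (\sum_(v <- x :: l) deg E v)%N.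
Proof.
have mem_le v : v \in x :: l -> (deg E v <= \sum_(v <- x :: l) deg E v)%N.
  by move=> vl; rewrite (big_rem v) //= leq_addr.
have -> : (8 : R) = 2 ^+ 3 by rewrite -natrX.
rewrite -exprM -!exprD ler_weXn2l ?ler1n //.
have := mem_le x (mem_head x l).
have : (deg E (last x l) <= \sum_(v <- x :: l) deg E v)%N by apply: mem_le; exact: mem_last.
by move: (\sum_(_ <- _) _)%N => S; lia.
Qed.

(** A large power [s] makes each vertex of the path contribute a factor [delta]
at the price of a factor exponential in its degree. *)
Lemma path_value_pow_le (delta : R) s E x l : 0 <= delta ->
  (forall d : nat, (d%:R / d.+1%:R) ^+ s <= delta * 2 ^+ d) ->
  (deg E x)%:R * path_value R E x l ^+ s <=
  ((2 * s)`! * 2 ^ (2 * s))%:R * delta ^+ (size l).+1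
    * 8 ^+ (\sum_(v <- x :: l) deg E v)%N.
Proof.
move=> dl0 hs; rewrite /path_value exprMn -exprM -prodrXl.
have h1 : \prod_(v <- x :: l) damping R E v ^+ s <=
    delta ^+ (size l).+1 * 2 ^+ (\sum_(v <- x :: l) deg E v)%N.
  apply: (@le_trans _ _ (\prod_(v <- x :: l) (delta * 2 ^+ deg E v))).
    by apply: ler_prod => v _; rewrite exprn_ge0 ?damping_ge0 //= hs.
  rewrite big_split /= -prodrXr big_const_seq count_predT iter_mulr mulr1.
  by rewrite lexx.
have h2 : (deg E (last x l)).+1%:R ^+ (2 * s) <=
    ((2 * s)`! * 2 ^ (2 * s))%:R * 2 ^+ deg E (last x l) :> R.
  rewrite -!natrX -natrM ler_nat -mulnA -expnD addnC; exact: pow_le_exp2.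
have h3 : (deg E x)%:R <= 2 ^+ deg E x :> R.
  by rewrite -natrX ler_nat ltnW // ltn_expl.
have p1 : 0 <= \prod_(v <- x :: l) damping R E v ^+ s.
  by apply: prodr_ge0 => v _; rewrite exprn_ge0 ?damping_ge0.
move: ((2 * s)`! * 2 ^ (2 * s))%N h2 => N h2.
set c : R := N%:R in h2 *; have c0 : 0 <= c by exact: ler0n.
apply: (@le_trans _ _ (2 ^+ deg E x *
  ((delta ^+ (size l).+1 * 2 ^+ (\sum_(v <- x :: l) deg E v)%N) *
   (c * 2 ^+ deg E (last x l))))).
  by do 2?[apply: ler_pM => //]; rewrite ?mulr_ge0 ?exprn_ge0.
have rearrange (a1 a2 a3 a4 a5 : R) :
  a1 * ((a2 * a3) * (a4 * a5)) = a4 * a2 * (a1 * a5 * a3) by ring.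
rewrite rearrange.
by rewrite ler_wpM2l ?sum_deg_pow_le // mulr_ge0 ?exprn_ge0.
Qed.

(** The maximum is bounded by a sum of [s]-th powers; the term 1 covers values
below 1. *)
Lemma potential_le_sum_pow s E x : (0 < s)%N ->
  potential R E x <= 1 + \sum_(j < n.+1) \sum_(t : j.-tuple 'I_n | simple_path E x t)
    path_value R E x t ^+ s.
Proof.
move=> s0; have pos l : 0 <= path_value R E x l ^+ s.
  by rewrite exprn_ge0 ?path_value_ge0.
have le_pow l : path_value R E x l <= 1 + path_value R E x l ^+ s.
  have [h|/ltW h] := leP (path_value R E x l) 1.
    by apply: le_trans h _; rewrite lerDl.
  by apply: (@le_trans _ _ (path_value R E x l ^+ s)); rewrite ?lerDr ?ler_eXnr.
apply: bigmax_le => [|j _].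
  by rewrite addr_ge0 // sumr_ge0 // => j _; rewrite sumr_ge0.
apply: bigmax_le => [|t xt].
  by rewrite addr_ge0 // sumr_ge0 // => i _; rewrite sumr_ge0.
apply: le_trans (le_pow _) _; rewrite lerD2l (bigD1 j) //= (bigD1 t) //=.
rewrite -addrA lerDl addr_ge0 // ?sumr_ge0 // => i _.
by rewrite sumr_ge0.
Qed.

End PotentialExpectation.

Section PotentialMean.

Local Open Scope ring_scope.

Variable R : realType.

Lemma geom_half_le (q : R) m : 0 <= q -> q <= 2^-1 -> \sum_(j < m) q ^+ j <= 2.
Proof.
move=> q0 qh; have q1 : q != 1 by apply/eqP => q1; move: qh; rewrite q1; lra.
suff h : (1 - q) * \sum_(j < m) q ^+ j <= 1.
  have s0 : 0 <= \sum_(j < m) q ^+ j by apply: sumr_ge0 => j _; exact: exprn_ge0.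
  nra.
have := subrX1 q m; have := exprn_ge0 m q0; nra.
Qed.

Lemma Ex_deg_pow_le n (p C : R) (x : 'I_n) : 0 <= p <= 1 -> n%:R * p <= C ->
  Ex p (pairs n) (fun E => 8 ^+ deg E x) <= expR (63 * C).
Proof.
move=> p01 npC; have := Ex_path_le p01 npC (l := [::]) (x := x) isT.
rewrite expr0 mul1r expr1; apply: le_trans.
by apply: le_Ex => // E _; rewrite /= mul1r big_seq1.
Qed.

(** There are at most [n ^ j] sequences of [j] vertices to continue [x] to a
path, which is present with probability [p ^ j]. As [n * p] is bounded, the factor
[delta] per vertex makes the series over [j] geometric. *)
Lemma Ex_potential_le (C : R) : 0 <= C -> exists K,
  forall n (p : R), 0 <= p <= 1 -> n%:R * p <= C ->
  Ex p (pairs n) (fun E => \sum_x (deg E x)%:R * potential R E x) <= K * n%:R.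
Proof.
move=> C0; set A := expR (63 * C).
have A0 : 0 < A by exact: expR_gt0.
pose delta := (128 * (C + 1) * A)^-1.
have dl0 : 0 < delta by rewrite invr_gt0 !mulr_gt0 //; lra.
have dlA : delta * A * (128 * (C + 1)) = 1.
  rewrite /delta -mulrA [A * _]mulrC mulVf // gt_eqF // !mulr_gt0 //; lra.
have [s s0 hs] := damping_pow_small dl0.
pose c : R := ((2 * s)`! * 2 ^ (2 * s))%:R.
have c0 : 0 <= c by exact: ler0n.
exists (A + 2 * (c * (delta * A))); move=> n p p01 npC; have [p0 p1] := andP p01.
apply: (@le_trans _ _ (\sum_(x < n) (A + 2 * (c * (delta * A))))); last first.
  by rewrite sumr_const card_ord mulr_natr.
rewrite Ex_sum; apply: ler_sum => x _.
pose F (j : nat) (t : j.-tuple 'I_n) E : R :=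
  c * delta ^+ j.+1 * ((path (adj E) x t)%:R * 8 ^+ (\sum_(v <- x :: t) deg E v)%N).
apply: (@le_trans _ _ (Ex p (pairs n) (fun E => 8 ^+ deg E x +
  \sum_(j < n.+1) \sum_(t : j.-tuple 'I_n | uniq (x :: t)) F j t E))).
  apply: le_Ex => // E EP.
  have h := @potential_le_sum_pow R n s E x s0.
  apply: le_trans (ler_wpM2l (ler0n R (deg E x)) h) _.
  rewrite mulrDr mulr1; apply: lerD.
    by rewrite -natrX ler_nat ltnW // ltn_expl.
  rewrite mulr_sumr; apply: ler_sum => j _; rewrite mulr_sumr.
  rewrite big_mkcond [leRHS]big_mkcond; apply: ler_sum => t _.
  rewrite /simple_path; case: (uniq (x :: t)); rewrite ?andbF // andbT /F.
  case: ifP => [xt|_]; last by rewrite mul0r mulr0.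
  rewrite mul1r; apply: le_trans (path_value_pow_le _ _ _ (ltW dl0) hs) _.
  by rewrite size_tuple.
rewrite ExD; apply: lerD; first exact: Ex_deg_pow_le.
rewrite Ex_sum; set q := 64 * C * (delta * A).
have q0 : 0 <= q by rewrite !mulr_ge0 // ltW.
have qh : q <= 2^-1.
  have : 0 <= delta * A by rewrite mulr_ge0 // ltW.
  rewrite /q; nra.
apply: (@le_trans _ _ (\sum_(j < n.+1) (c * (delta * A)) * q ^+ j)); last first.
  rewrite -mulr_sumr mulrC ler_wpM2r ?geom_half_le // !mulr_ge0 // ltW //.
apply: ler_sum => j _; rewrite Ex_sum.
apply: (@le_trans _ _ (\sum_(t : j.-tuple 'I_n)
    c * delta ^+ j.+1 * ((64 * p) ^+ j * A ^+ j.+1))).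
  rewrite big_mkcond; apply: ler_sum => t _; case: ifP => [ut|_]; last first.
    by rewrite !mulr_ge0 ?exprn_ge0 ?(ltW A0) ?(ltW dl0) // mulr_ge0.
  rewrite /F ExZ ler_wpM2l ?mulr_ge0 ?exprn_ge0 ?(ltW dl0) //.
  by have := Ex_path_le p01 npC ut; rewrite size_tuple.
rewrite sumr_const card_tuple card_ord -[leLHS]mulr_natl natrX.
rewrite [leLHS](_ : _ = (c * (delta * A)) * (64 * (n%:R * p) * (delta * A)) ^+ j); last first.
  by rewrite !exprMn !exprS; ring.
rewrite ler_wpM2l ?mulr_ge0 ?(ltW A0) ?(ltW dl0) // lerXn2r // ?nnegrE.
- by rewrite !mulr_ge0 ?(ltW A0) ?(ltW dl0).
- by rewrite /q ler_wpM2r ?mulr_ge0 ?(ltW A0) ?(ltW dl0) // ler_wpM2l.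
Qed.

End PotentialMean.

(** * The worklist process *)

Section FlipCost.

Local Open Scope ring_scope.

Variables (R : realType) (n : nat) (E : graph n).

(** A flip of [v] puts its neighbours on the worklist, and each of them will
have its own neighbourhood inspected. *)
Definition flip_cost (v : 'I_n) : nat := \sum_(u | adj E v u) (deg E u).+1.

Lemma deg_le_flip_cost v : (deg E v <= flip_cost v)%N.
Proof. by rewrite /deg /flip_cost -sum1_card; apply: leq_sum. Qed.

Lemma deg_sq_le_potential v : (deg E v)%:R ^+ 2 <= potential R E v.
Proof.
have : path_value R E v [::] <= potential R E v by exact: path_value_le.
rewrite /path_value big_seq1 /= expr2 mulrA [damping R E v * _]mulrC damping_deg.
apply: le_trans; rewrite expr2 ler_wpM2l // ler_nat //.
Qed.

(** [deg v * (deg u).+1] is at most the larger of the two squares, and both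
squares are bounded by the potential of [v], which is close to that of [u]. *)
Lemma flip_cost_le v : (flip_cost v)%:R <= 4 * potential R E v.
Proof.
rewrite /flip_cost natr_sum.
have [d0|d0] := posnP (deg E v).
  rewrite big_pred0 ?mulr_ge0 ?potential_ge0 // => u.
  by have /card0_eq/(_ u) := d0; rewrite inE.
have dR : 0 < (deg E v)%:R :> R by rewrite ltr0n.
rewrite -(ler_pM2l dR) mulr_sumr.
have -> : (deg E v)%:R * (4 * potential R E v) = \sum_(u | adj E v u) 4 * potential R E v.
  by rewrite sumr_const mulr_natl.
apply: ler_sum => u vu.
have hv := deg_sq_le_potential v.
have du : (0 < deg E u)%N by apply/card_gt0P; exists v; rewrite inE adjC.
have h1 : path_value R E u [::] <= potential R E u by exact: path_value_le.
have h2 := potential_slow R vu.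
have h3 : (deg E u).+1%:R * (deg E u)%:R <= potential R E u.
  move: h1; rewrite /path_value big_seq1 /= expr2 mulrA [damping R E u * _]mulrC damping_deg.
  by rewrite mulrC.
have h4 : (deg E v).+1%:R <= 2 * (deg E v)%:R :> R by rewrite -natrM ler_nat; lia.
have h5 : (deg E u).+1%:R <= 2 * (deg E u)%:R :> R by rewrite -natrM ler_nat; lia.
have pv := potential_ge0 R E v; have pu := potential_ge0 R E u.
have h6 : potential R E u <= 2 * potential R E v.
  rewrite -(ler_pM2l dR); apply: le_trans h2 _.
  by rewrite mulrA [_ * 2]mulrC ler_wpM2r.
have s0 : 0 <= (deg E u).+1%:R :> R by [].
have h7 : (deg E u).+1%:R ^+ 2 <= 2 * potential R E u by nra.
have := sqr_ge0 ((deg E v)%:R - (deg E u).+1%:R : R); nra.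
Qed.

Lemma deg_le v : (deg E v <= n)%N.
Proof. by rewrite -[leqRHS]card_ord; exact: max_card. Qed.

Lemma potential_le_sq v : potential R E v <= n.+1%:R ^+ 2.
Proof.
apply: potential_le => // l _; rewrite /path_value.
apply: (@le_trans _ _ (1 * (deg E (last v l)).+1%:R ^+ 2)).
  by rewrite ler_wpM2r // prodr_ile1 // => i _; rewrite damping_ge0 damping_le1.
by rewrite mul1r lerXn2r ?nnegrE // ler_nat ltnS deg_le.
Qed.

End FlipCost.

Section Process.

Variables (n : nat) (ext : bool) (L k : nat) (E : graph n).
Hypothesis k0 : 0 < k.
Hypothesis EP : E \subset pairs n.
Implicit Types (u v : 'I_n) (l : seq 'I_n) (c : nat) (b : nat -> seq 'I_n).

(** The state of the worklist algorithm: the current colouring and, for every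
class, the list of the vertices that are waiting for a visit. The last three
fields only serve the analysis of the running time, except that [moved] decides
when to stop: the degrees of the vertices recoloured in the current sweep, the
flip costs of all recolourings so far, and the sizes of the neighbourhoods
inspected so far. *)
Record process_state := ProcessState {
  chi : colouring n;
  bucket : nat -> seq 'I_n;
  moved : nat;
  spent : nat;
  inspected : nat }.
Implicit Types a : process_state.

Definition nb v : seq 'I_n := [seq u <- enum 'I_n | adj E v u].

Definition push b v : nat -> seq 'I_n :=
  fun c => if c == cls k v then v :: b c else b c.

Definition recolour a v : process_state :=
  ProcessState (flip1 (chi a) v) (foldl push (bucket a) (nb v))
    (moved a + deg E v) (spent a + flip_cost E v) (inspected a).

Definition inspect a v : process_state :=
  ProcessState (chi a) (bucket a) (moved a) (spent a) (inspected a + (deg E v).+1).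

Definition ready a v : bool := ~~ frozen L k E v && unhappy ext E (chi a) v.

Definition pop a v : process_state :=
  inspect (if ready a v then recolour a v else a) v.

Definition empty_bucket a c : process_state :=
  ProcessState (chi a) (fun c' => if c' == c then [::] else bucket a c')
    (moved a) (spent a) (inspected a).

Definition visit a c : process_state := foldl pop (empty_bucket a c) (bucket a c).

Definition sweep a : process_state :=
  foldl visit (ProcessState (chi a) (bucket a) 0 (spent a) (inspected a)) (iota 0 k).

Lemma mem_foldl_push l b c u :
  (u \in foldl push b l c) = (u \in b c) || ((u \in l) && (cls k u == c)).
Proof.
elim: l b => [|v l IH] b /=; first by rewrite orbF.
rewrite IH /push; case: eqP => [->|ne].
  rewrite !inE; case: (u =P v) => [->|_] /=; last by [].
  by rewrite eqxx orbT.
rewrite inE; case: (u =P v) => [->|_] //=.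
by rewrite eq_sym; move/eqP/negbTE: ne => ->; rewrite !andbF.
Qed.

Definition pending (F : 'I_n -> nat) m b : nat := \sum_(c < m) \sum_(u <- b c) F u.

Lemma pending_push F m b v :
  pending F m (push b v) = pending F m b + (cls k v < m) * F v.
Proof.
rewrite /pending; case: (ltnP (cls k v) m) => h; last first.
  rewrite addn0; apply: eq_bigr => c _; rewrite /push; case: eqP => // cv.
  by move: (ltn_ord c); rewrite cv ltnNge h.
rewrite (bigD1 (Ordinal h)) //= [in RHS](bigD1 (Ordinal h)) //= /push eqxx big_cons.
rewrite mul1n addnC [F v + _]addnC addnA; congr (_ + _); rewrite addnC; congr (_ + _).
by apply: eq_bigr => c; rewrite -val_eqE /= => /negbTE ->.
Qed.

Lemma pending_foldl_push F m b l :
  pending F m (foldl push b l) = pending F m b + \sum_(u <- l) (cls k u < m) * F u.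
Proof.
elim: l b => [|v l IH] b /=; first by rewrite big_nil addn0.
by rewrite IH pending_push big_cons addnA.
Qed.

Lemma cls_lt v : cls k v < k.
Proof. exact: ltn_pmod. Qed.

Lemma sum_nb (F : 'I_n -> nat) v : \sum_(u <- nb v) F u = \sum_(u | adj E v u) F u.
Proof. by rewrite /nb big_filter big_enum_cond. Qed.

Lemma size_nb v : size (nb v) = deg E v.
Proof. by rewrite -sum1_size sum_nb sum1_card. Qed.

Lemma mem_nb u v : (u \in nb v) = adj E v u.
Proof. by rewrite mem_filter mem_enum andbT. Qed.

Definition waiting b := pending (fun u => (deg E u).+1) k b.

Lemma waiting_nb b v : waiting (foldl push b (nb v)) = waiting b + flip_cost E v.
Proof.
rewrite /waiting pending_foldl_push sum_nb; congr (_ + _).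
by apply: eq_bigr => u _; rewrite cls_lt mul1n.
Qed.

Definition covers a := forall u, ready a u -> u \in bucket a (cls k u).

Definition classified a := forall c u, u \in bucket a c -> cls k u = c.

(** What holds between visits: [a] carries the colouring after [t] steps, no
vertex that may move is forgotten, and every unit of neighbourhood inspected or
waiting to be inspected comes from the initial worklist or from a flip. *)
Definition tracks chi0 t w0 a :=
  [/\ chi a = col ext L k E chi0 t, covers a, classified a
    & inspected a + waiting (bucket a) = w0 + spent a].

Section Visit.

Variables (chi1 : colouring n) (c w0 : nat).

(** The invariant of a visit to class [c] that started from the colouring
[chi1]: the moves of the step have been carried out on the vertices [done]. A
vertex may occur in the bucket several times. *)
Definition visiting (done todo : seq 'I_n) a :=
  [/\ forall v, chi a v = chi1 v (+) ((v \in done) && moves ext L k E chi1 c v),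
      forall u, ready a u -> u \in bucket a (cls k u) ++ todo,
      classified a &
      inspected a + waiting (bucket a) + \sum_(u <- todo) (deg E u).+1 = w0 + spent a].

(** No neighbour of an unfrozen vertex shares its class, so during a visit its
neighbourhood keeps the colours it had at the start. *)
Lemma visiting_ready done todo a v : visiting done todo a -> cls k v = c ->
  ready a v = (v \notin done) && moves ext L k E chi1 c v.
Proof.
move=> [hchi _ _ _] vc; rewrite /ready /moves vc eqxx /=.
have [fv|nfv] := boolP (frozen L k E v); first by rewrite andbF.
have nbr u : adj E v u -> chi a u = chi1 u.
  move=> vu; rewrite hchi /moves; case: eqP => [uc|_]; last by rewrite andbF addbF.
  move: nfv; rewrite /frozen negb_or => /andP[_ /existsP[]].
  by exists u; rewrite vu uc vc eqxx.
have mv : moves ext L k E chi1 c v = unhappy ext E chi1 v.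
  by rewrite /moves vc eqxx nfv.
have hv := hchi v; rewrite mv in hv.
rewrite /=; have [vd|vd] := boolP (v \in done); last first.
  rewrite (negbTE vd) addbF in hv; rewrite /unhappy (@eq_bad_deg _ _ _ _ chi1) // => u vu.
  by rewrite /bad hv nbr.
rewrite vd /= in hv; case: (boolP (unhappy ext E chi1 v)) hv => un hv.
  have h : bad_deg ext E (chi a) v + bad_deg ext E chi1 v = deg E v.
    apply: bad_deg_compl => u vu; rewrite /bad nbr // hv addbT.
    by case: (chi1 u); case: (chi1 v); case: ext.
  by move: un; rewrite /unhappy -h; apply: contraTF; lia.
rewrite addbF in hv; rewrite /unhappy (@eq_bad_deg _ _ _ _ chi1); first exact/negbTE.
by move=> u vu; rewrite /bad hv nbr.
Qed.

Lemma visiting_pop done todo a v : cls k v = c ->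
  visiting done (v :: todo) a -> visiting (rcons done v) todo (pop a v).
Proof.
move=> vc J; have rv := visiting_ready J vc; case: J => hchi hcov hcls hbal.
have wbal : inspected a + (deg E v).+1 + waiting (bucket a)
    + \sum_(u <- todo) (deg E u).+1 = w0 + spent a.
  by rewrite -hbal big_cons; lia.
rewrite /pop; case: (boolP (ready a v)) => rav.
- split => /=.
  + move=> u; rewrite ffunE hchi mem_rcons inE; case: (u =P v) => [->|_] /=.
      by move: rv; rewrite rav => /esym/andP[/negbTE -> ->] /=; rewrite addbF.
    by rewrite addbF.
  + move=> u; rewrite /ready /= => /andP[fu un].
    rewrite mem_cat mem_foldl_push eqxx andbT mem_nb.
    have [vu|nvu] := boolP (adj E v u); first by rewrite orbT.
    rewrite orbF; have [uv|uv] := eqVneq u v.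
      by move: un; rewrite uv; apply: contraTT => _; apply: unhappy_flip1 => //;
         move: rav => /andP[].
    have : u \in bucket a (cls k u) ++ v :: todo.
      apply: hcov; rewrite /ready fu /=; move: un.
      rewrite /unhappy (@eq_bad_deg _ _ _ _ (chi a)) // => w uw.
      rewrite bad_flip1_other //; apply: contraNneq nvu => <-.
      by rewrite adjC.
    by rewrite !mem_cat inE (negbTE uv).
  + move=> d u; rewrite mem_foldl_push => /orP[/hcls//|/andP[_ /eqP//]].
  + by rewrite waiting_nb; move: wbal; lia.
- split => //=.
  + move=> u; rewrite hchi mem_rcons inE; case: (u =P v) => [->|_] //=.
    move: rv; rewrite (negbTE rav) => /esym/negbT; rewrite negb_and negbK.
    by case: (v \in done) => //= /negbTE ->.
  + move=> u ru'; have ru : ready a u := ru'; have := hcov u ru; rewrite !mem_cat inE.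
    by case: (u =P v) => // uv; rewrite uv in ru; rewrite ru in rav.
Qed.

Lemma visiting_foldl todo done a : all (fun v => cls k v == c) todo ->
  visiting done todo a -> visiting (done ++ todo) [::] (foldl pop a todo).
Proof.
elim: todo done a => [|v todo IH] done a /=; first by rewrite cats0.
by move=> /andP[/eqP vc all_c] J; rewrite -cat_rcons; apply: IH => //; exact: visiting_pop.
Qed.

End Visit.

Lemma tracks_visit chi0 t w0 a : tracks chi0 t w0 a ->
  tracks chi0 t.+1 w0 (visit a (t %% k)).
Proof.
move=> [hchi hcov hcls hbal]; set c := t %% k.
have ck : c < k by exact: ltn_pmod.
have J : visiting (chi a) c w0 [::] (bucket a c) (empty_bucket a c).
  split => /=; first by move=> v; rewrite addbF.
  - move=> u ru; have := hcov u ru; rewrite mem_cat.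
    by case: eqP => [->|_ ->].
  - by move=> d u /=; case: (d =P c) => // _; exact: hcls.
  - rewrite -hbal -addnA; congr (_ + _); rewrite /waiting /pending.
    rewrite [in RHS](bigD1 (Ordinal ck)) //= (bigD1 (Ordinal ck)) //= eqxx big_nil add0n addnC.
    congr (_ + _); apply: eq_bigr => d.
    by rewrite -val_eqE /= => /negbTE ->.
have allc : all (fun v => cls k v == c) (bucket a c).
  by apply/allP => v /hcls ->.
have [hchi' hcov' hcls' hbal'] := visiting_foldl allc J.
split => //.
- rewrite /= -hchi; apply/ffunP => v; rewrite hchi' ffunE /=; congr (_ (+) _).
  apply: andb_idl => /and3P[/eqP vc nf un]; rewrite -vc; apply: hcov.
  by rewrite /ready nf un.
- by move=> u /hcov'; rewrite cats0.
- by move: hbal'; rewrite big_nil addn0.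
Qed.

Lemma foldl_tracks chi0 j w0 a i : i <= k -> tracks chi0 (j * k) w0 a ->
  tracks chi0 (j * k + i) w0 (foldl visit a (iota 0 i)).
Proof.
elim: i => [|i IH] ik ta; first by rewrite addn0.
rewrite -addn1 iotaD foldl_cat addn1 add0n /= addnS.
by have := tracks_visit (IH (ltnW ik) ta); rewrite modnMDl modn_small.
Qed.

Lemma tracks_sweep chi0 j w0 a : tracks chi0 (j * k) w0 a ->
  tracks chi0 (j.+1 * k) w0 (sweep a).
Proof. by move=> ta; rewrite mulSn addnC; apply: foldl_tracks. Qed.

Definition queued m a : nat := pending (fun=> 1) m (bucket a).

(** Bucket [m] is emptied by its visit, and each later entry of the first [m.+1]
buckets is paid for by a move of this sweep. *)
Lemma queued_visit a m : queued m a <= moved a -> queued m.+1 (visit a m) <= moved (visit a m).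
Proof.
move=> qa; have q0 : queued m.+1 (empty_bucket a m) <= moved (empty_bucket a m).
  rewrite /queued /pending big_ord_recr /= eqxx big_nil addn0; apply: leq_trans qa.
  by apply: leq_sum => c _; rewrite /= ltn_eqF.
rewrite /visit; elim: (bucket a m) (empty_bucket a m) q0 => //= v l IH a' qa'.
apply: IH; rewrite /pop; case: ifP => //= _.
rewrite /queued pending_foldl_push leq_add //.
rewrite -size_nb -sum1_size; apply: leq_sum => u _.
by case: (_ < _).
Qed.

Lemma queued_sweep a : queued k (sweep a) <= moved (sweep a).
Proof.
rewrite /sweep; move: (ProcessState _ _ _ _ _) (erefl : moved (ProcessState (chi a) (bucket a) 0 (spent a) (inspected a)) = 0) => a' _.
suff h m : queued m (foldl visit a' (iota 0 m)) <= moved (foldl visit a' (iota 0 m)) by [].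
elim: m => [|m IH]; first by rewrite /queued /pending big_ord0.
by rewrite -addn1 iotaD foldl_cat add0n addn1 /=; exact: queued_visit.
Qed.

(** A vertex that is still ready waits in its bucket, and everything that waits
at the end of a sweep was put there by a move during this sweep. *)
Lemma card_ready_sweep chi0 t w0 a : tracks chi0 t w0 (sweep a) ->
  #|[pred v | ready (sweep a) v]| <= moved (sweep a).
Proof.
move=> [_ hcov _ _]; apply: leq_trans (queued_sweep a).
set a' := sweep a in hcov *.
have -> : queued k a' = size (flatten [seq bucket a' c | c <- iota 0 k]).
  rewrite size_flatten /shape -map_comp sumnE big_map -[k in iota 0 k]subn0.
  rewrite big_mkord /queued /pending; apply: eq_bigr => c _ /=.
  by rewrite sum1_size.
apply: leq_trans (card_size _); apply: subset_leq_card.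
apply/fintype.subsetP => v; rewrite inE => rv; apply/flatten_mapP.
exists (cls k v); last exact: hcov.
by rewrite mem_iota add0n cls_lt.
Qed.

Lemma spent_moved_visit l a : spent a + moved (foldl pop a l) <= spent (foldl pop a l) + moved a.
Proof.
elim: l a => [|v l IH] a /=; first by [].
have := IH (pop a v); rewrite /pop; case: ifP => _ /=; last by [].
have := deg_le_flip_cost E v; set x := moved (foldl _ _ _); set y := spent (foldl _ _ _); lia.
Qed.

Lemma spent_moved_sweep a : spent a + moved (sweep a) <= spent (sweep a).
Proof.
rewrite /sweep; set a0 := ProcessState _ _ _ _ _.
suff h (l : seq nat) : forall a', spent a' + moved (foldl visit a' l) <= spent (foldl visit a' l) + moved a'.
  by have := h (iota 0 k) a0; rewrite addn0.
elim: l => //= c l IH a'; have := IH (visit a' c).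
have := spent_moved_visit (bucket a' c) (empty_bucket a' c).
rewrite -/(visit a' c) /=; move: (foldl visit _ _) => a2; lia.
Qed.

Section Spending.

Local Open Scope ring_scope.

Variables (R : realType).

(** The costs paid so far plus the energy that is left to pay for further
flips. *)
Definition bank a : R := (spent a)%:R + 4 * energy ext E (potential R E) (chi a).

Lemma bank_pop a v : bank (pop a v) <= bank a.
Proof.
rewrite /pop /bank; case: ifP => //= /andP[_ un].
have := energy_flip1 EP (potential_ge0 R E) (fun v u => @potential_slow R n E v u) un.
have := flip_cost_le R E v; rewrite natrD; nra.
Qed.

Lemma bank_foldl_pop l a : bank (foldl pop a l) <= bank a.
Proof.
by elim: l a => //= v l IH a; apply: le_trans (IH _) (bank_pop _ _).
Qed.

Lemma bank_visit a c : bank (visit a c) <= bank a.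
Proof. exact: (bank_foldl_pop _ (empty_bucket a c)). Qed.

Lemma bank_foldl_visit (l : seq nat) a : bank (foldl visit a l) <= bank a.
Proof.
by elim: l a => //= v l IH a; apply: le_trans (IH _) (bank_visit _ _).
Qed.

Lemma bank_sweep a : bank (sweep a) <= bank a.
Proof.
exact: (bank_foldl_visit (iota 0 k) (ProcessState (chi a) (bucket a) 0 (spent a) (inspected a))).
Qed.

Lemma spent_le_bank a : (spent a)%:R <= bank a.
Proof. by rewrite lerDl mulr_ge0 // energy_ge0 //; exact: potential_ge0. Qed.

End Spending.

End Process.

(** * Execution of deterministic programs *)

Notation cells := Defs.mem.

Section Execution.

Variable w : nat.

(** Big-step semantics, with the number of elementary steps, of the commands
that do not sample. *)
Inductive exec : cmd -> state -> nat -> state -> Prop :=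
| exec_skip s : exec CSkip s 1 s
| exec_assign x e s :
    exec (CAssign x e) s 1 (State (upd (regs s) x (eval_expr w s e)) (cells s))
| exec_store a e s :
    exec (CStore a e) s 1
      (State (regs s) (upd (cells s) (eval_expr w s a) (eval_expr w s e)))
| exec_seq c1 c2 s t1 s1 t2 s2 : exec c1 s t1 s1 -> exec c2 s1 t2 s2 ->
    exec (CSeq c1 c2) s (t1 + t2).+1 s2
| exec_if e c1 c2 s t s' :
    exec (if eval_expr w s e != 0 then c1 else c2) s t s' ->
    exec (CIf e c1 c2) s t.+1 s'
| exec_while0 e c s : eval_expr w s e = 0 -> exec (CWhile e c) s 1 s
| exec_whileS e c s t1 s1 t2 s2 : eval_expr w s e != 0 ->
    exec c s t1 s1 -> exec (CWhile e c) s1 t2 s2 ->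
    exec (CWhile e c) s (t1 + t2).+1 s2.

(** Every step on the way has a single possible outcome. *)
Fixpoint reaches t cf cf' : Prop :=
  if t is t'.+1 then
    ~~ halted cf /\ exists2 cf1, step w cf = [:: cf1] & reaches t' cf1 cf'
  else cf = cf'.

Lemma reaches_trans t1 t2 cf1 cf2 cf3 :
  reaches t1 cf1 cf2 -> reaches t2 cf2 cf3 -> reaches (t1 + t2) cf1 cf3.
Proof.
elim: t1 cf1 => [|t1 IH] cf1 /=; first by move=> ->.
by move=> [h [cf h1 h2]] h3; split => //; exists cf => //; exact: IH.
Qed.

Lemma exec_reaches c s t s' k : exec c s t s' -> reaches t (c :: k, s) (k, s').
Proof.
move=> h; elim: h k => {c s t s'}.
- by move=> s k; split => //; exists (k, s).
- by move=> x e s k; split => //; eexists.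
- by move=> a e s k; split => //; eexists.
- move=> c1 c2 s t1 s1 t2 s2 _ IH1 _ IH2 k; split => //; eexists; first by [].
  by apply: reaches_trans; [exact: IH1 | exact: IH2].
- move=> e c1 c2 s t s' _ IH k; split => //; eexists; first by [].
  exact: IH.
- by move=> e c s e0 k; split => //; eexists; rewrite /= ?e0.
- move=> e c s t1 s1 t2 s2 e0 _ IH1 _ IH2 k; split => //; eexists; first by rewrite /= e0.
  by apply: reaches_trans; [exact: IH1 | exact: IH2].
Qed.

Section RunProb.

Local Open Scope ring_scope.

Variable R : realType.

Lemma run_prob_reaches t t' cf cf' (Q : pred config) :
  reaches t cf cf' -> run_prob R w (t + t') Q cf = run_prob R w t' Q cf'.
Proof.
elim: t cf => [|t IH] cf /=; first by move=> ->.
by move=> [_ [cf1 -> /IH <-]]; rewrite big_seq1 divr1.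
Qed.

Lemma run_prob_halted t (Q : pred config) s :
  run_prob R w t Q ([::], s) = (Q ([::], s))%:R.
Proof. by elim: t => //= t IH; rewrite big_seq1 IH divr1. Qed.

Lemma run_prob_running t i cf cf' : (i < t)%N -> reaches t cf cf' ->
  run_prob R w i (fun c => ~~ halted c) cf = 1.
Proof.
elim: i t cf => [|i IH] [|t] cf //= it [h [cf1 e r]].
  by rewrite h.
by rewrite e big_seq1 divr1; exact: IH r.
Qed.

Lemma halt_prob_exec c s t s' (Q : pred state) :
  exec c s t s' -> halt_prob R w Q ([:: c], s) = (Q s')%:R.
Proof.
move=> /(exec_reaches [::]) h; apply/cvg_lim; first exact: Rhausdorff.
apply: cvg_near_cst; exists t => // i /= ti.
by rewrite -(subnKC ti) (run_prob_reaches _ _ h) run_prob_halted.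
Qed.

Lemma expected_time_exec c s t s' :
  exec c s t s' -> expected_time R w ([:: c], s) = (t%:R)%:E.
Proof.
move=> /(exec_reaches [::]) h; rewrite /expected_time.
have hge i : (t <= i)%N -> run_prob R w i (fun c => ~~ halted c) ([:: c], s) = 0.
  by move=> ti; rewrite -(subnKC ti) (run_prob_reaches _ _ h) run_prob_halted.
apply/cvg_lim; first exact: ereal_hausdorff.
apply: cvg_near_cst; exists t => // i /= ti.
rewrite (big_cat_nat _ (n := t)) //= [X in (_ + X)%E]big1_seq ?adde0; last first.
  by move=> j /andP[_]; rewrite mem_index_iota => /andP[tj _]; rewrite hge.
rewrite (eq_big_nat _ _ (F2 := fun=> (1 : R)%:E)); last first.
  by move=> j /andP[_ jt]; rewrite (run_prob_running jt h).
by rewrite sumEFin big_const_nat subn0 iter_addr addr0.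
Qed.

End RunProb.

(** Weakest precondition for total correctness; the first argument of [Q] is
the number of steps. *)
Definition wp c s (Q : nat -> state -> Prop) : Prop :=
  exists t s', exec c s t s' /\ Q t s'.

Lemma wp_skip s (Q : nat -> state -> Prop) : Q 1 s -> wp CSkip s Q.
Proof. by exists 1, s; split => //; constructor. Qed.

Lemma wp_assign x e v s (Q : nat -> state -> Prop) : eval_expr w s e = v ->
  Q 1 (State (upd (regs s) x v) (cells s)) -> wp (CAssign x e) s Q.
Proof. by move=> <- q; do 2!eexists; split; last exact: q; constructor. Qed.

Lemma wp_store a e x v s (Q : nat -> state -> Prop) :
  eval_expr w s a = x -> eval_expr w s e = v ->
  Q 1 (State (regs s) (upd (cells s) x v)) -> wp (CStore a e) s Q.
Proof. by move=> <- <- q; do 2!eexists; split; last exact: q; constructor. Qed.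

Lemma wp_seq c1 c2 s (Q : nat -> state -> Prop) :
  wp c1 s (fun t1 s1 => wp c2 s1 (fun t2 s2 => Q (t1 + t2).+1 s2)) ->
  wp (CSeq c1 c2) s Q.
Proof.
move=> [t1 [s1 [h1 [t2 [s2 [h2 q]]]]]]; exists (t1 + t2).+1, s2; split => //.
by econstructor; eauto.
Qed.

Lemma wp_if e b c1 c2 s (Q : nat -> state -> Prop) : (eval_expr w s e != 0) = b ->
  wp (if b then c1 else c2) s (fun t => Q t.+1) -> wp (CIf e c1 c2) s Q.
Proof.
move=> eb [t [s' [h q]]]; exists t.+1, s'; split => //.
by constructor; rewrite eb.
Qed.

Lemma wp_while0 e c s (Q : nat -> state -> Prop) :
  eval_expr w s e = 0 -> Q 1 s -> wp (CWhile e c) s Q.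
Proof. by move=> e0 q; exists 1, s; split => //; constructor. Qed.

Lemma wp_whileS e c s (Q : nat -> state -> Prop) : eval_expr w s e != 0 ->
  wp c s (fun t1 s1 => wp (CWhile e c) s1 (fun t2 s2 => Q (t1 + t2).+1 s2)) ->
  wp (CWhile e c) s Q.
Proof.
move=> e0 [t1 [s1 [h1 [t2 [s2 [h2 q]]]]]]; exists (t1 + t2).+1, s2; split => //.
exact: exec_whileS h1 h2.
Qed.

(** Arithmetic is exact as long as the values involved fit in a word. *)
Lemma ev_const m s : m < 2 ^ w -> eval_expr w s (EConst m) = m.
Proof. exact: modn_small. Qed.

Lemma ev_reg x s : eval_expr w s (EReg x) = regs s x.
Proof. by []. Qed.

Lemma ev_mem e a s : eval_expr w s e = a -> eval_expr w s (EMem e) = cells s a.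
Proof. by move=> <-. Qed.

Lemma ev_add e1 e2 a b s : eval_expr w s e1 = a -> eval_expr w s e2 = b ->
  a + b < 2 ^ w -> eval_expr w s (EBin OAdd e1 e2) = a + b.
Proof. by move=> /= -> -> /modn_small. Qed.

Lemma ev_sub e1 e2 a b s : eval_expr w s e1 = a -> eval_expr w s e2 = b ->
  a < 2 ^ w -> eval_expr w s (EBin OSub e1 e2) = a - b.
Proof. by move=> /= -> -> h; apply/modn_small/(leq_ltn_trans _ h)/leq_subr. Qed.

Lemma ev_mul e1 e2 a b s : eval_expr w s e1 = a -> eval_expr w s e2 = b ->
  a * b < 2 ^ w -> eval_expr w s (EBin OMul e1 e2) = a * b.
Proof. by move=> /= -> -> /modn_small. Qed.

Lemma ev_div e1 e2 a b s : eval_expr w s e1 = a -> eval_expr w s e2 = b ->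
  a < 2 ^ w -> eval_expr w s (EBin ODiv e1 e2) = a %/ b.
Proof. by move=> /= -> -> h; apply/modn_small/(leq_ltn_trans _ h)/leq_div. Qed.

Lemma ev_mod e1 e2 a b s : eval_expr w s e1 = a -> eval_expr w s e2 = b ->
  a < 2 ^ w -> eval_expr w s (EBin OMod e1 e2) = a %% b.
Proof. by move=> /= -> -> h; apply/modn_small/(leq_ltn_trans _ h)/leq_mod. Qed.

Lemma ev_lt e1 e2 a b s : eval_expr w s e1 = a -> eval_expr w s e2 = b ->
  1 < 2 ^ w -> eval_expr w s (EBin OLt e1 e2) = (a < b).
Proof. by move=> /= -> -> h; apply/modn_small/(leq_ltn_trans _ h)/leq_b1. Qed.

End Execution.

(** * Adjacency lists in memory *)

Section InputLayout.

Variables (n : nat) (E : graph n).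

Definition offset (v : nat) : nat := nth 0 (graph_words E) v.

Let lists := [seq nbrs E u | u <- enum 'I_n].

Lemma offsetE v : v <= n -> offset v = n.+1 + sumn (take v (map size lists)).
Proof.
by move=> vn; rewrite /offset /graph_words nth_cat size_mkseq ltnS vn nth_mkseq.
Qed.

Lemma size_nbrs v : size (nbrs E v) = deg E v.
Proof. by rewrite size_map; exact: size_nb. Qed.

Lemma offsetS (v : 'I_n) : offset v.+1 = offset v + deg E v.
Proof.
have vl : v < size (map size lists) by rewrite /lists 2!size_map size_enum_ord.
rewrite (offsetE (ltn_ord v)) (offsetE (ltnW (ltn_ord v))) (take_nth 0) // sumn_rcons addnA; congr (_ + _).
rewrite (nth_map [::]); last by rewrite /lists size_map size_enum_ord.
rewrite (nth_map v); last by rewrite size_enum_ord.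
by rewrite nth_ord_enum size_nbrs.
Qed.

Lemma offset_mono u v : u <= v -> v <= n -> offset u <= offset v.
Proof.
move=> uv vn; rewrite (offsetE vn) (offsetE (leq_trans uv vn)) leq_add2l.
rewrite -(subnKC uv) takeD sumn_cat; exact: leq_addr.
Qed.

Lemma offset0_gt v : v <= n -> n < offset v.
Proof. by move=> vn; rewrite offsetE // leq_addr. Qed.

Lemma offset_last : offset n = n.+1 + \sum_v deg E v.
Proof.
rewrite offsetE // take_oversize; last by rewrite /lists 2!size_map size_enum_ord.
congr (_ + _).
rewrite sumnE big_map /lists big_map big_enum /=; apply: eq_bigr => v _.
exact: size_nbrs.
Qed.

Lemma nbr_word (v : 'I_n) j : j < deg E v ->
  nth 0 (graph_words E) (offset v + j) = nth 0 (nbrs E v) j.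
Proof.
move=> jd; rewrite (offsetE (ltnW (ltn_ord v))) /graph_words nth_cat size_mkseq.
have -> : n.+1 + sumn (take v (map size lists)) + j < n.+1 = false by lia.
rewrite -addnA addKn -/lists.
have vl : v < size lists by rewrite /lists size_map size_enum_ord.
rewrite -(cat_take_drop v lists) (drop_nth [::]) // flatten_cat /= nth_cat.
rewrite size_flatten /shape map_cat take_cat.
have sv : size (map size (take v lists)) = v by rewrite size_map size_takel // ltnW.
rewrite sv ltnn subnn take0 cats0 ltnNge leq_addr /= addKn nth_cat.
have -> : nth [::] lists v = nbrs E v.
  by rewrite (nth_map v) ?nth_ord_enum // size_enum_ord.
by rewrite size_nbrs jd.
Qed.

End InputLayout.

(** * Turning a colouring into a bisection *)

Section Rebalancing.

Variable n : nat.
Implicit Types (p : pred 'I_n) (chi : colouring n) (v : 'I_n).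

Definition below p i : nat := \sum_(v : 'I_n | v < i) p v.

Lemma below0 p : below p 0 = 0.
Proof. by rewrite /below big_pred0. Qed.

Lemma belowS p v : below p v.+1 = below p v + p v.
Proof.
rewrite /below (bigD1 v) //= addnC; congr (_ + _); apply: eq_bigl => u.
by rewrite ltnS ltn_neqAle andbC.
Qed.

Lemma below_all p : below p n = #|[pred v | p v]|.
Proof.
rewrite -sum1_card [RHS]big_mkcond; apply: eq_big => [v|v _]; first exact: ltn_ord.
by rewrite inE; case: (p v).
Qed.

Lemma below_compl p : below p n + below (predC p) n = n.
Proof.
rewrite /below -big_split /= -[RHS](card_ord n) -sum1_card.
apply: eq_big => [v|v _]; first by rewrite ltn_ord.
by case: (p v).
Qed.

(** At most one of the two excesses is positive; it is the number of vertices
of the majority colour that have to change. *)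
Definition red_excess chi : nat := (2 * below chi n - n) %/ 2.
Definition blue_excess chi : nat := (n - 2 * below chi n) %/ 2.

Definition recoloured chi v : bool :=
  if chi v then below chi v < red_excess chi
  else below (fun u => ~~ chi u) v < blue_excess chi.

Definition rebalanced chi : colouring n := [ffun v => chi v (+) recoloured chi v].

Lemma sum_first p h : h <= below p n -> \sum_v (p v && (below p v < h)) = h.
Proof.
move=> hn; suff key i : i <= n ->
    \sum_(v : 'I_n | v < i) (p v && (below p v < h)) = minn h (below p i).
  rewrite -[RHS](minn_idPl hn) -(key n (leqnn n)).
  by apply: eq_bigl => v; rewrite ltn_ord.
elim: i => [|i IH] iltn; first by rewrite below0 minn0 big_pred0.
pose v := Ordinal iltn; rewrite (bigD1 v) //= (belowS p v) /=.
rewrite (eq_bigl (fun u : 'I_n => u < i)); last first.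
  by move=> u; rewrite ltnS ltn_neqAle andbC.
rewrite (IH (ltnW iltn)) -[below p i]/(below p v).
by case: (p v) => /=; lia.
Qed.

Lemma red_excess_le chi : red_excess chi <= below chi n.
Proof. rewrite /red_excess; have := below_compl chi; lia. Qed.

Lemma blue_excess_le chi : blue_excess chi <= below (fun u => ~~ chi u) n.
Proof.
have h : below chi n + below (fun u => ~~ chi u) n = n := below_compl chi.
rewrite /blue_excess; lia.
Qed.

Lemma card_recoloured chi :
  #|[pred v | recoloured chi v]| = red_excess chi + blue_excess chi.
Proof.
rewrite -(sum_first (red_excess_le chi)) -(sum_first (blue_excess_le chi)).
rewrite -big_split -sum1_card big_mkcond; apply: eq_bigr => v _.
by rewrite inE /recoloured; case: (chi v) => /=; rewrite ?addn0; case: (_ < _).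
Qed.

Lemma bisection_rebalanced chi : bisection (rebalanced chi).
Proof.
have hr : #|[pred v | rebalanced chi v]| + red_excess chi = below chi n + blue_excess chi.
  rewrite -[red_excess chi](sum_first (red_excess_le chi)).
  rewrite -[blue_excess chi](sum_first (blue_excess_le chi)) below_all.
  rewrite -!sum1_card [X in X + _]big_mkcond [X in _ = X + _]big_mkcond -!big_split.
  apply: eq_bigr => v _; rewrite !inE ffunE /recoloured.
  by case: (chi v) => /=; rewrite ?addbT ?addbF ?addn0 //; case: (_ < _).
have hb : #|[pred v | rebalanced chi v]| + #|[pred v | ~~ rebalanced chi v]| = n.
  rewrite -[RHS]card_ord -(cardC (fun v => rebalanced chi v)); congr (_ + _).
rewrite /bisection; move: hr hb.
have := red_excess_le chi; rewrite /red_excess /blue_excess.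
have := odd_double_half n; have := below_compl chi; rewrite -addnn.
set x := #|_|; set y := #|_|; case: (odd n) => /=; lia.
Qed.

End Rebalancing.

(** * The program *)

Declare Scope cmd_scope.
Notation "c1 ;; c2" := (CSeq c1 c2) (at level 61, right associativity) : cmd_scope.

Notation r_n := 0 (only parsing).
Notation r_L := 1 (only parsing).
Notation r_k := 2 (only parsing).
Notation r_base := 3 (only parsing).
Notation r_top := 4 (only parsing).
Notation r_moved := 5 (only parsing).
Notation r_class := 6 (only parsing).
Notation r_node := 7 (only parsing).
Notation r_v := 8 (only parsing).
Notation r_i := 9 (only parsing).
Notation r_end := 10 (only parsing).
Notation r_bad := 11 (only parsing).
Notation r_dist := 12 (only parsing).
Notation r_u := 13 (only parsing).
Notation r_x := 14 (only parsing).
Notation r_red := 15 (only parsing).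
Notation r_blue := 16 (only parsing).

Notation e_add := (EBin OAdd) (only parsing).
Notation e_sub := (EBin OSub) (only parsing).
Notation e_mul := (EBin OMul) (only parsing).
Notation e_div := (EBin ODiv) (only parsing).
Notation e_mod := (EBin OMod) (only parsing).
Notation e_lt := (EBin OLt) (only parsing).

Section ProgramText.

Local Open Scope cmd_scope.

Local Notation "x ::= e" := (CAssign x e) (at level 60) : cmd_scope.
Local Notation "$ k" := (EConst k) (at level 1, format "$ k") : cmd_scope.
Local Notation "# x" := (EReg x) (at level 1, format "# x") : cmd_scope.

Variable ext : bool.



Definition e_class (e : expr) : expr := e_mod (e_div e $2) #r_k.
Definition e_head (e : expr) : expr := e_add (e_add #r_base #r_n) e.
Definition e_colour (e : expr) : expr := EMem (e_add #r_base e).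

(** The cells from [r_base] on hold the colours, then the heads of the buckets,
then list nodes made of a vertex and the address of the next node; [r_top] is the
first free cell. Address 0 belongs to the input and stands for the empty list. *)
Definition c_push : cmd :=
  CStore #r_top #r_u;;
  CStore (e_add #r_top $1) (EMem (e_head (e_class #r_u)));;
  CStore (e_head (e_class #r_u)) #r_top;;
  r_top ::= e_add #r_top $2.

Definition c_push_nbrs : cmd :=
  CWhile (e_lt #r_i #r_end)
    (r_u ::= EMem #r_i;; c_push;; r_i ::= e_add #r_i $1).

(** The neighbours in other classes are counted in [r_dist]: there is no conflict
if these are all the neighbours. *)
Definition c_scan : cmd :=
  CWhile (e_lt #r_i #r_end)
    (r_u ::= EMem #r_i;;
     r_bad ::= e_add #r_bad
       (e_mod (e_add (e_add (e_colour #r_u) (e_colour #r_v)) $(ext : nat)) $2);;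
     r_dist ::= e_add #r_dist
       (e_add (e_lt (e_class #r_u) (e_class #r_v)) (e_lt (e_class #r_v) (e_class #r_u)));;
     r_i ::= e_add #r_i $1).

Definition e_ready : expr :=
  e_mul (e_lt #r_x (e_mul $2 #r_bad))
    (e_mul (e_sub $1 (e_lt #r_dist #r_x)) (e_sub $1 (e_lt #r_L #r_x))).

Definition c_recolour : cmd :=
  CStore (e_add #r_base #r_v) (e_sub $1 (e_colour #r_v));;
  r_moved ::= e_add #r_moved #r_x;;
  r_i ::= EMem #r_v;;
  c_push_nbrs.

Definition c_pop : cmd :=
  r_v ::= EMem #r_node;;
  r_node ::= EMem (e_add #r_node $1);;
  r_i ::= EMem #r_v;;
  r_end ::= EMem (e_add #r_v $1);;
  r_x ::= e_sub #r_end #r_i;;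
  r_bad ::= $0;;
  r_dist ::= $0;;
  c_scan;;
  CIf e_ready c_recolour CSkip.

Definition c_visit : cmd :=
  r_node ::= EMem (e_head #r_class);;
  CStore (e_head #r_class) $0;;
  CWhile #r_node c_pop.

Definition c_sweep : cmd :=
  r_moved ::= $0;;
  r_class ::= $0;;
  CWhile (e_lt #r_class #r_k) (c_visit;; r_class ::= e_add #r_class $1).

Definition c_log : cmd :=
  r_u ::= $0;;
  CWhile (e_lt $1 #r_x) (r_x ::= e_div #r_x $2;; r_u ::= e_add #r_u $1);;
  r_x ::= #r_u.

Definition c_init : cmd :=
  r_x ::= #r_n;; c_log;; c_log;; c_log;;
  r_L ::= e_add #r_x $1;;
  r_k ::= e_mul #r_L #r_L;;
  r_base ::= EMem #r_n;;
  r_top ::= e_head #r_k;;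
  r_u ::= $0;;
  CWhile (e_lt #r_u #r_n)
    (CStore (e_add #r_base #r_u) (e_mod #r_u $2);;
     c_push;;
     r_u ::= e_add #r_u $1);;
  r_moved ::= e_add #r_n $1.

Definition c_count : cmd :=
  r_x ::= $0;;
  r_v ::= $0;;
  CWhile (e_lt #r_v #r_n)
    (r_x ::= e_add #r_x (e_colour #r_v);; r_v ::= e_add #r_v $1).

Definition c_rebalance : cmd :=
  r_red ::= e_div (e_sub (e_mul $2 #r_x) #r_n) $2;;
  r_blue ::= e_div (e_sub #r_n (e_mul $2 #r_x)) $2;;
  r_v ::= $0;;
  CWhile (e_lt #r_v #r_n)
    (CIf (e_colour #r_v)
       (CIf (e_lt $0 #r_red)
          (CStore #r_v $0;; r_red ::= e_sub #r_red $1)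
          (CStore #r_v $1))
       (CIf (e_lt $0 #r_blue)
          (CStore #r_v $1;; r_blue ::= e_sub #r_blue $1)
          (CStore #r_v $0));;
     r_v ::= e_add #r_v $1).

Definition program : cmd :=
  c_init;;
  CWhile (e_lt #r_n (e_mul #r_moved #r_L)) c_sweep;;
  c_count;;
  c_rebalance.

End ProgramText.

Ltac ev := repeat first
  [ eapply ev_add | eapply ev_sub | eapply ev_mul | eapply ev_div
  | eapply ev_mod | eapply ev_lt | eapply ev_mem | apply ev_reg | apply ev_const ].

(** * Correctness of the program *)

Section ProgramCorrectness.

Variables (w n : nat) (ext : bool) (L k : nat) (E : graph n).
Hypothesis EP : E \subset pairs n.
Hypothesis k0 : 0 < k.
Hypothesis L0 : 0 < L.

Let base := offset E n.
Let lo := base + n + k.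
Variable smax : nat.
Hypothesis fits_address : lo + 2 * (n + smax) + 2 * n + 8 < 2 ^ w.
Hypothesis fits_product : (smax + n + 1) * L.+1 < 2 ^ w.

Implicit Types (s : state) (v u : 'I_n) (l : seq 'I_n) (b : nat -> seq 'I_n)
  (chi : colouring n) (a : process_state n).

(** The list [l] is stored from address [p] on, in nodes between [lo] and [q].
Nodes are never modified, which is why [chain_mono] suffices as frame rule. *)
Fixpoint chain (m : nat -> nat) (q p : nat) l : Prop :=
  if l is v :: l' then
    [/\ lo <= p, p.+1 < q, m p = v & chain m q (m p.+1) l']
  else p = 0.

Lemma chain_mono m m' q q' p l : q <= q' ->
  (forall i, lo <= i < q -> m' i = m i) -> chain m q p l -> chain m' q' p l.
Proof.
move=> qq mm; elim: l p => //= v l IH p [h1 h2 h3 h4]; split => //.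
- exact: leq_trans qq.
- by rewrite mm // h1 ltnW.
- by rewrite mm; [exact: IH | rewrite h2 andbT ltnW].
Qed.

Record layout chi b s : Prop := Layout {
  reg_n : regs s r_n = n;
  reg_L : regs s r_L = L;
  reg_k : regs s r_k = k;
  reg_base : regs s r_base = base;
  input_cells : forall i, i < base -> cells s i = nth 0 (graph_words E) i;
  colour_cells : forall v, cells s (base + v) = chi v;
  bucket_cells : forall c, c < k ->
    chain (cells s) (regs s r_top) (cells s (base + n + c)) (b c);
  reg_top : lo <= regs s r_top }.

Lemma lo_gt0 : 0 < lo.
Proof. by rewrite /lo; lia. Qed.

Lemma small_lt c : c <= 8 -> c < 2 ^ w.
Proof. by move: fits_address; lia. Qed.

Lemma wp_push chi b s v (Q : nat -> state -> Prop) :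
  layout chi b s -> regs s r_u = v -> regs s r_top + 2 < 2 ^ w ->
  (forall t s', t <= 7 -> layout chi (push k b v) s' ->
     regs s' r_top = regs s r_top + 2 ->
     (forall x, x != r_top -> regs s' x = regs s x) ->
     (forall i, lo <= i < regs s r_top -> cells s' i = cells s i) -> Q t s') ->
  wp w c_push s Q.
Proof.
move=> [hn hL hk hb hin hcol hbk htop] hu hq post.
have vn := ltn_ord v; have cv := cls_lt k0 v.
have h2 : 2 < 2 ^ w by exact: small_lt.
have lo_lt : lo < 2 ^ w by move: fits_address; lia.
have hd s0 : regs s0 = regs s ->
    eval_expr w s0 (e_head (e_class (EReg r_u))) = base + n + cls k v.
  move=> e0; have -> : base + n + cls k v = base + n + v %/ 2 %% k by rewrite divn2.
  rewrite /e_head /e_class.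
  have -> : eval_expr w s0 (EBin OAdd (EBin OAdd (EReg r_base) (EReg r_n))
    (EBin OMod (EBin ODiv (EReg r_u) (EConst 2)) (EReg r_k)))
    = regs s0 r_base + regs s0 r_n + regs s0 r_u %/ 2 %% regs s0 r_k.
    ev => //; rewrite e0 ?hb ?hn ?hu ?hk; move: lo_lt cv; rewrite /lo /cls -?divn2; lia.
  by rewrite e0 hb hn hu hk.
apply: wp_seq; apply: wp_store; [by ev | by ev |]; rewrite hu.
set s1 := State _ _.
apply: wp_seq; eapply wp_store; [ev; move=> /= ; lia | apply: ev_mem; exact: hd |].
set s2 := State _ _.
apply: wp_seq; eapply wp_store; [exact: hd | by ev |].
eapply wp_assign; [by ev; move=> /=; lia|].
rewrite {}/s2 {}/s1 /=; set q := regs s r_top in hq hbk htop post *.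
set head := base + n + cls k v; set m' := upd _ head q.
have hlo : head < lo by rewrite /head /lo ltn_add2l.
have m'E i : i != q -> i != q + 1 -> i != head -> m' i = cells s i.
  by rewrite /m' /upd => /negbTE -> /negbTE -> /negbTE ->.
have m'q : m' q = v.
  have qh : q == head = false by lia.
  by rewrite /m' /upd qh (_ : q == q + 1 = false) ?eqxx //; lia.
have m'q1 : m' q.+1 = cells s head.
  rewrite /m' /upd addn1 eqxx (_ : q.+1 == head = false); last by lia.
  by rewrite (_ : head == q = false) //; lia.
have m'h : m' head = q by rewrite /m' /upd eqxx.
have m'low i : i < lo -> i != head -> m' i = cells s i.
  by move=> ilo ih; apply: m'E => //; lia.
have m'heap i : lo <= i < q -> m' i = cells s i.
  by move=> /andP[h1 h3]; apply: m'E; lia.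
apply: post => //=.
split => //=.
- by move=> i ib; rewrite m'low; [exact: hin | rewrite /lo; lia | rewrite /head; lia].
- by move=> u; rewrite m'low //; have := ltn_ord u; rewrite /lo /head; lia.
- move=> c ck; rewrite /push [upd _ _ _ r_top]/upd eqxx; case: (c =P cls k v) => [->|ne].
    rewrite -/head m'h /=; split; rewrite ?m'q ?m'q1 //; first by lia.
    by apply: chain_mono (hbk _ cv) => //; lia.
  rewrite m'low; last 2 first; rewrite /lo /head; try lia.
  by apply: chain_mono (hbk _ ck) => //; lia.
- by rewrite /upd eqxx; lia.
- by move=> x xt; rewrite /upd (negbTE xt).
Qed.

Lemma layout_nbr chi b s v j : layout chi b s -> j < deg E v ->
  cells s (offset E v + j) = nth 0 (nbrs E v) j.
Proof.
move=> ls jd; rewrite (input_cells ls) ?nbr_word //.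
apply: leq_trans (offset_mono E (ltn_ord v) (leqnn n)).
by rewrite offsetS ltn_add2l.
Qed.

Lemma wp_push_nbrs l chi b s i (Q : nat -> state -> Prop) :
  layout chi b s -> regs s r_i = i -> regs s r_end = i + size l ->
  (forall j, j < size l -> cells s (i + j) = nth 0 (map val l) j) ->
  i + size l <= base ->
  regs s r_top + 2 * size l < 2 ^ w ->
  (forall t s', t <= 13 * size l + 1 -> layout chi (foldl (push k) b l) s' ->
     regs s' r_top = regs s r_top + 2 * size l ->
     (forall x, x \notin [:: r_top; r_i; r_u] -> regs s' x = regs s x) ->
     (forall i, lo <= i < regs s r_top -> cells s' i = cells s i) -> Q t s') ->
  wp w c_push_nbrs s Q.
Proof.
elim: l b s i Q => [|v l IH] b s i Q ls hi hend hl hbase hq post.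
  apply: wp_while0.
    erewrite ev_lt; [|exact: ev_reg|exact: ev_reg|exact: small_lt].
    by rewrite hi hend addn0 ltnn.
  by apply: post; rewrite //= muln0 addn0.
rewrite /= in hend hbase hq post.
apply: wp_whileS.
  erewrite ev_lt; [|exact: ev_reg|exact: ev_reg|exact: small_lt].
  by rewrite hi hend addnS leq_addr.
have hv : cells s i = v by have := hl 0 isT; rewrite addn0.
apply: wp_seq; apply: wp_assign; first by ev.
rewrite hi hv.
apply: wp_seq; apply: (@wp_push chi b _ v) => //=.
- by case: ls => *; split.
- by rewrite /upd /=; lia.
move=> t1 s1 t1le ls1 top1 reg1' heap1.
have reg1 x : x != r_top -> x != r_u -> regs s1 x = regs s x.
  by move=> x4 x13; rewrite reg1' //= /upd (negbTE x13).
have i1 : regs s1 r_i = i by rewrite reg1.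
have {}top1 : regs s1 r_top = regs s r_top + 2 by rewrite top1.
eapply wp_assign; first by ev => //; rewrite ?i1; move: fits_address; rewrite /lo; lia.
rewrite i1; apply: (IH (push k b v) _ i.+1) => /=.
- by case: ls1 => *; split.
- by rewrite /upd /= addn1.
- by rewrite /upd /= reg1 //= hend addSnnS.
- move=> j jl; have := hl j.+1; rewrite /= addnS -addSn => <- //.
  (* the list of neighbours lies in the input part of the memory *)
  have ib : i.+1 + j < base by lia.
  by rewrite (input_cells ls1 ib) (input_cells ls ib).
- lia.
- by rewrite /upd /= top1 /=; lia.
move=> t2 s2 t2le ls2 top2 reg2 heap2; apply: post => //.
- lia.
- by rewrite top2 /upd /= top1 /=; lia.
- move=> x; rewrite !inE !negb_or => /and3P[x1 x2 x3].
  by rewrite reg2 ?inE ?negb_or ?x1 ?x2 //= /upd (negbTE x2) reg1.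
- move=> j hj; rewrite heap2; last by rewrite /upd /= top1; lia.
  by rewrite heap1.
Qed.

Lemma ev_lt_reg s x y : eval_expr w s (e_lt (EReg x) (EReg y)) = (regs s x < regs s y).
Proof. by apply: ev_lt; [exact: ev_reg | exact: ev_reg | exact: small_lt]. Qed.

Lemma ev_class s x v : regs s r_k = k -> regs s x = v ->
  eval_expr w s (e_class (EReg x)) = cls k v.
Proof.
move=> hk hx; rewrite /e_class /cls -divn2 -hk -hx.
have h2 : 2 < 2 ^ w by exact: small_lt.
have hv : regs s x < 2 ^ w by have := ltn_ord v; rewrite hx; move: fits_address; rewrite /lo; lia.
apply: ev_mod; last exact: leq_ltn_trans (leq_div _ _) hv.
  by apply: ev_div => //; exact: ev_const.
exact: ev_reg.
Qed.

Lemma ev_colour s x chi v : regs s r_base = base -> regs s x = v ->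
  (forall v, cells s (base + v) = chi v) ->
  eval_expr w s (e_colour (EReg x)) = chi v.
Proof.
move=> hb hx hcol; rewrite /e_colour -hcol -hb -hx; apply: ev_mem.
apply: ev_add; [exact: ev_reg | exact: ev_reg |].
by have := ltn_ord v; rewrite hb hx; move: fits_address; rewrite /lo; lia.
Qed.

Lemma wp_scan l v chi b s i (Q : nat -> state -> Prop) :
  layout chi b s -> regs s r_i = i -> regs s r_end = i + size l ->
  regs s r_v = v ->
  (forall j, j < size l -> cells s (i + j) = nth 0 (map val l) j) ->
  i + size l <= base ->
  regs s r_bad + size l <= n -> regs s r_dist + size l <= n ->
  (forall t s', t <= 9 * size l + 1 -> cells s' = cells s ->
     regs s' r_bad = regs s r_bad + count (fun u => bad ext chi u v) l ->
     regs s' r_dist = regs s r_dist + count (fun u => cls k u != cls k v) l ->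
     (forall x, x \notin [:: r_i; r_bad; r_dist; r_u] -> regs s' x = regs s x) ->
     Q t s') ->
  wp w (c_scan ext) s Q.
Proof.
elim: l s i Q => [|u l IH] s i Q ls hi hend hv hl hbase hbad hdist post.
  apply: wp_while0.
    by rewrite ev_lt_reg hi hend addn0 ltnn.
  by apply: post; rewrite //= addn0.
rewrite /= in hend hbase hbad hdist post.
have small x : x <= n -> x < 2 ^ w by move: fits_address; rewrite /lo; lia.
apply: wp_whileS.
  by rewrite ev_lt_reg hi hend addnS leq_addr.
have hu : cells s i = u by have := hl 0 isT; rewrite addn0.
apply: wp_seq; apply: wp_assign; first by ev.
rewrite hi hu; set s1 := State _ _.
have ls1 : layout chi b s1 by case: ls => *; split.
have hb1 := reg_base ls1; have hk1 := reg_k ls1; have hcol1 := colour_cells ls1.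
have two : 2 < 2 ^ w by exact: small_lt.
apply: wp_seq; eapply wp_assign.
  apply: ev_add; [exact: ev_reg | | ].
    apply: ev_mod; last 1 first.
    - have h4 : chi u + chi v + ext < 4 by case: (chi u); case: (chi v); case: ext.
      exact: ltn_trans h4 (small_lt _).
    - apply: ev_add; [apply: ev_add; [exact: ev_colour hb1 _ hcol1
        | exact: (ev_colour hb1 (v := v) _ hcol1) | ] | apply: ev_const | ].
      + by apply: (@leq_ltn_trans 2); [case: (chi u); case: (chi v) | ].
      + by apply: (@leq_ltn_trans 1); [case: ext | exact: small_lt].
      + by apply: (@leq_ltn_trans 3); [case: (chi u); case: (chi v); case: ext | exact: small_lt].
    - exact: ev_const.
  have -> : (chi u + chi v + ext) %% 2 = bad ext chi u v.
    by rewrite /bad; case: (chi u); case: (chi v); case: ext.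
  by rewrite /s1 /= /upd /=; apply: small; case: (bad _ _ _ _) hbad; lia.
have -> : (chi u + chi v + ext) %% 2 = bad ext chi u v.
  by rewrite /bad; case: (chi u); case: (chi v); case: ext.
set s2 := State _ _.
have ls2 : layout chi b s2 by case: ls1 => *; split.
have hk2 := reg_k ls2.
apply: wp_seq; eapply wp_assign.
  apply: ev_add; [exact: ev_reg | | ].
    apply: ev_add.
    - by apply: ev_lt; [exact: (ev_class hk2 (v := u)) | exact: (ev_class hk2 (v := v)) |
        exact: small_lt].
    - by apply: ev_lt; [exact: (ev_class hk2 (v := v)) | exact: (ev_class hk2 (v := u)) |
        exact: small_lt].
    - by apply: (@leq_ltn_trans 2) => //; case: (_ < _); case: (_ < _).
  have -> : (cls k u < cls k v) + (cls k v < cls k u) = (cls k u != cls k v) by lia.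
  by rewrite /s2 /s1 /= /upd /=; apply: small; case: (cls _ _ != _); lia.
have -> : (cls k u < cls k v) + (cls k v < cls k u) = (cls k u != cls k v) by lia.
set s3 := State _ _.
have i3 : regs s3 r_i = i by [].
eapply wp_assign.
  apply: ev_add; [exact: ev_reg | apply: ev_const; exact: small_lt | ].
  by rewrite i3; move: fits_address; rewrite /lo; lia.
rewrite i3; apply: (IH _ i.+1) => //=.
- by case: ls2 => *; split.
- by rewrite /upd /= addn1.
- by rewrite /upd /= hend addSnnS.
- by move=> j jl; have := hl j.+1; rewrite /= addnS -addSn => <-.
- lia.
- by rewrite /upd /=; case: (bad _ _ _ _); lia.
- by rewrite /upd /=; case: (cls _ _ != _); lia.
move=> t s' tle cells' bad' dist' regs'; apply: post => //.
- lia.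
- by rewrite bad' /upd /=; case: (bad _ _ _ _); lia.
- by rewrite dist' /upd /=; case: (cls _ _ != _); lia.
- move=> x xn; rewrite regs' //; move: xn; rewrite !inE !negb_or /upd.
  by move=> /and4P[/negbTE -> /negbTE -> /negbTE -> /negbTE ->].
Qed.

Lemma count_nb (p : pred 'I_n) v : count p (nb E v) = #|[pred u | adj E v u && p u]|.
Proof.
by rewrite -sum1_count big_mkcond sum_nb -big_mkcondr sum1_card.
Qed.

Lemma conflict_count v :
  conflict k E v = (count (fun u => cls k u != cls k v) (nb E v) < deg E v).
Proof.
have := count_predC (fun u => cls k u == cls k v) (nb E v); rewrite size_nb => <-.
rewrite addnC -[X in X < _]addn0 ltn_add2l -has_count.
apply/existsP/hasP => [[u /andP[vu uv]]|[u]]; first by exists u; rewrite ?mem_nb.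
by rewrite mem_nb => vu uv; exists u; rewrite vu.
Qed.

Definition rep a s : Prop :=
  [/\ layout (chi a) (bucket a) s, regs s r_moved = moved a &
      regs s r_top <= lo + 2 * (n + spent a)].

Lemma layout_colour chi chi' b s v (x : nat) : layout chi b s -> x = chi' v ->
  (forall u, u != v -> chi' u = chi u) ->
  layout chi' b (State (regs s) (upd (cells s) (base + v) x)).
Proof.
move=> [hn hL hk hb hin hcol hbk htop] xv chi'E; have vn := ltn_ord v; split => //=.
- by move=> i ib; rewrite /upd ltn_eqF ?hin //; lia.
- move=> u; rewrite /upd eqn_add2l val_eqE hcol.
  by case: (eqVneq u v) => [->|/chi'E ->] /=; rewrite ?xv.
- move=> c ck; rewrite {2}/upd gtn_eqF; last by lia.
  apply: chain_mono (hbk c ck) => // i /andP[il _].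
  by rewrite /upd gtn_eqF //; move: il; rewrite /lo; lia.
Qed.

Lemma wp_recolour a s v (Q : nat -> state -> Prop) :
  rep a s -> regs s r_v = v -> regs s r_x = deg E v ->
  regs s r_end = offset E v + deg E v ->
  spent a + flip_cost E v <= smax -> moved a <= spent a ->
  (forall t s', t <= 13 * deg E v + 10 -> rep (recolour k E a v) s' ->
     (forall x, x \notin [:: r_top; r_i; r_u; r_moved] -> regs s' x = regs s x) ->
     (forall i, lo <= i < regs s r_top -> cells s' i = cells s i) ->
     regs s r_top <= regs s' r_top ->
     Q t s') ->
  wp w c_recolour s Q.
Proof.
move=> [ls hmoved htop] hv hx hend hsp hms post.
have dle := deg_le_flip_cost E v; have dn := deg_le E v; have vn := ltn_ord v.
have hb := reg_base ls; have hcol := colour_cells ls; have tl := reg_top ls.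
apply: wp_seq; eapply wp_store.
- by ev; rewrite hb hv; move: fits_address; rewrite /lo; lia.
- apply: ev_sub; [by apply: ev_const; exact: small_lt | exact: (ev_colour hb hv hcol) |].
  exact: small_lt.
rewrite hb hv; set s1 := State _ _.
have ls1 : layout (flip1 (chi a) v) (bucket a) s1.
  apply: (layout_colour ls); first by rewrite ffunE eqxx; case: (chi a v).
  by move=> u /negbTE uv; rewrite ffunE uv addbF.
apply: wp_seq; eapply wp_assign.
  ev; rewrite /s1 /= hmoved hx; move: fits_address; rewrite /lo; lia.
rewrite /s1 /= hmoved hx; set s2 := State _ _.
have ls2 : layout (flip1 (chi a) v) (bucket a) s2 by case: ls1 => *; split.
apply: wp_seq; apply: wp_assign; first by ev.
have iv : cells s2 (regs s2 r_v) = offset E v.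
  by rewrite [regs _ _]hv (input_cells ls2) //; have := offset0_gt E (leqnn n); rewrite -/base; lia.
rewrite iv; set s3 := State _ _.
have ls3 : layout (flip1 (chi a) v) (bucket a) s3 by case: ls2 => *; split.
apply: (wp_push_nbrs (l := nb E v) ls3 (i := offset E v)) => //.
- by rewrite /s3 /= /upd /= size_nb.
- by move=> j; rewrite size_nb => jd; rewrite (layout_nbr ls3).
- by rewrite size_nb -offsetS; apply: offset_mono.
- by rewrite size_nb /s3 /= /upd /=; move: fits_address htop hsp dle; lia.
move=> t s' tle ls' top' reg' heap'; apply: post.
- by move: tle; rewrite size_nb; lia.
- split => //=.
  + by rewrite reg' //= /s3 /= /upd.
  + by rewrite top' size_nb /s3 /= /upd /=; lia.
- move=> x; rewrite !inE !negb_or => /and4P[x1 x2 x3 x4].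
  by rewrite reg' ?inE ?negb_or ?x1 ?x2 //= /upd (negbTE x2) (negbTE x4).
- move=> i /andP[il iq]; rewrite heap'; last by rewrite il.
  by rewrite /s3 /= /upd gtn_eqF //; move: il; rewrite /lo; lia.
- by rewrite top' /s3 /= /upd /=; exact: leq_addr.
Qed.

Lemma spent_pop_le a v : spent a <= spent (pop ext L k E a v).
Proof. by rewrite /pop; case: ifP => //= _; exact: leq_addr. Qed.

(** The constant 40 covers the instructions executed per neighbour. *)
Lemma wp_pop a s v l (Q : nat -> state -> Prop) :
  rep a s -> chain (cells s) (regs s r_top) (regs s r_node) (v :: l) ->
  spent (pop ext L k E a v) <= smax -> moved a <= spent a ->
  (forall t s', t + 40 * (inspected a + spent a) + 1 <=
       40 * (inspected (pop ext L k E a v) + spent (pop ext L k E a v)) ->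
     rep (pop ext L k E a v) s' -> regs s' r_class = regs s r_class ->
     chain (cells s') (regs s' r_top) (regs s' r_node) l -> Q t s') ->
  wp w (c_pop ext) s Q.
Proof.
move=> [ls hmoved htop] /= [p1 p2 pv pl] hsp hms post.
have dle := deg_le_flip_cost E v; have dn := deg_le E v; have vn := ltn_ord v.
have hsa := leq_trans (spent_pop_le a v) hsp.
have topw : regs s r_top < 2 ^ w by move: fits_address; lia.
have nb0 := offset0_gt E (leqnn n); rewrite -/base in nb0.
have off_le : offset E v + deg E v <= base by rewrite -offsetS; apply: offset_mono.
have bw : base < 2 ^ w by move: fits_address; rewrite /lo; lia.
have one : 1 < 2 ^ w by exact: small_lt.
apply: wp_seq; apply: wp_assign; first by ev.
rewrite pv.
apply: wp_seq; eapply wp_assign; first by ev => //=; rewrite /upd /=; lia.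
rewrite /= /upd /= addn1.
apply: wp_seq; apply: wp_assign; first by ev.
rewrite /= /upd /= (input_cells ls); last by lia.
apply: wp_seq; eapply wp_assign; first by ev => //=; rewrite /upd /=; lia.
rewrite /= addn1 /upd /= (input_cells ls); last by lia.
rewrite -/(offset E v) -/(offset E v.+1) offsetS.
apply: wp_seq; eapply wp_assign; first by ev => //=; rewrite /upd /=; lia.
rewrite /= /upd /= addKn.
apply: wp_seq; eapply wp_assign; first by ev; exact: small_lt.
apply: wp_seq; eapply wp_assign; first by ev; exact: small_lt.
rewrite /=; set s1 := State _ _.
have ls1 : layout (chi a) (bucket a) s1 by case: ls => *; split.
apply: wp_seq; apply: (wp_scan (l := nb E v) (v := v) ls1 (i := offset E v)) => //.
- by rewrite size_nb.
- by move=> j; rewrite size_nb => jd; rewrite (layout_nbr ls1).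
- by rewrite size_nb.
- by rewrite size_nb.
- by rewrite size_nb.
rewrite size_nb => t2 s2 t2le cells2 bad2 dist2 reg2.
have {}bad2 : regs s2 r_bad = bad_deg ext E (chi a) v by rewrite bad2 count_nb.
have x2 : regs s2 r_x = deg E v by rewrite reg2.
have L2 : regs s2 r_L = L by rewrite reg2 //; exact: (reg_L ls).
have badle := bad_deg_le ext E (chi a) v.
have ls2 : layout (chi a) (bucket a) s2.
  case: ls1 => h1 h2 h3 h4 h5 h6 h7 h8; by split; rewrite ?cells2 ?reg2.
have rdy : eval_expr w s2 e_ready = ready ext L k E a v.
  rewrite /e_ready; have -> : (ready ext L k E a v : nat) =
    (deg E v < 2 * bad_deg ext E (chi a) v) *
    ((1 - (regs s2 r_dist < deg E v)) * (1 - (L < deg E v))).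
    rewrite /ready /frozen dist2 /= add0n -conflict_count /unhappy.
    by case: (_ < _); case: (conflict _ _ _); case: (_ < _).
  have b1 (b1 : bool) : b1 < 2 ^ w by apply: (@leq_ltn_trans 1); [case: b1 | ].
  apply: ev_mul.
  - apply: ev_lt; rewrite // -?x2 // -bad2; apply: ev_mul => //.
      by apply: ev_const; exact: small_lt.
    by rewrite bad2; move: fits_address; rewrite /lo; lia.
  - apply: ev_mul.
    + by apply: ev_sub => //; [exact: ev_const | apply: ev_lt; rewrite // -x2].
    + by apply: ev_sub => //; [exact: ev_const | apply: ev_lt; rewrite // -?x2 // -L2].
    + by apply: (@leq_ltn_trans 1) => //; case: (_ < _); case: (_ < _).
  - by apply: (@leq_ltn_trans 1) => //; case: (_ < _); case: (_ < _); case: (_ < _).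
have rep2 : rep a s2 by split; rewrite ?reg2.
apply: (wp_if (b := ready ext L k E a v)); first by rewrite rdy; case: (ready _ _ _ _ _ _).
have node2 : regs s2 r_node = cells s (regs s r_node).+1 by rewrite reg2.
have top2 : regs s2 r_top = regs s r_top by rewrite reg2.
have class2 : regs s2 r_class = regs s r_class by rewrite reg2.
move: hsp post; rewrite /pop; case: ifP => rv /= hsp post.
  apply: (wp_recolour (a := a) (v := v)) => //.
  - by rewrite reg2.
  - by rewrite reg2.
  move=> t s' tle [ls' mv' tp'] reg' heap' topmono; apply: post.
  - have d1 : 0 < deg E v by move: rv; rewrite /ready /unhappy => /andP[_]; lia.
    lia.
  - by split.
  - by rewrite reg'.
  - rewrite [regs s' r_node]reg' // node2.
    by apply: chain_mono pl; [rewrite -top2 | move=> i hi; rewrite heap' ?cells2 // top2].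
apply: wp_skip; apply: post => //.
- lia.
- by rewrite node2 top2 cells2.
Qed.

Lemma moved_pop_le a v : moved a <= spent a ->
  moved (pop ext L k E a v) <= spent (pop ext L k E a v).
Proof.
by rewrite /pop; case: ifP => //= _ ms; apply: leq_add; rewrite ?deg_le_flip_cost.
Qed.

Lemma spent_foldl_pop_le l a : spent a <= spent (foldl (pop ext L k E) a l).
Proof.
by elim: l a => //= v l IH a; apply: leq_trans (spent_pop_le a v) (IH _).
Qed.

Lemma wp_pops l a s (Q : nat -> state -> Prop) :
  rep a s -> chain (cells s) (regs s r_top) (regs s r_node) l ->
  spent (foldl (pop ext L k E) a l) <= smax -> moved a <= spent a ->
  (forall t s', t + 40 * (inspected a + spent a) <=
       40 * (inspected (foldl (pop ext L k E) a l) + spent (foldl (pop ext L k E) a l)) + 1 ->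
     rep (foldl (pop ext L k E) a l) s' -> regs s' r_class = regs s r_class -> Q t s') ->
  wp w (CWhile (EReg r_node) (c_pop ext)) s Q.
Proof.
elim: l a s Q => [|v l IH] a s Q hrep hch hsp hms post.
  by apply: wp_while0 => //; apply: post => //=; lia.
apply: wp_whileS.
  by case: hch => h _ _ _; rewrite /= -lt0n (leq_trans lo_gt0 h).
apply: (wp_pop hrep hch) => //.
  by apply: leq_trans hsp; exact: spent_foldl_pop_le.
move=> t1 s1 t1le rep1 class1 ch1.
apply: (IH _ _ _ rep1 ch1) => //; first exact: moved_pop_le.
move=> t2 s2 t2le rep2 class2; apply: post => //; last by rewrite class2.
move: t1le t2le => /=; lia.
Qed.

Lemma wp_visit a s c (Q : nat -> state -> Prop) :
  rep a s -> regs s r_class = c -> c < k ->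
  spent (visit ext L k E a c) <= smax -> moved a <= spent a ->
  (forall t s', t + 40 * (inspected a + spent a) <=
       40 * (inspected (visit ext L k E a c) + spent (visit ext L k E a c)) + 5 ->
     rep (visit ext L k E a c) s' -> regs s' r_class = c -> Q t s') ->
  wp w (c_visit ext) s Q.
Proof.
move=> [ls hmoved htop] hc ck hsp hms post.
have head s0 : regs s0 r_n = n -> regs s0 r_base = base -> regs s0 r_class = c ->
    eval_expr w s0 (e_head (EReg r_class)) = base + n + c.
  move=> h1 h2 h3; rewrite -h1 -h2 -h3; rewrite /e_head.
  by ev; rewrite ?h1 ?h2 ?h3; move: fits_address; rewrite /lo; lia.
apply: wp_seq; apply: wp_assign; first by apply: ev_mem; apply: head; rewrite ?(reg_n ls) ?(reg_base ls).
apply: wp_seq; eapply wp_store.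
- by apply: head; rewrite /= /upd /= ?(reg_n ls) ?(reg_base ls).
- by apply: ev_const; exact: small_lt.
set s1 := State _ _.
apply: (wp_pops (l := bucket a c) (a := empty_bucket a c)) => //.
- split => //; case: ls => h1 h2 h3 h4 h5 h6 h7 h8; split => //=.
  + by move=> i ib; rewrite /upd ltn_eqF ?h5 //; lia.
  + by move=> v; rewrite /upd ltn_eqF ?h6 //; have := ltn_ord v; lia.
  + move=> d dk; rewrite [upd _ _ _ (base + n + d)]/upd eqn_add2l; case: eqP => // dc.
    apply: chain_mono (h7 d dk) => // i /andP[il _].
    by rewrite /upd gtn_eqF //; move: il; rewrite /lo; lia.
- apply: chain_mono (bucket_cells ls ck) => //= i /andP[il _].
  by rewrite /upd gtn_eqF //; move: il; rewrite /lo; lia.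
move=> t s' tle rep' class'; apply: post => //.
  by move: tle; rewrite -/(visit ext L k E a c) /=; lia.
by rewrite class'.
Qed.

Lemma moved_visit_le a c : moved a <= spent a ->
  moved (visit ext L k E a c) <= spent (visit ext L k E a c).
Proof.
move=> ms; have := spent_moved_visit ext L k0 EP (bucket a c) (empty_bucket a c).
by rewrite -/(visit ext L k E a c) /=; lia.
Qed.

Lemma spent_foldl_visit_le r a : spent a <= spent (foldl (visit ext L k E) a r).
Proof.
elim: r a => //= c r IH a; apply: leq_trans (IH _).
exact: (spent_foldl_pop_le _ (empty_bucket a c)).
Qed.

Lemma wp_visits m c a s (Q : nat -> state -> Prop) : c + m = k ->
  rep a s -> regs s r_class = c ->
  spent (foldl (visit ext L k E) a (iota c m)) <= smax -> moved a <= spent a ->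
  (forall t s', t + 40 * (inspected a + spent a) <=
       40 * (inspected (foldl (visit ext L k E) a (iota c m))
             + spent (foldl (visit ext L k E) a (iota c m))) + 8 * m + 1 ->
     rep (foldl (visit ext L k E) a (iota c m)) s' -> Q t s') ->
  wp w (CWhile (e_lt (EReg r_class) (EReg r_k)) (CSeq (c_visit ext)
    (CAssign r_class (e_add (EReg r_class) (EConst 1))))) s Q.
Proof.
elim: m c a s Q => [|m IH] c a s Q cm hrep hc hsp hms post; have [ls _ _] := hrep.
  apply: wp_while0; first by rewrite ev_lt_reg hc (reg_k ls) -cm addn0 ltnn.
  by apply: post => //=; lia.
apply: wp_whileS; first by rewrite ev_lt_reg hc (reg_k ls) -cm addnS leq_addr.
have ck : c < k by rewrite -cm addnS ltnS leq_addr.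
apply: wp_seq; apply: (wp_visit hrep hc ck) => //.
  by apply: leq_trans hsp => /=; exact: spent_foldl_visit_le.
move=> t1 s1 t1le [ls1 mv1 tp1] class1; eapply wp_assign.
  apply: ev_add; [exact: ev_reg | by apply: ev_const; exact: small_lt |].
  by rewrite class1; move: fits_address; rewrite /lo; lia.
apply: (IH c.+1 (visit ext L k E a c)) => //.
- by rewrite addSnnS.
- by split => //; case: ls1 => *; split.
- by rewrite /= /upd /= class1 addn1.
- exact: moved_visit_le.
move=> t2 s2 t2le rep2; apply: post => //.
move: t1le t2le => /=; lia.
Qed.

Lemma wp_sweep a s (Q : nat -> state -> Prop) :
  rep a s -> spent (sweep ext L k E a) <= smax ->
  (forall t s', t + 40 * (inspected a + spent a) <=
       40 * (inspected (sweep ext L k E a) + spent (sweep ext L k E a)) + 8 * k + 5 ->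
     rep (sweep ext L k E a) s' -> Q t s') ->
  wp w (c_sweep ext) s Q.
Proof.
move=> [ls hmoved htop] hsp post.
apply: wp_seq; eapply wp_assign; first by ev; exact: small_lt.
apply: wp_seq; eapply wp_assign; first by ev; exact: small_lt.
apply: (wp_visits (m := k) (c := 0)
  (a := ProcessState (chi a) (bucket a) 0 (spent a) (inspected a))) => //.
  by split => //; case: ls => *; split.
move=> t s' tle rep'; apply: post => //.
by move: tle; rewrite -/(sweep ext L k E a) /=; lia.
Qed.

Lemma ev_continue a s : rep a s -> moved a <= smax + n + 1 ->
  eval_expr w s (e_lt (EReg r_n) (e_mul (EReg r_moved) (EReg r_L))) = (n < moved a * L).
Proof.
move=> [ls hmoved _] hmv; rewrite -hmoved -(reg_L ls) -[in RHS](reg_n ls).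
apply: ev_lt; [exact: ev_reg | | exact: small_lt].
apply: ev_mul; [exact: ev_reg | exact: ev_reg |].
rewrite hmoved (reg_L ls); apply: leq_ltn_trans fits_product.
exact: leq_mul.
Qed.

(** A sweep after which the loop goes on has spent at least 1, so [smax - spent a]
bounds the number of such sweeps. *)
Lemma wp_sweeps m a s (Q : nat -> state -> Prop) :
  rep a s -> moved a <= smax + n + 1 ->
  (forall i, spent (iter i (sweep ext L k E) a) <= smax) ->
  moved a * L <= n \/ smax < m + spent a ->
  (forall t s' i, let a' := iter i (sweep ext L k E) a in
     (forall i', i' < i -> n < moved (iter i' (sweep ext L k E) a) * L) ->
     moved a' * L <= n -> rep a' s' ->
     t + 40 * (inspected a + spent a) <=
       40 * (inspected a' + spent a') + (8 * k + 6) * i + 1 -> Q t s') ->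
  wp w (CWhile (e_lt (EReg r_n) (e_mul (EReg r_moved) (EReg r_L))) (c_sweep ext)) s Q.
Proof.
elim: m a s Q => [|m IH] a s Q hrep hmv hsp stop post; have [ls hmoved _] := hrep.
  have test := ev_continue hrep hmv.
  have {}stop : moved a * L <= n by case: stop => //; have := hsp 0 => /=; lia.
  apply: wp_while0; first by rewrite test ltnNge stop.
  by apply: (post _ _ 0) => //=; lia.
have test := ev_continue hrep hmv.
have [go|stay] := ltnP n (moved a * L); last first.
  apply: wp_while0; first by rewrite test ltnNge stay.
  by apply: (post _ _ 0) => //=; lia.
apply: wp_whileS; first by rewrite test go.
have sp1 : spent (sweep ext L k E a) <= smax by exact: (hsp 1).
apply: (wp_sweep hrep sp1) => t1 s1 t1le rep1.
have ms := spent_moved_sweep ext L k0 EP a.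
apply: (IH (sweep ext L k E a)) => //.
- by move: ms sp1; lia.
- by move=> i; have := hsp i.+1; rewrite iterSr.
- have [|] := leqP (moved (sweep ext L k E a) * L) n; [by left | move=> go1; right].
  have : 0 < moved (sweep ext L k E a) by case: (moved _) go1.
  by case: stop go => [|st _]; [lia | move: st ms; lia].
move=> t2 s2 i; rewrite -iterSr => a' hi hstop rep2 t2le.
apply: (post _ _ i.+1) => //.
  by case=> [_ //|i' ii]; rewrite iterSr; exact: hi.
move: t1le t2le; rewrite mulnS; rewrite -/a'; lia.
Qed.

Lemma wp_log_loop y x s (Q : nat -> state -> Prop) :
  x <= n -> regs s r_x = x -> regs s r_u = y -> x + y <= n ->
  (forall t s', t <= 4 * trunc_log 2 x + 1 -> cells s' = cells s ->
     regs s' r_u = y + trunc_log 2 x ->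
     (forall r, r \notin [:: r_u; r_x] -> regs s' r = regs s r) -> Q t s') ->
  wp w (CWhile (e_lt (EConst 1) (EReg r_x))
    (CSeq (CAssign r_x (e_div (EReg r_x) (EConst 2)))
          (CAssign r_u (e_add (EReg r_u) (EConst 1))))) s Q.
Proof.
elim/ltn_ind: x y s Q => x IH y s Q xn hx hu xy post.
have nw : n < 2 ^ w by move: fits_address; rewrite /lo; lia.
have test : eval_expr w s (e_lt (EConst 1) (EReg r_x)) = (1 < x).
  by rewrite -hx; apply: ev_lt; [apply: ev_const | exact: ev_reg | ]; exact: small_lt.
have [x1|x1] := leqP x 1.
  apply: wp_while0; first by rewrite test ltnNge x1.
  have lx : trunc_log 2 x = 0 by case: x x1 {IH xn hx xy post test} => [|[]].
  by apply: post; rewrite // lx ?addn0.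
apply: wp_whileS; first by rewrite test x1.
apply: wp_seq; eapply wp_assign.
  apply: ev_div; [exact: ev_reg | by apply: ev_const; exact: small_lt |].
  by rewrite hx; lia.
eapply wp_assign.
  apply: ev_add; [exact: ev_reg | by apply: ev_const; exact: small_lt |].
  by rewrite /= /upd /= hu; lia.
have lx := trunc_log2S x1.
rewrite hx /= /upd /= hu; apply: (IH x./2 _ (y + 1)) => //=.
- by rewrite -divn2; lia.
- lia.
- by rewrite divn2.
- lia.
move=> t s' tle cells' u' regs'; apply: post => //.
- by rewrite lx; lia.
- by rewrite u' lx; lia.
- move=> r rn; rewrite regs' //; move: rn; rewrite !inE negb_or.
  by move=> /andP[/negbTE -> /negbTE ->].
Qed.

Lemma wp_log x s (Q : nat -> state -> Prop) :
  x <= n -> regs s r_x = x ->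
  (forall t s', t <= 4 * n + 5 -> cells s' = cells s ->
     regs s' r_x = trunc_log 2 x ->
     (forall r, r \notin [:: r_u; r_x] -> regs s' r = regs s r) -> Q t s') ->
  wp w c_log s Q.
Proof.
move=> xn hx post; have lx : trunc_log 2 x <= x.
  have [->//|x0] := posnP x.
  by apply: leq_trans (trunc_logP (ltnSn 1) x0); exact: ltnW (ltn_expl _ _).
apply: wp_seq; eapply wp_assign; first by ev; exact: small_lt.
apply: wp_seq; apply: (@wp_log_loop 0 x) => //=; first by rewrite addn0.
move=> t s' tle cells' u' regs'; eapply wp_assign; first exact: ev_reg.
apply: post => //=.
- lia.
- move=> r rn; rewrite /upd; move: (rn); rewrite !inE negb_or => /andP[ru /negbTE ->].
  by rewrite regs' //= /upd (negbTE ru).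
Qed.

Definition initial_colouring : colouring n := [ffun v : 'I_n => odd v].

Definition initial_state : process_state n :=
  ProcessState initial_colouring (foldl (push k) (fun=> [::]) (enum 'I_n)) n.+1 0 0.

Lemma size_graph_words : size (graph_words E) = base.
Proof.
rewrite /base offset_last /graph_words size_cat size_mkseq; congr (_ + _).
rewrite size_flatten /shape -map_comp sumnE big_map big_enum /=.
by apply: eq_bigr => v _; rewrite size_nbrs.
Qed.

Definition partial_colouring i : colouring n := [ffun v : 'I_n => (v < i) && odd v].

Lemma wp_init_loop m i s (Q : nat -> state -> Prop) : i + m = n ->
  layout (partial_colouring i) (foldl (push k) (fun=> [::]) (take i (enum 'I_n))) s ->
  regs s r_u = i -> regs s r_top = lo + 2 * i ->
  (forall t s', t <= 13 * m + 1 ->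
     layout initial_colouring (foldl (push k) (fun=> [::]) (enum 'I_n)) s' ->
     regs s' r_top = lo + 2 * n -> Q t s') ->
  wp w (CWhile (e_lt (EReg r_u) (EReg r_n))
    (CSeq (CStore (e_add (EReg r_base) (EReg r_u)) (e_mod (EReg r_u) (EConst 2)))
      (CSeq c_push (CAssign r_u (e_add (EReg r_u) (EConst 1)))))) s Q.
Proof.
elim: m i s Q => [|m IH] i s Q im ls hu htop post; have hn := reg_n ls.
  rewrite addn0 in im; apply: wp_while0; first by rewrite ev_lt_reg hu hn im ltnn.
  apply: post; rewrite ?muln0 // ?htop ?im //.
  rewrite take_oversize ?size_enum_ord ?im // in ls.
  suff -> : initial_colouring = partial_colouring n by [].
  by apply/ffunP => v; rewrite !ffunE ltn_ord.
have iltn : i < n by lia.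
pose v := Ordinal iltn; have hb := reg_base ls.
have fits : base + n + 2 < 2 ^ w by move: fits_address; rewrite /lo; lia.
apply: wp_whileS; first by rewrite ev_lt_reg hu hn iltn.
apply: wp_seq; eapply wp_store.
- by ev; rewrite hu hb; lia.
- by apply: ev_mod; [exact: ev_reg | apply: ev_const; lia | rewrite hu; lia].
rewrite hb hu.
have ls1 := layout_colour (chi' := partial_colouring i.+1) (v := v) (x := i %% 2) ls.
apply: wp_seq; apply: (@wp_push (partial_colouring i.+1)
  (foldl (push k) (fun=> [::]) (take i (enum 'I_n))) _ v) => //=.
- apply: ls1; first by rewrite ffunE /= leqnn modn2.
  by move=> u uv; rewrite !ffunE ltnS leq_eqVlt -[_ == i]/(u == v) (negbTE uv).
- by rewrite htop; move: fits_address; lia.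
move=> t1 s1 t1le ls2 top1 reg1 _.
have u1 : regs s1 r_u = i by rewrite reg1.
eapply wp_assign.
  apply: ev_add; [exact: ev_reg | apply: ev_const; lia |].
  by rewrite u1; lia.
apply: (IH i.+1) => /=.
- by rewrite addSnnS.
- have vi : v < size (enum 'I_n) by rewrite size_enum_ord.
  rewrite (take_nth v) // -[nth _ _ _]/(nth v (enum 'I_n) v) nth_ord_enum foldl_rcons.
  by case: ls2 => *; split.
- by rewrite /upd /= u1 addn1.
- by rewrite /upd /= top1 htop; lia.
move=> t s' tle ls' top'; apply: post => //; lia.
Qed.

Hypothesis L_def : L = (trunc_log 2 (trunc_log 2 (trunc_log 2 n))).+1.
Hypothesis k_def : k = L * L.

Lemma wp_init (Q : nat -> state -> Prop) s : regs s = upd (fun=> 0) 0 n ->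
  cells s = nth 0 (graph_words E) ->
  (forall t s', t <= 25 * n + 40 -> rep initial_state s' -> Q t s') ->
  wp w c_init s Q.
Proof.
move=> hr hc post.
have log_le x : trunc_log 2 x <= x.
  have [->//|x0] := posnP x.
  by apply: leq_trans (trunc_logP (ltnSn 1) x0); exact: ltnW (ltn_expl _ _).
have Lw : L * L.+1 < 2 ^ w.
  apply: leq_ltn_trans fits_product; rewrite leq_mul2r L_def.
  by have := log_le n; have := log_le (trunc_log 2 n);
     have := log_le (trunc_log 2 (trunc_log 2 n)); lia.
apply: wp_seq; apply: wp_assign; first exact: ev_reg.
rewrite hr.
apply: wp_seq; apply: (@wp_log n) => //= t1 s1 t1le cells1 x1 regs1.
apply: wp_seq; apply: (wp_log _ x1) => [//|t2 s2 t2le cells2 x2 regs2].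
apply: wp_seq; apply: (wp_log _ x2) => [|t3 s3 t3le cells3 x3 regs3].
  by apply: leq_trans (log_le _) (log_le _).
have c3 : cells s3 = nth 0 (graph_words E) by rewrite cells3 cells2 cells1.
have r3 r : r \notin [:: r_u; r_x] -> regs s3 r = upd (fun=> 0) 0 n r.
  move=> rn; rewrite regs3 // regs2 // regs1 //= /upd.
  by move: rn; rewrite !inE negb_or => /andP[_ /negbTE ->].
have n3 : regs s3 r_n = n by rewrite r3.
apply: wp_seq; eapply wp_assign.
  apply: ev_add; [exact: ev_reg | by apply: ev_const; exact: small_lt |].
  by rewrite x3; move: Lw; rewrite L_def addn1 => /(leq_ltn_trans _); apply; exact: leq_pmulr.
rewrite x3 addn1 -L_def.
apply: wp_seq; eapply wp_assign.
  apply: ev_mul; [exact: ev_reg | exact: ev_reg |].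
  by rewrite /= /upd /=; apply: leq_ltn_trans Lw; rewrite leq_mul2l leqnSn orbT.
rewrite /= /upd /= -k_def.
apply: wp_seq; apply: wp_assign; first by ev.
rewrite /= n3 c3 -/(offset E n) -/base.
apply: wp_seq; eapply wp_assign.
  by rewrite /e_head; ev; rewrite /= /upd /= ?n3; move: fits_address; rewrite /lo; lia.
rewrite /= /upd /= n3 -/lo.
apply: wp_seq; eapply wp_assign; first by ev; exact: small_lt.
set s4 := State _ _.
apply: wp_seq; apply: (@wp_init_loop n 0) => //.
- split; rewrite /s4 //= ?c3 //.
  + move=> v; rewrite nth_default ?ffunE //.
    by rewrite size_graph_words leq_addr.
  + move=> c ck; rewrite take0 /= nth_default // size_graph_words -addnA.
    exact: leq_addr.
- by rewrite /s4 /= /upd /= muln0 addn0.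
move=> t s' tle ls' top'; have n' := reg_n ls'.
eapply wp_assign.
  apply: ev_add; [exact: ev_reg | by apply: ev_const; exact: small_lt |].
  by rewrite n'; move: fits_address; rewrite /lo; lia.
apply: post => //; first lia.
split.
- by case: ls' => *; split.
- by rewrite /= /upd /= n' addn1.
- by rewrite /= /upd /= top' addn0.
Qed.

Lemma wp_count_loop chi b m i s (Q : nat -> state -> Prop) : i + m = n ->
  layout chi b s -> regs s r_v = i -> regs s r_x = below chi i ->
  (forall t s', t <= 6 * m + 1 -> layout chi b s' -> regs s' r_x = below chi n -> Q t s') ->
  wp w (CWhile (e_lt (EReg r_v) (EReg r_n))
    (CSeq (CAssign r_x (e_add (EReg r_x) (e_colour (EReg r_v))))
          (CAssign r_v (e_add (EReg r_v) (EConst 1))))) s Q.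
Proof.
elim: m i s Q => [|m IH] i s Q im ls hi hx post; have hn := reg_n ls.
  rewrite addn0 in im; apply: wp_while0; first by rewrite ev_lt_reg hi hn im ltnn.
  by apply: post; rewrite // hx im.
have iltn : i < n by lia.
pose v := Ordinal iltn; have nw : n < 2 ^ w by move: fits_address; rewrite /lo; lia.
apply: wp_whileS; first by rewrite ev_lt_reg hi hn iltn.
have below_le j : below chi j <= n.
  by rewrite -[leqRHS](below_compl chi) (leq_trans _ (leq_addr _ _)) // /below;
     rewrite [leqRHS](bigID (fun u : 'I_n => u < j)) /= (leq_trans _ (leq_addr _ _)) //;
     rewrite [leqRHS](eq_bigl (fun u : 'I_n => u < j)) // => u; rewrite ltn_ord.
have hb := belowS chi v; rewrite /= in hb.
apply: wp_seq; eapply wp_assign.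
  apply: ev_add; [exact: ev_reg | exact: (ev_colour (v := v) (reg_base ls) hi (colour_cells ls)) |].
  by rewrite hx -hb; apply: leq_ltn_trans nw; exact: below_le.
rewrite hx -hb; eapply wp_assign.
  apply: ev_add; [exact: ev_reg | by apply: ev_const; exact: small_lt |].
  by rewrite /= /upd /= hi; lia.
rewrite /= /upd /= hi addn1; apply: (IH i.+1) => //.
- by rewrite addSnnS.
- by case: ls => *; split.
move=> t s' tle ls' x'; apply: post => //; lia.
Qed.

Lemma wp_rebalance_loop chi m i s (Q : nat -> state -> Prop) : i + m = n ->
  regs s r_n = n -> regs s r_base = base ->
  (forall v, cells s (base + v) = chi v) -> regs s r_v = i ->
  regs s r_red = red_excess chi - below chi i ->
  regs s r_blue = blue_excess chi - below (fun u => ~~ chi u) i ->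
  (forall v, v < i -> cells s v = rebalanced chi v) ->
  (forall t s', t <= 9 * m + 1 -> (forall v, cells s' v = rebalanced chi v) -> Q t s') ->
  wp w (CWhile (e_lt (EReg r_v) (EReg r_n))
    (CSeq (CIf (e_colour (EReg r_v))
       (CIf (e_lt (EConst 0) (EReg r_red))
          (CSeq (CStore (EReg r_v) (EConst 0)) (CAssign r_red (e_sub (EReg r_red) (EConst 1))))
          (CStore (EReg r_v) (EConst 1)))
       (CIf (e_lt (EConst 0) (EReg r_blue))
          (CSeq (CStore (EReg r_v) (EConst 1)) (CAssign r_blue (e_sub (EReg r_blue) (EConst 1))))
          (CStore (EReg r_v) (EConst 0))))
     (CAssign r_v (e_add (EReg r_v) (EConst 1))))) s Q.
Proof.
elim: m i s Q => [|m IH] i s Q im hn hb hcol hi hr hbl hout post.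
  rewrite addn0 in im; apply: wp_while0; first by rewrite ev_lt_reg hi hn im ltnn.
  by apply: post => // v; apply: hout; rewrite im.
have iltn : i < n by lia.
pose v := Ordinal iltn; have nw : n < 2 ^ w by move: fits_address; rewrite /lo; lia.
have nb : n < base by exact: offset0_gt.
have one : 1 < 2 ^ w by exact: small_lt.
have red_lt : regs s r_red < 2 ^ w.
  by rewrite hr /red_excess; have := below_compl chi; lia.
have blue_lt : regs s r_blue < 2 ^ w by rewrite hbl /blue_excess; lia.
apply: wp_whileS; first by rewrite ev_lt_reg hi hn iltn.
have hS := belowS chi v; have hS' := belowS (fun u => ~~ chi u) v; rewrite /= in hS hS'.
have ev_v := ev_colour (v := v) hb hi hcol.
(* all four branches write the new colour of [v] to its output cell *)
have finish rd bl t0 x : x = rebalanced chi v :> nat -> t0 <= 5 -> rd = red_excess chi - below chi i.+1 ->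
    bl = blue_excess chi - below (fun u => ~~ chi u) i.+1 ->
    forall r', r' r_n = n -> r' r_base = base -> r' r_v = i ->
    r' r_red = rd -> r' r_blue = bl ->
    wp w (CAssign r_v (e_add (EReg r_v) (EConst 1)))
      (State r' (upd (cells s) i x))
      (fun t2 s2 => wp w (CWhile (e_lt (EReg r_v) (EReg r_n))
    (CSeq (CIf (e_colour (EReg r_v))
       (CIf (e_lt (EConst 0) (EReg r_red))
          (CSeq (CStore (EReg r_v) (EConst 0)) (CAssign r_red (e_sub (EReg r_red) (EConst 1))))
          (CStore (EReg r_v) (EConst 1)))
       (CIf (e_lt (EConst 0) (EReg r_blue))
          (CSeq (CStore (EReg r_v) (EConst 1)) (CAssign r_blue (e_sub (EReg r_blue) (EConst 1))))
          (CStore (EReg r_v) (EConst 0))))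
     (CAssign r_v (e_add (EReg r_v) (EConst 1))))) s2
     (fun t3 => [eta Q ((t0 + t2).+1 + t3).+1])).
  move=> -> t0le -> -> r' n' b' v' rd' bl'; eapply wp_assign.
    apply: ev_add; [exact: ev_reg | exact: ev_const |].
    by rewrite /= v'; lia.
  rewrite /= v' addn1; apply: (IH i.+1) => //=.
  - by rewrite addSnnS.
  - by move=> u; rewrite /upd gtn_eqF ?hcol //; lia.
  - move=> u; rewrite ltnS leq_eqVlt /upd -[u == i :> nat]/(u == v).
    by case: (u =P v) => [->|_ /=]; last exact: hout.
  by move=> t s' tle out'; apply: post => //; lia.
apply: wp_seq; have [cv|cv] := boolP (chi v).
  rewrite cv in ev_v hS; rewrite cv /= addn0 in hS'.
  have rv : rebalanced chi v = ~~ (0 < regs s r_red) :> bool.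
    rewrite ffunE /recoloured cv hr addTb; congr (~~ _).
    by rewrite /= subn_gt0.
  apply: (wp_if (b := true)); first by rewrite ev_v.
  apply: (wp_if (b := 0 < regs s r_red)).
    rewrite (ev_lt (a := 0) (b := regs s r_red)) //; last by apply: ev_const; exact: small_lt.
    by case: (_ < _).
  case: ifP => rd; rewrite rd /= in rv.
    apply: wp_seq; eapply wp_store; [by ev | by apply: ev_const; exact: small_lt |].
    eapply wp_assign; first by apply: ev_sub; [exact: ev_reg | exact: ev_const |].
    rewrite /= hi; apply: finish; rewrite ?rv /upd //= ?hS' //.
    by rewrite hS hr; lia.
  eapply wp_store; [by ev | by apply: ev_const |].
  rewrite hi; apply: finish => //; rewrite ?rv //; by rewrite ?hS' // hS hr; move: rd; rewrite hr; lia.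
rewrite (negbTE cv) in ev_v; rewrite (negbTE cv) /= addn0 in hS; rewrite cv in hS'.
have rv : rebalanced chi v = (0 < regs s r_blue) :> bool.
  rewrite ffunE /recoloured (negbTE cv) hbl addFb.
  by rewrite /= subn_gt0.
apply: (wp_if (b := false)); first by rewrite ev_v.
apply: (wp_if (b := 0 < regs s r_blue)).
  rewrite (ev_lt (a := 0) (b := regs s r_blue)) //; last by apply: ev_const; exact: small_lt.
  by case: (_ < _).
case: ifP => rd; rewrite rd /= in rv.
  apply: wp_seq; eapply wp_store; [by ev | by apply: ev_const |].
  eapply wp_assign; first by apply: ev_sub; [exact: ev_reg | exact: ev_const |].
  rewrite /= hi; apply: finish; rewrite ?rv /upd //= ?hS //.
  by rewrite hS' hbl; lia.
eapply wp_store; [by ev | by apply: ev_const; exact: small_lt |].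
rewrite hi; apply: finish => //; rewrite ?rv //; by rewrite ?hS // hS' hbl; move: rd; rewrite hbl; lia.
Qed.

(** The program stops after the first sweep that moves vertices of total degree
at most [n / L]; the initial value [n.+1] of [moved] forces a first sweep. *)
Lemma wp_program (Q : nat -> state -> Prop) s : regs s = upd (fun=> 0) 0 n ->
  cells s = nth 0 (graph_words E) ->
  (forall i, spent (iter i (sweep ext L k E) initial_state) <= smax) ->
  (forall t s' i, let a := iter i (sweep ext L k E) initial_state in
     (forall i', i' < i -> n < moved (iter i' (sweep ext L k E) initial_state) * L) ->
     moved a * L <= n ->
     t <= 40 * n + 60 + 40 * (inspected a + spent a) + (8 * k + 6) * i ->
     output n s' = rebalanced (chi a) -> Q t s') ->
  wp w (program ext) s Q.
Proof.
move=> hr hc hsp post.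
have one : 1 < 2 ^ w by exact: small_lt.
apply: wp_seq; apply: (wp_init hr hc) => t1 s1 t1le rep1.
apply: wp_seq; apply: (@wp_sweeps smax.+1 _ _ _ rep1) => //=; first lia.
  by right; lia.
move=> t2 s2 i hi hstop [ls2 _ _] t2le.
apply: wp_seq.
apply: wp_seq; eapply wp_assign; first by ev; exact: small_lt.
apply: wp_seq; eapply wp_assign; first by ev; exact: small_lt.
apply: (wp_count_loop (chi := chi (iter i (sweep ext L k E) initial_state))
  (b := bucket (iter i (sweep ext L k E) initial_state)) (m := n) (i := 0)) => //.
- by case: ls2 => *; split.
- by rewrite /= /upd /= below0.
move=> t3 s3 t3le ls3 x3.
set c := chi _ in ls3 x3.
have rn : below c n <= n by rewrite -[leqRHS](below_compl c) leq_addr.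
have nw : 2 * n < 2 ^ w by move: fits_address; lia.
apply: wp_seq; eapply wp_assign.
  apply: ev_div; [apply: ev_sub; [apply: ev_mul; [by apply: ev_const; exact: small_lt
    | exact: ev_reg |] | exact: ev_reg |] | by apply: ev_const; exact: small_lt |].
  - by rewrite x3; lia.
  - by rewrite x3; lia.
  - by rewrite x3; lia.
rewrite x3 (reg_n ls3) -/(red_excess c).
apply: wp_seq; eapply wp_assign.
  apply: ev_div; [apply: ev_sub; [exact: ev_reg | apply: ev_mul; [by apply: ev_const; exact: small_lt
    | exact: ev_reg |] |] | by apply: ev_const; exact: small_lt |].
  - by rewrite /= /upd /= x3; lia.
  - by rewrite /= /upd /= (reg_n ls3); lia.
  - by rewrite /= /upd /= (reg_n ls3); lia.
rewrite /= /upd /= x3 (reg_n ls3) -/(blue_excess c).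
apply: wp_seq; eapply wp_assign; first by ev; exact: small_lt.
apply: (wp_rebalance_loop (chi := c) (m := n) (i := 0)) => //=.
- by rewrite /upd /= (reg_n ls3).
- by rewrite /upd /= (reg_base ls3).
- exact: colour_cells ls3.
- by rewrite /upd /= below0 subn0.
- by rewrite /upd /= below0 subn0.
move=> t4 s4 t4le out4; apply: (post _ _ i) => //.
- by move: t1le t2le t3le t4le; rewrite /=; lia.
- by apply/ffunP => v; rewrite ffunE out4; case: (rebalanced _ _).
Qed.

End ProgramCorrectness.
(** * Influence of a single edge *)

Section Influence.

Variables (n : nat) (ext : bool) (L k : nat).
Implicit Types (E : graph n) (chi : colouring n) (u v z : 'I_n).

Definition differ chi chi' : {set 'I_n} := [set v | chi v != chi' v]%SET.

(** Apart from [Y], a difference between two runs spreads only from vertices that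
have themselves moved in one of the runs, hence have degree at most [L]; so the
set [D t] of differences grows by a factor of at most [L + 2] per step. *)
Lemma influence_growth E (D : nat -> {set 'I_n}) (Y : {set 'I_n}) q :
  #|D 0| <= q -> #|Y| <= q ->
  (forall t, (D t.+1 \subset Y :|: D t :|:
    \bigcup_(u in D t | deg E u <= L) [set v | adj E u v])%SET) ->
  forall t, #|D t| <= q * (L + 2) ^ t.
Proof.
move=> D0 Yq DS; elim=> [|t IH]; first by rewrite muln1.
apply: leq_trans (subset_leq_card (DS t)) _.
apply: leq_trans (leq_card_setU _ _) _.
have h1 : #|\bigcup_(u in D t | deg E u <= L) [set v | adj E u v]|%SET <= #|D t| * L.
  apply: (@leq_trans (\sum_(u in D t | deg E u <= L) #|[set v | adj E u v]%SET|)).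
    elim/big_rec2: _ => [|u x A _ h]; first by rewrite cards0.
    by apply: leq_trans (leq_card_setU _ _) _; rewrite leq_add2l.
  rewrite -sum_nat_const big_mkcondr; apply: leq_sum => u _.
  by case: ifP => // h; rewrite cardsE.
have h2 := (leq_card_setU Y (D t)).1.
have h3 : q <= q * (L + 2) ^ t by rewrite leq_pmulr // expn_gt0 addn2.
have h4 : #|D t| * L <= q * (L + 2) ^ t * L by rewrite leq_mul2r IH orbT.
rewrite expnS mulnCA mulnDl [L * _]mulnC.
apply: leq_trans (leq_add (leq_trans h2 (leq_add Yq IH)) (leq_trans h1 h4)) _.
by move: h3; move: (q * _) => x; lia.
Qed.

Lemma unhappy_eq_nbrs E E' chi chi' v :
  (forall u, adj E v u = adj E' v u) -> chi v = chi' v ->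
  (forall u, adj E v u -> chi u = chi' u) ->
  unhappy ext E chi v = unhappy ext E' chi' v.
Proof.
move=> hadj hv hu; rewrite /unhappy /deg /bad_deg.
congr (_ < 2 * _); first exact: eq_card.
apply: eq_card => u; rewrite !inE -hadj; case: (boolP (adj E v u)) => //= vu.
by rewrite /bad hv hu.
Qed.

Lemma frozen_eq_nbrs E E' v : (forall u, adj E v u = adj E' v u) ->
  frozen L k E v = frozen L k E' v.
Proof.
move=> hadj; rewrite /frozen /conflict /deg; congr (_ || _).
  by congr (_ < _); exact: eq_card.
by apply: eq_existsb => u; rewrite hadj.
Qed.

(** A vertex decides on the basis of its own colour and those of its
neighbours. *)
Lemma differ_step E E' chi chi' c v :
  (forall u, adj E v u = adj E' v u) ->
  class_step ext L k E chi c v != class_step ext L k E' chi' c v ->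
  (v \in differ chi chi') || [exists u in differ chi chi', adj E u v].
Proof.
move=> hadj; apply: contraTT; rewrite negb_or inE negbK => /andP[/eqP hv].
rewrite negb_exists_in => /forall_inP h; rewrite negbK !ffunE hv /moves.
rewrite (frozen_eq_nbrs hadj) (unhappy_eq_nbrs hadj hv) // => u vu.
apply/eqP; have [//|du] := boolP (chi u == chi' u).
by have := h u; rewrite inE du adjC vu => /(_ isT).
Qed.

Lemma moved_low_degree E chi0 t v : chi0 v != col ext L k E chi0 t v -> deg E v <= L.
Proof.
elim: t => [|t IH] /=; first by rewrite eqxx.
rewrite ffunE; have [m|nm] := boolP (moves ext L k E (col ext L k E chi0 t) (t %% k) v).
  by move: m => /and3P[_ + _] _; rewrite /frozen negb_or -leqNgt => /andP[].
by rewrite addbF; exact: IH.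
Qed.

(** Away from [e] both graphs look the same; a vertex of [e] whose colour differs
has moved in one of the graphs, so it has degree at most [L] in the smaller one. *)
Lemma edge_influence E e chi0 t : e \in pairs n ->
  #|differ (col ext L k (e |: E)%SET chi0 t) (col ext L k (E :\ e)%SET chi0 t)|
    <= 2 * (L + 2) ^ t.
Proof.
move=> eP; set E1 := (e |: E)%SET; set E0 := (E :\ e)%SET.
apply: (@influence_growth E0 (fun t => differ (col ext L k E1 chi0 t) (col ext L k E0 chi0 t)) e).
- by rewrite (_ : differ _ _ = set0) ?cards0 //; apply/setP => v; rewrite !inE eqxx.
- by move: eP; rewrite inE => /eqP ->.
move=> {}t; apply/fintype.subsetP => v; rewrite inE => dv.
rewrite !inE; have [//|ve] := boolP (v \in e).
have hadj u : adj E1 v u = adj E0 v u.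
  rewrite /adj !inE (_ : [set v; u]%SET == e = false) //; apply/eqP => h.
  by move: ve; rewrite -h set21.
have := differ_step hadj dv; rewrite inE => /orP[->//|/existsP[u /andP[du uv]]].
rewrite orFb; apply/orP; right; apply/bigcupP; exists u; last first.
  by rewrite inE adjC -hadj adjC.
rewrite du /=; have d01 : deg E0 u <= deg E1 u.
  apply: subset_leq_card; apply/fintype.subsetP => x; rewrite !inE /adj !inE.
  by case/andP => _ ->; rewrite orbT.
move: du; rewrite inE => du.
have [h|/moved_low_degree //] := eqVneq (chi0 u) (col ext L k E0 chi0 t u).
apply: leq_trans d01 _; apply: (@moved_low_degree _ chi0 t).
by rewrite eq_sym h.
Qed.

Lemma colour_influence E chi0 chi0' t :
  #|differ (col ext L k E chi0 t) (col ext L k E chi0' t)|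
    <= (\sum_(z in differ chi0 chi0') (deg E z).+1) * (L + 2) ^ t.
Proof.
set Z := differ chi0 chi0'.
apply: (@influence_growth E
  (fun t => differ (col ext L k E chi0 t) (col ext L k E chi0' t))
  (\bigcup_(z in Z) [set v | adj E z v])%SET).
- by rewrite /= -/Z -sum1_card; apply: leq_sum.
- elim/big_rec2: _ => [|u x A _ h]; first by rewrite cards0.
  by apply: leq_trans (leq_card_setU _ _) _; rewrite leq_add // cardsE ltnW.
move=> {}t; apply/fintype.subsetP => v; rewrite inE => dv.
rewrite !inE; have := differ_step (fun=> erefl) dv.
rewrite inE => /orP[->|/existsP[u /andP[du uv]]]; first by rewrite orbT.
have [uZ|uZ] := boolP (u \in Z).
  by do 2![apply/orP; left]; apply/bigcupP; exists u => //; rewrite inE.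
apply/orP; right; apply/bigcupP; exists u; last by rewrite inE.
rewrite du /=; move: du uZ; rewrite !inE negbK => du /eqP h0.
have [h|/moved_low_degree //] := eqVneq (chi0 u) (col ext L k E chi0 t u).
apply: (@moved_low_degree _ chi0' t).
by apply: contra du => /eqP h'; rewrite -h -h' h0.
Qed.

Lemma below_differ chi chi' : below chi n <= below chi' n + #|differ chi chi'|.
Proof.
rewrite !below_all -!sum1_card big_mkcond [X in _ <= X + _]big_mkcond
  [X in _ <= _ + X]big_mkcond -big_split; apply: leq_sum => v _ /=.
by rewrite !inE; case: (chi v); case: (chi' v).
Qed.

Lemma differC chi chi' : differ chi chi' = differ chi' chi.
Proof. by apply/setP => v; rewrite !inE eq_sym. Qed.

End Influence.

(** * Symmetry between the colours *)

Section Symmetry.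

Variables (n : nat) (ext : bool) (L k : nat).
Implicit Types (E : graph n) (chi : colouring n) (u v : 'I_n).

Definition twin_nat (i : nat) : nat := if odd i then i.-1 else i.+1.

(** Exchanges [2 i] and [2 i + 1]; the last vertex is fixed if [n] is odd. *)
Definition twin v : 'I_n := insubd v (twin_nat v).

Lemma val_twin v : twin v = (if twin_nat v < n then twin_nat v else v) :> nat.
Proof. by rewrite /twin val_insubd. Qed.

Lemma twinK : involutive twin.
Proof.
move=> v; apply: val_inj; rewrite /= val_twin val_twin /twin_nat.
have vn := ltn_ord v; case: (boolP (odd v)) => ov.
  have -> : v.-1 < n by lia.
  have -> : odd v.-1 = false by case: (val v) ov => //= m /negbTE.
  have v0 : 0 < v by case: (val v) ov.
  by rewrite (prednK v0) vn.
case: (ltnP v.+1 n) => h; last by rewrite (negbTE ov) ltnNge h.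
by rewrite /= ov /= vn.
Qed.

Lemma cls_twin v : cls k (twin v) = cls k v.
Proof.
rewrite /cls; congr (_ %% k); rewrite val_twin /twin_nat.
case: ifP => // _; case: ifP => ov; lia.
Qed.

Lemma odd_twin v : twin v != v -> odd (twin v) = ~~ odd v.
Proof.
rewrite -val_eqE /= val_twin /twin_nat; case: ifP => [_|]; last by rewrite eqxx.
case: (boolP (odd v)) => ov /=; last by [].
by case: (val v) ov => //= m /negbTE.
Qed.

Lemma twin_fixed v : twin v = v -> v = n.-1 :> nat.
Proof.
move=> /(congr1 val) /=; rewrite val_twin /twin_nat; have := ltn_ord v.
case: ifP => [_|/negbT]; case: ifP => ov; lia.
Qed.

Lemma card_twin (p : pred 'I_n) : #|[pred v | p (twin v)]| = #|[pred v | p v]|.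
Proof.
rewrite -!sum1_card [RHS](reindex_inj (inv_inj twinK)) /=.
by apply: eq_bigl => v; rewrite !inE.
Qed.

Definition twin_edge (e : {set 'I_n}) : {set 'I_n} := (twin @: e)%SET.

Lemma twin_edgeK : involutive twin_edge.
Proof.
move=> e; rewrite /twin_edge -imset_comp -[RHS]imset_id.
by apply: eq_imset => v /=; rewrite twinK.
Qed.

Lemma twin_edge_pairs e : (twin_edge e \in pairs n) = (e \in pairs n).
Proof. by rewrite !inE card_imset //; exact: inv_inj twinK. Qed.

Definition twin_graph E : graph n := (twin_edge @: E)%SET.

Lemma mem_twin_graph E e : (twin_edge e \in twin_graph E) = (e \in E).
Proof. by rewrite mem_imset //; exact: inv_inj twin_edgeK. Qed.

Lemma twin_graphK : involutive twin_graph.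
Proof.
move=> E; rewrite /twin_graph -imset_comp -[RHS]imset_id.
by apply: eq_imset => v /=; rewrite twin_edgeK.
Qed.

Lemma adj_twin E u v : adj (twin_graph E) (twin u) (twin v) = adj E u v.
Proof.
rewrite /adj -[RHS]mem_twin_graph.
by rewrite /twin_edge finset.imsetU !imset_set1.
Qed.

Lemma deg_twin E v : deg (twin_graph E) (twin v) = deg E v.
Proof.
rewrite /deg -card_twin; apply: eq_card => u.
by rewrite !inE adj_twin.
Qed.

Lemma frozen_twin E v : frozen L k (twin_graph E) (twin v) = frozen L k E v.
Proof.
rewrite /frozen deg_twin; congr (_ || _); apply/existsP/existsP => -[u].
  move=> h; exists (twin u); move: h.
  by rewrite -(adj_twin _ v) twinK !cls_twin.
by move=> h; exists (twin u); rewrite adj_twin !cls_twin.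
Qed.

Lemma unhappy_twin E chi v :
  unhappy ext (twin_graph E) chi (twin v) = unhappy ext E [ffun u => chi (twin u)] v.
Proof.
rewrite /unhappy deg_twin /bad_deg -card_twin; congr (_ < 2 * _).
by apply: eq_card => u; rewrite !inE adj_twin /bad !ffunE.
Qed.

Lemma col_twin E chi t v :
  col ext L k (twin_graph E) chi t (twin v) = col ext L k E [ffun u => chi (twin u)] t v.
Proof.
elim: t v => [|t IH] v /=; first by rewrite ffunE.
rewrite !ffunE IH /moves frozen_twin cls_twin unhappy_twin.
congr (_ (+) [&& _, _ & unhappy _ _ _ _]).
by apply/ffunP => u; rewrite ffunE IH.
Qed.

Lemma col_negb E chi t :
  col ext L k E [ffun v => ~~ chi v] t = [ffun v => ~~ col ext L k E chi t v].
Proof.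
elim: t => [|t IH] //=; apply/ffunP => v; rewrite IH !ffunE addNb; congr (~~ (_ (+) _)).
rewrite /moves; congr [&& _, _ & _]; rewrite /unhappy; congr (_ < 2 * _).
apply: eq_bad_deg => u _; rewrite /bad !ffunE.
by case: (col _ _ _ _ _ _ u); case: (col _ _ _ _ _ _ v).
Qed.

Lemma below_twin chi : below [ffun v => chi (twin v)] n = below chi n.
Proof.
rewrite !below_all -card_twin; apply: eq_card => v.
by rewrite !inE ffunE twinK.
Qed.

(** Exchanging twins turns the initial colouring into its complement, except
at a fixed vertex; hence it nearly exchanges the two colour classes. *)
Lemma red_twin E t (r := fun E => below (col ext L k E (initial_colouring n) t) n)
    (q := \sum_(z | twin z == z) (deg E z).+1) :
  r E + r (twin_graph E) <= n + q * (L + 2) ^ t /\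
  n <= r E + r (twin_graph E) + q * (L + 2) ^ t.
Proof.
pose chi1 : colouring n := [ffun v => ~~ initial_colouring n (twin v)].
have -> : r (twin_graph E) = below [ffun v => ~~ col ext L k E chi1 t v] n.
  rewrite /r -below_twin -col_negb; congr (below (fun_of_fin _) n).
  apply/ffunP => v; rewrite ffunE col_twin; congr (col _ _ _ _ _ _ v).
  by apply/ffunP => u; rewrite !ffunE negbK.
have hD : #|differ (col ext L k E (initial_colouring n) t) (col ext L k E chi1 t)|
    <= q * (L + 2) ^ t.
  apply: leq_trans (colour_influence _ _ _ _ _ _ _) _; rewrite leq_mul2r; apply/orP; right.
  rewrite /q big_mkcond [leqRHS]big_mkcond; apply: leq_sum => z _.
  rewrite inE !ffunE; have [//|/odd_twin ->] := eqVneq (twin z) z; first by case: ifP.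
  by rewrite negbK eqxx.
have h1 := below_differ (col ext L k E (initial_colouring n) t) (col ext L k E chi1 t).
have h2 := below_differ (col ext L k E chi1 t) (col ext L k E (initial_colouring n) t).
rewrite differC in h2.
have h3 : below (col ext L k E chi1 t) n
    + below [ffun v => ~~ col ext L k E chi1 t v] n = n.
  rewrite -[RHS](below_compl (col ext L k E chi1 t)); congr (_ + _).
  by apply: eq_bigr => v _; rewrite ffunE.
rewrite /r; lia.
Qed.

Section Invariance.

Local Open Scope ring_scope.

Variables (R : realType) (p : R).

Lemma Ex_twin (f : graph n -> R) :
  Ex p (pairs n) (fun E => f (twin_graph E)) = Ex p (pairs n) f.
Proof.
rewrite /Ex [RHS](reindex_inj (inv_inj twin_graphK)) /=; apply: eq_big => E.
  rewrite !inE; apply/fintype.subsetP/fintype.subsetP => h e.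
    by move=> /imsetP[e' /h eP ->]; rewrite twin_edge_pairs.
  by rewrite -mem_twin_graph => /h; rewrite twin_edge_pairs.
move=> _; congr (_ * _); rewrite /wgt [RHS](reindex_inj (inv_inj twin_edgeK)) /=.
by apply: eq_big => e; rewrite ?twin_edge_pairs ?mem_twin_graph.
Qed.

End Invariance.

End Symmetry.

(** * Choice of the parameters *)

Section Levels.

(** A slowly growing integer: it bounds the degrees of the vertices that may
move, and is of the order of the inverse precision. *)
Definition levels n : nat := (trunc_log 2 (trunc_log 2 (trunc_log 2 n))).+1.

Lemma trunc_log2_le n : trunc_log 2 n <= n.
Proof.
have [->//|n0] := posnP n.
by apply: leq_trans (trunc_logP (ltnSn 1) n0); exact: ltnW (ltn_expl _ _).
Qed.

Lemma exp2_levels_le n : 0 < n -> 2 ^ (levels n).-1 <= n.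
Proof.
move=> n0; rewrite /levels /=; have [->//|h] := posnP (trunc_log 2 (trunc_log 2 n)).
apply: leq_trans (trunc_logP (ltnSn 1) h) _.
by apply: leq_trans (trunc_log2_le _) (trunc_log2_le _).
Qed.

Lemma levels_cube n : 0 < n -> levels n ^ 3 <= 48 * n.
Proof.
move=> n0; apply: leq_trans (pow_le_exp2 3 (levels n).-1) _.
by rewrite addnC expnD mulnA; apply: leq_mul (exp2_levels_le n0).
Qed.

Lemma levels_le n : 0 < n -> levels n <= n.
Proof.
by move=> n0; apply: leq_trans (exp2_levels_le n0); exact: ltn_expl.
Qed.

Lemma tower_levels_le n : 1 < levels n -> 2 ^ (2 ^ (2 ^ (levels n).-1)) <= n.
Proof.
rewrite /levels ltnS /= => l0.
have step x : 0 < trunc_log 2 x -> 2 ^ trunc_log 2 x <= x.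
  by case: x => // x _; exact: trunc_logP.
have l1 : 0 < trunc_log 2 (trunc_log 2 n) by apply: leq_trans l0 (trunc_log2_le _).
have l2 : 0 < trunc_log 2 n by apply: leq_trans l1 (trunc_log2_le _).
apply: leq_trans (step _ l2); rewrite leq_exp2l //.
apply: leq_trans (step _ l1); rewrite leq_exp2l //.
exact: step.
Qed.

Lemma levels_large m n : 2 ^ (2 ^ (2 ^ m)) <= n -> m < levels n.
Proof.
move=> h; rewrite /levels ltnS.
have e x : trunc_log 2 (2 ^ x) = x by rewrite trunc_expnK.
by do 3![rewrite -[X in X <= _]e; apply: leq_trunc_log].
Qed.

(** Up to a constant, [(L + 2) ^ (4 * L ^ 4)] is the square of the influence of an
edge during the time considered; the other factors leave room for a union
bound. *)
Lemma levels_power_le n : 6 <= levels n ->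
  (levels n + 2) ^ (4 * levels n ^ 4 + 9) <= n.
Proof.
set L := levels n => L6; apply: leq_trans (tower_levels_le (leq_trans _ L6)) => //.
have small m : 6 <= m -> 5 * m <= (2 ^ m.-1).+1.
  elim: m => // m IH; rewrite leq_eqVlt => /orP[/eqP <-//|m6].
  have := IH m6; case: m m6 {IH} => // m m6 /=; rewrite expnS; lia.
have lin m : m <= 2 ^ m.-1 by case: m => // m; exact: ltn_expl.
apply: (@leq_trans ((2 ^ L) ^ (4 * L ^ 4 + 9))).
  rewrite leq_exp2r; last by rewrite addnS.
  by case: L L6 => // l l6; rewrite expnS; have := lin l.+1; rewrite /=; lia.
rewrite -expnM leq_exp2l //.
apply: (@leq_trans (2 ^ (5 * L).-1)); last first.
  rewrite leq_exp2l //; have := small _ L6.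
  by move: (2 ^ _) => y; lia.
apply: (@leq_trans (2 ^ 4 * (2 ^ L.-1) ^ 5)); last first.
  by rewrite -expnM -expnD leq_exp2l //; lia.
apply: (@leq_trans (2 ^ 4 * L ^ 5)); last by rewrite leq_mul2l leq_exp2r // lin orbT.
have : L <= L ^ 5 by rewrite -{1}(expn1 L) leq_pexp2l //; lia.
rewrite mulnDr mulnCA -expnS; lia.
Qed.

End Levels.

(** * Output and running time of the program *)

Section ProgramSpec.

Variables (R : realType) (n : nat) (ext : bool) (E : graph n).
Hypothesis n0 : 0 < n.
Hypothesis EP : E \subset pairs n.

Let L := levels n.
Let k := L * L.
Let a0 := initial_state n k.
Let after i := iter i (sweep ext L k E) a0.
Let smax := 8 * n * n * n.+1 ^ 2.

Local Open Scope ring_scope.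

Definition flip_bound : R := 8 * \sum_x (deg E x)%:R * potential R E x.

Lemma flip_bound_le : flip_bound <= smax%:R.
Proof.
rewrite /flip_bound /smax -!mulnA natrM ler_wpM2l //.
apply: (@le_trans _ _ (\sum_(x < n) n%:R * n.+1%:R ^+ 2)).
  apply: ler_sum => x _; apply: ler_pM => //; first exact: potential_ge0.
    by rewrite ler_nat deg_le.
  exact: potential_le_sq.
by rewrite sumr_const card_ord -[leLHS]mulr_natl -natrX -!natrM.
Qed.

Lemma bank_initial : bank ext E R a0 <= flip_bound.
Proof.
rewrite /bank /flip_bound add0r.
have := energy_le ext E (potential_ge0 R E) (initial_colouring n).
rewrite /=; lra.
Qed.

Lemma bank_after i : bank ext E R (after i) <= flip_bound.
Proof.
elim: i => [|i IH]; first exact: bank_initial.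
by apply: le_trans IH; exact: bank_sweep.
Qed.

Lemma spent_after i : (spent (after i))%:R <= flip_bound.
Proof. exact: le_trans (spent_le_bank ext E R _) (bank_after i). Qed.

Local Close Scope ring_scope.

Lemma k_gt0 : 0 < k. Proof. by rewrite muln_gt0. Qed.

Let w0 := waiting k E (bucket a0).

Lemma waiting_initial : w0 = n + \sum_v deg E v.
Proof.
rewrite /w0 /waiting pending_foldl_push {1}/pending big1 => [|c _]; last by rewrite big_nil.
rewrite add0n big_enum /= -[X in X + _]card_ord -sum1_card -big_split.
by apply: eq_bigr => v _; rewrite cls_lt ?k_gt0 // mul1n.
Qed.

Lemma tracks_after i : tracks ext L k E (initial_colouring n) (i * k) w0 (after i).
Proof.
elim: i => [|i IH]; last by apply: tracks_sweep => //; exact: k_gt0.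
split => //=.
- by move=> u _; rewrite mem_foldl_push mem_enum eqxx.
- by move=> c u; rewrite mem_foldl_push /= => /andP[_ /eqP].
- by rewrite add0n addn0.
Qed.

(** Each sweep but the last one moves vertices of total degree above [n / L]. *)
Lemma sweeps_le i : (forall i', i' < i -> n < moved (after i') * L) ->
  i.-1 * n <= L * spent (after i).
Proof.
move=> h; suff key j : j < i -> j * n <= L * spent (after j).
  case: i h key => // i h key; apply: leq_trans (key i (leqnn _)) _.
  rewrite leq_mul2l; apply/orP; right.
  have := spent_moved_sweep ext L k_gt0 EP (after i); rewrite -[sweep _ _ _ _ _]/(after i.+1).
  lia.
elim: j => // j IH ji; have := IH (ltnW ji).
have := spent_moved_sweep ext L k_gt0 EP (after j); rewrite -[sweep _ _ _ _ _]/(after j.+1).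
have := h _ ji; nia.
Qed.

(** Besides the potential, the time depends on the number of sweeps, each of
which looks at [k] buckets; as [L ^ 3 = O(n)], the vertices moved in a sweep that
is not the last one pay for this. *)
Lemma program_spec : exists t s' i,
  [/\ exec (word_bits 12 n) (program ext)
        (State (upd (fun=> 0) 0 n) (nth 0 (graph_words E))) t s',
      output n s' = rebalanced (col ext L k E (initial_colouring n) (i * k)),
      #|[pred v | ~~ frozen L k E v &&
          unhappy ext E (col ext L k E (initial_colouring n) (i * k)) v]| * L <= n,
      ((i.-1 * n)%:R <= L%:R * flip_bound)%R &
      (t%:R <= 530 * n%:R + 40 * (\sum_v deg E v)%:R + 752 * flip_bound)%R].
Proof.
have hsp i : spent (after i) <= smax.
  by rewrite -(ler_nat R); apply: le_trans (spent_after i) flip_bound_le.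
have Ln : L <= n := levels_le n0.
have L1 : 0 < L by [].
have L3 : L ^ 3 <= 48 * n := levels_cube n0.
have kn : k <= 48 * n.
  by apply: leq_trans L3; rewrite /k -[L * L]/(L ^ 2) leq_pexp2l.
have wn : n.+1 ^ 12 <= 2 ^ word_bits 12 n.
  rewrite /word_bits mulnC expnM leq_exp2r //.
  exact: trunc_log_ltn.
have sumdeg : \sum_v deg E v <= n * n.
  rewrite -[X in X * _]card_ord -sum_nat_const; apply: leq_sum => v _; exact: deg_le.
have smax4 : smax <= 8 * n.+1 ^ 4.
  rewrite /smax -mulnA -mulnA leq_mul2l /= mulnA (expnD _ 2 2) leq_mul2r.
  by rewrite leq_mul ?orbT.
have N12 : 2 ^ 8 * n.+1 ^ 4 <= n.+1 ^ 12.
  by rewrite -[12]/(8 + 4) expnD leq_mul2r leq_exp2r ?orbT.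
have N4 : n.+1 * n.+1 <= n.+1 ^ 4 by rewrite -[_ * _]/(n.+1 ^ 2) leq_pexp2l.
have fits1 : offset E n + n + k + 2 * (n + smax) + 2 * n + 8 < 2 ^ word_bits 12 n.
  apply: leq_trans wn; apply: leq_trans N12; rewrite offset_last.
  move: N4 smax4 kn sumdeg; move: (n.+1 ^ 4) smax k (\sum_v _) => N4' S K D; nia.
have fits2 : (smax + n + 1) * L.+1 < 2 ^ word_bits 12 n.
  apply: leq_trans wn; apply: (@leq_trans ((9 * n.+1 ^ 4).+1 * n.+1)).
    apply: (@leq_trans ((smax + n + 1) * n.+1).+1); first by rewrite ltnS leq_mul.
    by rewrite ltn_mul2r /= ltnS; lia.
  apply: (@leq_trans (2 ^ 4 * n.+1 ^ 4 * n.+1 ^ 4)); last first.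
    by rewrite -mulnA -expnD -[12]/(4 + (4 + 4)) [leqRHS]expnD leq_mul2r leq_exp2r ?orbT.
  by apply: leq_mul; lia.
have [t [s' [ht [i [hi hstop tle out]]]]] := wp_program (w := word_bits 12 n)
  (s := State (upd (fun=> 0) 0 n) (nth 0 (graph_words E))) (ext := ext)
  (Q := fun t s' => exists i, [/\ (forall i', i' < i -> n < moved (after i') * L),
     moved (after i) * L <= n,
     t <= 40 * n + 60 + 40 * (inspected (after i) + spent (after i)) + (8 * k + 6) * i &
     output n s' = rebalanced (chi (after i))])
  EP k_gt0 L1 fits1 fits2 (erefl _) (erefl _) (erefl _) (erefl _) hsp
  (fun t s' i h1 h2 h3 h4 => ex_intro _ i (And4 h1 h2 h3 h4)).
exists t, s', i; have [hchi hcov hcls hbal] := tracks_after i.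
have i0 : 0 < i.
  case: i hstop {hi tle out hchi hcov hcls hbal} => // h.
  have : n.+1 * L <= n := h.
  by rewrite mulSn; have := leq_pmulr n L1; lia.
split => //; first by rewrite out hchi.
- apply: (leq_trans _ hstop); rewrite leq_mul2r; apply/orP; right.
  case: i i0 {hi tle out} hstop hchi hcov hcls hbal => // i _ hstop hchi _ _ _.
  rewrite -hchi; have := card_ready_sweep k_gt0 (tracks_after i.+1); exact: leq_trans.
- apply: (@le_trans _ _ (L * spent (after i))%:R%R); first by rewrite ler_nat; exact: sweeps_le.
  by rewrite natrM ler_wpM2l // spent_after.
have sweep_time : k * i.-1 <= 48 * spent (after i).
  have h := sweeps_le hi; rewrite -(leq_pmul2r n0).
  apply: (@leq_trans (L ^ 3 * spent (after i))).
    have -> : L ^ 3 = k * L by rewrite expnSr -mulnn.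
    by rewrite -mulnA -[leqRHS]mulnA leq_mul2l h orbT.
  by rewrite mulnAC leq_mul2r L3 orbT.
have tn : t <= 530 * n + 40 * \sum_v deg E v + 752 * spent (after i).
  have e : (8 * k + 6) * i = 8 * k + 6 + 8 * (k * i.-1) + 6 * i.-1.
    by rewrite -{1}(prednK i0); nia.
  have i1k : i.-1 <= k * i.-1 by rewrite leq_pmull ?k_gt0.
  rewrite waiting_initial in hbal.
  move: tle; rewrite e; move: hbal sweep_time i1k kn.
  move: (k * i.-1) (inspected _) (waiting _ _ _) (spent _) (\sum_v _) => x y z u v; lia.
apply: (@le_trans _ _ (530 * n + 40 * \sum_v deg E v + 752 * spent (after i))%:R%R).
  by rewrite ler_nat.
have cast (a b c x y z : nat) :
  ((a * x + b * y + c * z)%:R = a%:R * x%:R + b%:R * y%:R + c%:R * z%:R :> R)%R.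
  by rewrite !natrD !natrM.
rewrite cast lerD2l; apply: ler_wpM2l; [exact: ler0n | exact: spent_after].
Qed.

End ProgramSpec.

Lemma sq_le_exp8 d : d ^ 2 <= 8 ^ d.
Proof.
have h : d <= 2 ^ d by rewrite ltnW // ltn_expl.
rewrite -mulnn (_ : 8 = 2 * 2 * 2) // !expnMn; apply: leq_trans (leq_mul h h) _.
by rewrite leq_pmulr // expn_gt0.
Qed.

(** * Typical graphs *)

Lemma mul_succ_le (F : realFieldType) (x d y : F) :
  (0 <= x -> 0 <= d -> d ^+ 2 <= y -> x * (d + 1) <= x * x + x + y)%R.
Proof. by move=> x0 d0 dy; have := sqr_ge0 (x - d)%R; nra. Qed.

Section TypicalGraphs.

Local Open Scope ring_scope.

Variables (R : realType) (n : nat) (ext : bool).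
Implicit Types (E : graph n) (chi : colouring n).

Let L := levels n.
Let k := (L * L)%N.

Definition degree_weight E : R := \sum_v 8 ^+ deg E v.

Definition red E t : nat := below (col ext L k E (initial_colouring n) t) n.

(** The bound on the potential leaves at most [L ^ 2 + 1] sweeps, so balance is
required at these times only. *)
Definition typical E : bool :=
  [&& degree_weight E <= n%:R * L%:R, flip_bound R E <= n%:R * L%:R,
      (#|[pred v | conflict k E v]| * L <= n)%N &
      [forall i : 'I_(L ^ 2).+2, `|(red E (i * k))%:R - n%:R / 2| <= n%:R / L%:R ^+ 3 :> R]].

(** Recolouring the vertices of [H] can disturb these and their neighbours
only. *)
Lemma unhappy_change E chi (H : pred 'I_n) :
  (#|[pred v | unhappy ext E [ffun v => chi v (+) H v] v]| <=
   #|[pred v | unhappy ext E chi v]| + \sum_(v | H v) (deg E v).+1)%N.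
Proof.
set chi' := [ffun v => _].
apply: (@leq_trans #|[predU [pred v | unhappy ext E chi v] &
    [pred v | H v || [exists u, H u && adj E u v]]]|).
  apply: subset_leq_card; apply/fintype.subsetP => v; rewrite !inE.
  apply: contraTT; rewrite !negb_or => /and3P[uv Hv /existsPn nbr].
  rewrite -(@unhappy_eq_nbrs n ext E E chi chi') // ?ffunE.
    by rewrite (negbTE Hv) addbF.
  move=> u vu; rewrite ffunE; have := nbr u; rewrite adjC vu andbT => /negbTE ->.
  by rewrite addbF.
apply: (@leq_trans (#|[pred v | unhappy ext E chi v]| +
    #|[pred v | H v || [exists u, H u && adj E u v]]|)).
  by rewrite -cardUI leq_addr.
rewrite leq_add2l.
apply: (@leq_trans #|\bigcup_(v | H v) (v |: [set u | adj E v u])%SET|).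
  apply: subset_leq_card; apply/fintype.subsetP => v; rewrite inE.
  case/orP => [Hv|/existsP[u /andP[Hu uv]]]; apply/bigcupP.
    by exists v => //; rewrite !inE eqxx.
  by exists u => //; rewrite !inE uv orbT.
elim/big_rec2: _ => [|u x A _ h]; first by rewrite cards0.
apply: leq_trans (leq_card_setU _ _) _; rewrite leq_add // cardsU1 inE.
by rewrite cardsE; case: (adj E u u) => //=; rewrite add0n leqW.
Qed.

Lemma excess_le chi :
  (red_excess chi + blue_excess chi)%:R <= `|(below chi n)%:R - n%:R / 2| :> R.
Proof.
have h : (red_excess chi + blue_excess chi)%:R * 2 <= `|2 * (below chi n)%:R - n%:R| :> R.
  have [le|/ltnW le] := leqP n (2 * below chi n).
    rewrite ger0_norm; last by rewrite subr_ge0 -natrM ler_nat.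
    rewrite -!natrM -natrB // ler_nat /red_excess /blue_excess; lia.
  rewrite ler0_norm; last by rewrite subr_le0 -natrM ler_nat.
  rewrite opprB -!natrM -natrB // ler_nat /red_excess /blue_excess; lia.
have -> : (below chi n)%:R - n%:R / 2 = 2^-1 * (2 * (below chi n)%:R - n%:R) :> R by field.
rewrite normrM ger0_norm; last by rewrite invr_ge0.
by rewrite mulrC ler_pdivlMr.
Qed.

(** A small set has a small neighbourhood: vertices of degree at most [L ^ 2]
contribute little each, and the others are controlled by the sum of all squared
degrees. *)
Lemma sum_neighbourhoods_le E (H : pred 'I_n) :
  L%:R ^+ 2 * (\sum_(v | H v) (deg E v).+1)%:R <=
  (L%:R ^+ 4 + L%:R ^+ 2) * #|H|%:R + degree_weight E :> R.
Proof.
have e : (L%:R ^+ 4 + L%:R ^+ 2) * #|H|%:R = \sum_(v | H v) (L%:R ^+ 4 + L%:R ^+ 2) :> R.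
  by rewrite sumr_const mulr_natr.
rewrite e natr_sum mulr_sumr.
apply: (@le_trans _ _ (\sum_(v | H v) ((L%:R ^+ 4 + L%:R ^+ 2) + 8 ^+ deg E v))).
  apply: ler_sum => v _.
  have d8 : (deg E v)%:R ^+ 2 <= 8 ^+ deg E v :> R.
    by rewrite -!natrX ler_nat sq_le_exp8.
  have -> : L%:R ^+ 4 = L%:R ^+ 2 * L%:R ^+ 2 :> R by rewrite -exprD.
  by rewrite -natr1; apply: mul_succ_le; rewrite // exprn_ge0.
rewrite big_split lerD2l /degree_weight [leRHS](bigID H) /= lerDl.
by apply: sumr_ge0 => v _; rewrite exprn_ge0.
Qed.

Lemma card_high_degree E :
  L%:R ^+ 2 * #|[pred v | (L < deg E v)%N]|%:R <= degree_weight E :> R.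
Proof.
have -> : L%:R ^+ 2 * #|[pred v | (L < deg E v)%N]|%:R =
    \sum_(v | (L < deg E v)%N) L%:R ^+ 2 :> R by rewrite sumr_const mulr_natr.
rewrite /degree_weight [leRHS](bigID (fun v => L < deg E v)%N) /=.
apply: ler_wpDr; first by apply: sumr_ge0 => v _; rewrite exprn_ge0.
apply: ler_sum => v Lv; rewrite -!natrX ler_nat.
apply: (@leq_trans (deg E v ^ 2)); last exact: sq_le_exp8.
by rewrite leq_exp2r // ltnW.
Qed.

(** The exceptional vertices: the frozen ones, those disturbed by the last
sweep, and those near a vertex recoloured to balance the colouring. *)
Lemma typical_unhappy E i : (0 < n)%N -> typical E ->
  (i.-1 * n)%:R <= L%:R * flip_bound R E ->
  (#|[pred v | ~~ frozen L k E v &&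
      unhappy ext E (col ext L k E (initial_colouring n) (i * k)) v]| * L <= n)%N ->
  #|[pred v | unhappy ext E
      (rebalanced (col ext L k E (initial_colouring n) (i * k))) v]|%:R
  <= 6 / L%:R * n%:R :> R.
Proof.
move=> n0 /and4P[hw hf hc /forallP hbal] hi hrd.
have nR : 0 < n%:R :> R by rewrite ltr0n.
have LR : 0 < L%:R :> R by rewrite ltr0n.
set chi := col _ _ _ _ _ _ in hrd *.
have ile : (i < (L ^ 2).+2)%N.
  have : (i.-1 * n <= L * (n * L))%N.
    rewrite -(ler_nat R); apply: le_trans hi _.
    by rewrite natrM ler_wpM2l // natrM.
  rewrite mulnCA mulnC leq_pmul2l // => h.
  by rewrite -[(L ^ 2)%N]mulnn; lia.
have hb := hbal (Ordinal ile); rewrite /= -/chi in hb.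
have hex : (red_excess chi + blue_excess chi)%:R <= n%:R / L%:R ^+ 3 :> R.
  exact: le_trans (excess_le chi) hb.
have h1 := unhappy_change E chi (recoloured chi).
rewrite -/(rebalanced chi) in h1.
have h2 : (#|[pred v | unhappy ext E chi v]| <=
    #|[pred v | ~~ frozen L k E v && unhappy ext E chi v]| +
    (#|[pred v | (L < deg E v)%N]| + #|[pred v | conflict k E v]|))%N.
  apply: (@leq_trans #|[predU [pred v | ~~ frozen L k E v && unhappy ext E chi v] &
    [predU [pred v | (L < deg E v)%N] & [pred v | conflict k E v]]]|).
    apply: subset_leq_card; apply/fintype.subsetP => v; rewrite !inE => ->.
    by rewrite /frozen andbT; case: (_ < _)%N; case: (conflict _ _ _).
  apply: (@leq_trans (#|[pred v | ~~ frozen L k E v && unhappy ext E chi v]| +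
      #|[predU [pred v | (L < deg E v)%N] & [pred v | conflict k E v]]|)).
    by rewrite -cardUI leq_addr.
  by rewrite leq_add2l -cardUI leq_addr.
set a := #|[pred v | ~~ frozen L k E v && _]| in h2 hrd.
set b := #|[pred v | (L < deg E v)%N]| in h2.
set c := #|[pred v | conflict k E v]| in h2 hc.
set d := (\sum_(v | _) _)%N in h1.
have hA : a%:R * L%:R <= n%:R :> R by rewrite -natrM ler_nat.
have hC : c%:R * L%:R <= n%:R :> R by rewrite -natrM ler_nat.
have hB : b%:R * L%:R <= n%:R :> R.
  rewrite -(ler_pM2r LR); apply: le_trans hw; apply: le_trans (card_high_degree E).
  by rewrite -mulrA -expr2 mulrC.
have hH : #|recoloured chi|%:R * L%:R ^+ 3 <= n%:R :> R.
  by rewrite -ler_pdivlMr ?exprn_gt0 //; move: hex; rewrite -card_recoloured.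
have L1 : 1 <= L%:R :> R by rewrite ler1n.
have hD : d%:R * L%:R <= 3 * n%:R :> R.
  rewrite -(ler_pM2r LR) -mulrA -expr2 mulrC.
  apply: le_trans (sum_neighbourhoods_le E (recoloured chi)) _.
  have -> : 3 * n%:R * L%:R = 2 * (n%:R * L%:R) + n%:R * L%:R :> R by ring.
  apply: lerD => //; rewrite mulrC.
  apply: (@le_trans _ _ (#|recoloured chi|%:R * (2 * L%:R ^+ 4))).
    rewrite ler_wpM2l // mulr_natl mulr2n lerD2l; apply: ler_weXn2l => //.
  have -> : #|recoloured chi|%:R * (2 * L%:R ^+ 4) = 2 * (#|recoloured chi|%:R * L%:R ^+ 3 * L%:R) :> R.
    by rewrite exprSr; ring.
  by rewrite ler_wpM2l // ler_pM2r.
rewrite mulrAC ler_pdivlMr //.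
apply: (@le_trans _ _ ((a + (b + c) + d)%:R * L%:R)).
  by rewrite ler_pM2r // ler_nat; apply: leq_trans h1 _; rewrite leq_add2r.
rewrite !natrD; nra.
Qed.

End TypicalGraphs.

(** * Most graphs are typical *)

Section TypicalProbability.

Local Open Scope ring_scope.

Variables (R : realType) (n : nat) (ext : bool) (p C : R).
Hypothesis n0 : (0 < n)%N.
Hypothesis p01 : 0 <= p <= 1.
Hypothesis npC : n%:R * p <= C.

Let L := levels n.
Let k := (L * L)%N.
Let A := expR (63 * C).

Lemma mean_degree_weight : Ex p (pairs n) (@degree_weight R n) <= n%:R * A.
Proof.
rewrite /degree_weight Ex_sum; apply: (@le_trans _ _ (\sum_(v < n) A)).
  by apply: ler_sum => v _; exact: Ex_deg_pow_le.
by rewrite sumr_const card_ord mulr_natl.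
Qed.

Lemma Ex_edge e : e \in pairs n -> Ex p (pairs n) (fun E => (e \in E)%:R) = p.
Proof.
move=> eP; rewrite -[X in Ex p X](finset.setD1K eP) Ex_setU1; last by rewrite !inE eqxx.
rewrite (eq_Ex _ (g := fun=> 1)); last by move=> E _; rewrite !inE eqxx.
rewrite (eq_Ex _ (f := fun E => (e \in E)%:R) (g := fun=> 0)); last first.
  move=> E /fintype.subsetP EP; case: (boolP (e \in E)) => // /EP.
  by rewrite !inE eqxx.
by rewrite !Ex_cst mulr1 mulr0 addr0.
Qed.

(** A vertex of a given class is determined by its parity and the quotient of
its half index by [k]. *)
Lemma card_class c : (#|[pred u : 'I_n | cls k u == c]| <= 2 * (n %/ k).+1)%N.
Proof.
have qn (u : 'I_n) : (u./2 %/ k < (n %/ k).+1)%N.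
  by rewrite ltnS leq_div2r // (leq_trans (half_leq (ltnW (ltn_ord u)))) // -divn2 leq_div.
have inj : {in [pred u : 'I_n | cls k u == c] &,
    injective (fun u : 'I_n => (odd u, Ordinal (qn u)))}.
  move=> u v; rewrite !inE /cls => /eqP uc /eqP vc [ouv quv]; apply: val_inj => /=.
  rewrite -(odd_double_half u) -(odd_double_half v) ouv; congr (_ + _.*2)%N.
  by rewrite (divn_eq u./2 k) (divn_eq v./2 k) uc vc quv.
rewrite -(card_in_imset inj); apply: leq_trans (max_card _) _.
by rewrite card_prod card_bool card_ord.
Qed.

Lemma mean_conflicts :
  Ex p (pairs n) (fun E => #|[pred v | conflict k E v]|%:R) <= 2 * C * (n %/ k).+1%:R.
Proof.
have [p0 p1] := andP p01.
apply: (@le_trans _ _ (\sum_(v < n) \sum_(u < n | (u != v) && (cls k u == cls k v)) p)).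
  rewrite (eq_bigr (fun v => \sum_(u < n | (u != v) && (cls k u == cls k v))
      Ex p (pairs n) (fun E => (adj E v u)%:R))); last first.
    move=> v _; apply: eq_bigr => u /andP[uv _]; rewrite Ex_edge //.
    by rewrite inE cards2 (eq_sym v) uv.
  under eq_bigr => v _ do rewrite -Ex_sum.
  rewrite -Ex_sum; apply: le_Ex => // E EP.
  rewrite -sum1_card natr_sum big_mkcond; apply: ler_sum => v _.
  rewrite inE; case: ifP => [/existsP[u /andP[vu uv]]|_]; last first.
    by apply: sumr_ge0 => u _.
  rewrite (bigD1 u) /=; last first.
    by rewrite uv andbT; apply: contraTneq vu => ->; rewrite adj_irr.
  by rewrite vu lerDl sumr_ge0.
apply: (@le_trans _ _ (\sum_(v < n) (2 * (n %/ k).+1)%:R * p)).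
  apply: ler_sum => v _; rewrite sumr_const -[leLHS]mulr_natl ler_wpM2r // ler_nat.
  apply: leq_trans (card_class (cls k v)); apply: subset_leq_card.
  by apply/fintype.subsetP => u; rewrite !inE => /andP[].
rewrite sumr_const card_ord -[leLHS]mulr_natl natrM; set x := (n %/ k).+1%:R.
have -> : n%:R * (2 * x * p) = 2 * x * (n%:R * p) by ring.
by rewrite [leRHS]mulrAC ler_wpM2l // mulr_ge0.
Qed.

(** The symmetry makes the mean number of red vertices equal to that in the
exchanged graph; together they number [n] up to the influence of a fixed
vertex. *)
Lemma mean_red t : `|Ex p (pairs n) (fun E => (red ext E t)%:R) - n%:R / 2|
  <= A * (L%:R + 2) ^+ t.
Proof.
have [p0 p1] := andP p01.
set m := Ex _ _ _; set P := (L%:R + 2) ^+ t.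
have P0 : 0 <= P by rewrite exprn_ge0 // addr_ge0.
pose q (E : graph n) : R := (\sum_(z | twin z == z) (deg E z).+1)%:R.
have hq : Ex p (pairs n) q <= A.
  apply: (@le_trans _ _ (\sum_(z : 'I_n | twin z == z) A)).
    rewrite /q (eq_Ex _ (g := fun E => \sum_(z | twin z == z) (deg E z).+1%:R)); last first.
      by move=> E _; rewrite natr_sum.
    rewrite Ex_sum; apply: ler_sum => z _; apply: le_trans (Ex_deg_pow_le z p01 npC).
    by apply: le_Ex => // E _; rewrite -natrX ler_nat ltn_expl.
  rewrite sumr_const -[leLHS]mulr_natr ler_piMr ?expR_ge0 // lern1.
  have hz : (n.-1 < n)%N by rewrite ltn_predL.
  rewrite -(cards1 (Ordinal hz)); apply: subset_leq_card.
  apply/fintype.subsetP => z; rewrite !inE => /eqP h; have zn := twin_fixed (val_inj h).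
  by apply/eqP; exact: val_inj.
have Pnat : ((L + 2) ^ t)%:R = P by rewrite natrX natrD.
have hm : m = Ex p (pairs n) (fun E => (red ext (twin_graph E) t)%:R).
  by rewrite (Ex_twin p (fun E => (red ext E t)%:R)).
have up : m + m <= n%:R + Ex p (pairs n) q * P.
  rewrite {2}hm /m -ExD mulrC -ExZ.
  rewrite -{1}(Ex_cst p (pairs n) n%:R) -ExD; apply: le_Ex => // E _.
  rewrite -Pnat -natrM -!natrD ler_nat mulnC.
  by have [] := red_twin ext L k E t.
have low : n%:R <= m + m + Ex p (pairs n) q * P.
  rewrite {2}hm /m -ExD mulrC -ExZ.
  rewrite -{1}(Ex_cst p (pairs n) n%:R) -ExD; apply: le_Ex => // E _.
  rewrite -Pnat -natrM -!natrD ler_nat [(_ * (\sum_(_ | _) _))%N]mulnC.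
  by have [] := red_twin ext L k E t.
have hqP : Ex p (pairs n) q * P <= A * P by rewrite ler_wpM2r.
have AP : 0 <= A * P by rewrite mulr_ge0 // expR_ge0.
by rewrite ler_norml; apply/andP; split; lra.
Qed.

Lemma card_pairs_le : (#|pairs n| <= n * n)%N.
Proof.
rewrite card_draws card_ord bin2.
apply: leq_trans (half_leq _) _; last by rewrite -divn2; exact: leq_div.
by rewrite leq_mul2l leq_pred orbT.
Qed.

Lemma Pr_unbalanced t :
  Pr p (pairs n) (fun E => n%:R / L%:R ^+ 3 < `|(red ext E t)%:R - n%:R / 2| :> R)
  <= (4 * C + A ^+ 2) * ((L%:R + 2) ^+ (2 * t) * L%:R ^+ 6) / n%:R.
Proof.
have [p0 p1] := andP p01.
have nR : 0 < n%:R :> R by rewrite ltr0n.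
have n1 : 1 <= n%:R :> R by rewrite ler1n.
have LR : 0 < L%:R :> R by rewrite ltr0n.
pose P : R := (L%:R + 2) ^+ t; have P0 : 0 <= P by rewrite exprn_ge0 // addr_ge0.
have b0 : 0 <= 2 * P by rewrite mulr_ge0.
have a0 : 0 < n%:R / L%:R ^+ 3 :> R by rewrite divr_gt0 // exprn_gt0.
apply: le_trans (chebyshev_Pr p01 (n%:R / 2) b0 a0 _) _.
  move=> e E eP _; have h := edge_influence ext L k E (initial_colouring n) t eP.
  have := below_differ (col ext L k (e |: E)%SET (initial_colouring n) t)
    (col ext L k (E :\ e)%SET (initial_colouring n) t).
  have := below_differ (col ext L k (E :\ e)%SET (initial_colouring n) t)
    (col ext L k (e |: E)%SET (initial_colouring n) t).
  rewrite differC => /leq_trans h1 /leq_trans h2.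
  have {h1}h1 := h1 _ (leq_add (leqnn _) h); have {h2}h2 := h2 _ (leq_add (leqnn _) h).
  have e2 : ((2 * (L + 2) ^ t)%N)%:R = 2 * P by rewrite natrM natrX natrD.
  move: h1 h2; rewrite -(ler_nat R) natrD => h1; rewrite -(ler_nat R) natrD => h2.
  by rewrite -e2 ler_norml /red -/L -/k; apply/andP; split; lra.
have hm := mean_red t; rewrite -/P in hm.
set m := Ex _ _ _ in hm *.
have sq : (m - n%:R / 2) ^+ 2 <= (A * P) ^+ 2.
  rewrite -[leLHS]real_normK ?num_real // lerXn2r ?nnegrE //.
  by rewrite mulr_ge0 // expR_ge0.
have pp : #|pairs n|%:R * p <= C * n%:R.
  apply: (@le_trans _ _ ((n * n)%:R * p)); first by rewrite ler_wpM2r // ler_nat card_pairs_le.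
  by rewrite natrM -mulrA mulrC ler_wpM2r.
have -> : (n%:R / L%:R ^+ 3) ^+ 2 = n%:R * (n%:R / L%:R ^+ 6) :> R.
  rewrite expr_div_n -exprM expr2; field.
  by rewrite gt_eqF.
rewrite ler_pdivrMr; last by rewrite !mulr_gt0 // invr_gt0 exprn_gt0.
have -> : (4 * C + A ^+ 2) * ((L%:R + 2) ^+ (2 * t) * L%:R ^+ 6) / n%:R
   * (n%:R * (n%:R / L%:R ^+ 6)) = (4 * C + A ^+ 2) * P ^+ 2 * n%:R.
  rewrite mulnC exprM -/P; field.
  by rewrite !gt_eqF.
have P20 : 0 <= P ^+ 2 by rewrite exprn_ge0.
have -> : (4 * C + A ^+ 2) * P ^+ 2 * n%:R = C * n%:R * (2 * P) ^+ 2 + (A * P) ^+ 2 * n%:R.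
  by rewrite !exprMn; ring.
apply: lerD; first by rewrite ler_wpM2r // exprn_ge0.
by apply: le_trans sq _; rewrite ler_peMr // exprn_ge0 // mulr_ge0 // expR_ge0.
Qed.

Lemma Pr_typical K : (6 <= L)%N ->
  Ex p (pairs n) (fun E => \sum_x (deg E x)%:R * potential R E x) <= K * n%:R ->
  Pr p (pairs n) (fun E => ~~ typical R ext E)
  <= (A + 8 * K + 98 * C + (4 * C + A ^+ 2)) / L%:R.
Proof.
move=> L6 hK; have [p0 p1] := andP p01.
have nR : 0 < n%:R :> R by rewrite ltr0n.
have LR : 0 < L%:R :> R by rewrite ltr0n.
have nL : 0 < n%:R * L%:R :> R by rewrite mulr_gt0.
have C0 : 0 <= C by apply: le_trans npC; rewrite mulr_ge0.
pose f1 (E : graph n) := n%:R * L%:R < degree_weight R E.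
pose f2 (E : graph n) := n%:R * L%:R < flip_bound R E.
pose f3 (E : graph n) := (n < #|[pred v | conflict k E v]| * L)%N.
pose f4 i (E : graph n) := n%:R / L%:R ^+ 3 < `|(red ext E (i * k))%:R - n%:R / 2| :> R.
apply: (@le_trans _ _ (Pr p (pairs n) f1 + Pr p (pairs n) f2 + Pr p (pairs n) f3
    + \sum_(i < (L ^ 2).+2) Pr p (pairs n) (f4 i))).
  rewrite /Pr -Ex_sum -!ExD; apply: le_Ex => // E _.
  rewrite /typical !negb_and -!ltNge -ltnNge -/L -/k -/(f1 E) -/(f2 E) -/(f3 E).
  have s0 : 0 <= \sum_(i < (L ^ 2).+2) (f4 i E)%:R :> R by apply: sumr_ge0.
  case: (boolP (f1 E)) => _ /=; first by rewrite -!addrA lerDl !addr_ge0.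
  case: (boolP (f2 E)) => _ /=; first by rewrite add0r -!addrA lerDl !addr_ge0.
  case: (boolP (f3 E)) => _ /=; first by rewrite !add0r lerDl.
  rewrite !add0r; case: (boolP [forall _, _]) => //= /forallPn[i hi].
  rewrite (bigD1 i) //= /f4 ltNge hi lerDl; exact: sumr_ge0.
set B := 4 * C + A ^+ 2.
have B0 : 0 <= B by rewrite addr_ge0 ?sqr_ge0 // mulr_ge0.
have -> : (A + 8 * K + 98 * C + B) / L%:R =
    A / L%:R + 8 * K / L%:R + 98 * C / L%:R + B / L%:R by field; rewrite gt_eqF.
apply: lerD; first apply: lerD; first apply: lerD.
- apply: le_trans (markov_Pr p01 nL (f := @degree_weight R n) _ _) _.
  + by move=> E _; apply: sumr_ge0 => v _; rewrite exprn_ge0.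
  + by move=> E _ /ltW.
  have e (x : R) : x / L%:R * (n%:R * L%:R) = n%:R * x by field; rewrite gt_eqF.
  by rewrite ler_pdivrMr // e; exact: mean_degree_weight.
- apply: le_trans (markov_Pr p01 nL (f := @flip_bound R n) _ _) _.
  + move=> E _; rewrite mulr_ge0 // sumr_ge0 // => v _.
    by rewrite mulr_ge0 // potential_ge0.
  + by move=> E _ /ltW.
  have e (x : R) : 8 * x / L%:R * (n%:R * L%:R) = 8 * (x * n%:R).
    by field; rewrite gt_eqF.
  by rewrite ler_pdivrMr // e /flip_bound ExZ ler_wpM2l.
- apply: le_trans (markov_Pr p01 nR
    (f := fun E => L%:R * #|[pred v | conflict k E v]|%:R) _ _) _.
  + by move=> E _; rewrite mulr_ge0.
  + by move=> E _ h; rewrite -natrM ler_nat mulnC ltnW.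
  rewrite ExZ ler_pdivrMr //.
  apply: (@le_trans _ _ (L%:R * (2 * C * (n %/ k).+1%:R))).
    by rewrite ler_wpM2l // mean_conflicts.
  have hn : (n %/ k * k <= n)%N by exact: leq_divM.
  have hL3 : (L ^ 3 <= 48 * n)%N by exact: levels_cube.
  have h : (L * L * (n %/ k).+1 <= 49 * n)%N.
    rewrite mulnS -/k mulnC addnC; apply: (@leq_trans (n + 48 * n)); last by lia.
    rewrite leq_add // (leq_trans _ hL3) // /k mulnn leq_pexp2l //.
  rewrite [leRHS]mulrAC ler_pdivlMr //.
  have -> : L%:R * (2 * C * (n %/ k).+1%:R) * L%:R =
      2 * C * (L * L * (n %/ k).+1)%:R by rewrite !natrM; ring.
  have -> : 98 * C * n%:R = 2 * C * (49 * n)%:R by rewrite natrM; ring.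
  by rewrite ler_wpM2l ?mulr_ge0 // ler_nat.
apply: (@le_trans _ _ (\sum_(i < (L ^ 2).+2)
   (4 * C + A ^+ 2) * ((L%:R + 2) ^+ (4 * L ^ 4) * L%:R ^+ 6) / n%:R)).
  apply: ler_sum => i _; apply: le_trans (Pr_unbalanced _) _.
  rewrite ler_wpM2r ?invr_ge0 // ler_wpM2l // ler_wpM2r ?exprn_ge0 // ler_weXn2l //.
    by rewrite -[leLHS]add0r lerD // ler1n.
  have il : (i <= (L ^ 2).+1)%N by rewrite -ltnS ltn_ord.
  rewrite [leqRHS](_ : _ = (2 * ((2 * L ^ 2) * k))%N); last first.
    rewrite /k mulnn (expnD L 2 2); move: (L ^ 2)%N => x; lia.
  rewrite leq_mul2l leq_mul2r; apply/orP; right; apply/orP; right.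
  apply: leq_trans il _; rewrite mul2n -addnn -addn1 leq_add2l.
  by rewrite expn_gt0.
rewrite sumr_const card_ord -[leLHS]mulr_natl -/B.
set Q := (L%:R + 2) ^+ (4 * L ^ 4); have Q0 : 0 <= Q by rewrite exprn_ge0 // addr_ge0.
rewrite -[_ * _ / n%:R]mulrA mulrCA ler_wpM2l //.
rewrite mulrA ler_pdivrMr // [leRHS]mulrC ler_pdivlMr //.
have := levels_power_le L6; rewrite -/L -(ler_nat R); apply: le_trans.
rewrite natrX natrD -[(4 * L ^ 4 + 9)%N]/(4 * L ^ 4 + (2 + 6 + 1))%N.
rewrite exprD -/Q !exprD expr1.
have h2 : (L ^ 2).+2%:R <= (L%:R + 2) ^+ 2 :> R.
  rewrite -natrD -natrX ler_nat -!mulnn; nia.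
have h6 : L%:R ^+ 6 <= (L%:R + 2) ^+ 6 :> R.
  by rewrite lerXn2r ?nnegrE ?addr_ge0 // lerDl.
rewrite mulrCA -[leLHS]mulrA.
rewrite ler_wpM2l //; apply: ler_pM; rewrite ?mulr_ge0 ?exprn_ge0 ?lerDl //.
by apply: ler_pM; rewrite ?exprn_ge0.
Qed.

End TypicalProbability.

(** * Convergence *)

Section Assembly.

Local Open Scope ring_scope.

Variable R : realType.

Lemma gnp_probE n (p : R) (A : pred (graph n)) : gnp_prob p A = Pr p (pairs n) A.
Proof.
rewrite /gnp_prob /Pr /Ex big_mkcondr; apply: eq_bigr => E _.
by case: (A E); rewrite ?mulr1 ?mulr0.
Qed.

Lemma Pr_compl n (p : R) (A : pred (graph n)) :
  Pr p (pairs n) A = 1 - Pr p (pairs n) (fun E => ~~ A E).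
Proof.
rewrite -[X in X - _](Ex_cst p (pairs n) 1) -mulN1r -ExZ -ExD.
by apply: eq_Ex => E _; case: (A E) => /=; rewrite ?mulr0 ?mulr1 ?addr0 ?subrr.
Qed.

Lemma cvg_levels (f : nat -> R) (l K : R) :
  (forall n, (6 <= levels n)%N -> `|f n - l| <= K / (levels n)%:R) ->
  (f @ \oo --> l)%classic.
Proof.
move=> h; apply/cvgrPdist_le => /= e e0.
pose m := maxn 6 (Num.truncn (`|K| / e)).+1.
exists (2 ^ (2 ^ (2 ^ m)))%N => // n /= /levels_large mn.
have Ln : 0 < (levels n)%:R :> R by rewrite ltr0n.
rewrite distrC; apply: le_trans (h n _) _.
  by apply: leq_trans (ltnW mn); exact: leq_maxl.
rewrite ler_pdivrMr //; apply: (@le_trans _ _ `|K|); first exact: ler_norm.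
rewrite -ler_pdivrMl // mulrC; apply: le_trans (ltW (truncnS_gt _)) _.
by rewrite ler_nat; apply: leq_trans (ltnW mn); exact: leq_maxr.
Qed.

Lemma limn_esup_bounded (u : nat -> R) :
  (limn_esup (fun n => (u n)%:E) < +oo)%E -> exists C, forall n, u n <= C.
Proof.
move=> /ereal_inf_lt[_ [A [N _ NA] <-]] supA.
have [M hM] : exists M : R, (ereal_sup [set (u n)%:E | n in A] <= M%:E)%E.
  case: (ereal_sup _) supA => [r _|//|_]; first by exists r.
  by exists 0; rewrite leNye.
exists (\big[Num.max/M]_(i < N) u i) => n; have [nN|Nn] := ltnP n N.
  exact: (le_bigmax_cond M (fun i : 'I_N => u i) (j := Ordinal nN)).
apply: (@le_trans _ _ M); last exact: bigmax_ge_id.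
rewrite -lee_fin; apply: le_trans hM.
by apply: ereal_sup_ubound; exists n => //; exact: NA.
Qed.

Definition precision n : R := 6 / (levels n)%:R.

Definition good (ext : bool) n : graph n -> colouring n -> bool :=
  if ext then external_bisection (precision n) (n := n)
  else internal_bisection (precision n) (n := n).

Lemma good_unhappy ext n (E : graph n) chi : bisection chi ->
  #|[pred v | unhappy ext E chi v]|%:R <= precision n * n%:R -> good ext E chi.
Proof.
move=> hb hu; have compl v : (same_deg E chi v + opp_deg E chi v = deg E v)%N.
  rewrite /deg -(cardID (fun u => chi u == chi v) (fun u => adj E v u)).
  congr (_ + _)%N; apply: eq_card => u; rewrite !inE /in_mem //=.
  by rewrite andbC.
have same v : bad_deg true E chi v = same_deg E chi v.
  by apply: eq_card => u; rewrite !inE /bad eqb_id.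
have opp v : bad_deg false E chi v = opp_deg E chi v.
  by apply: eq_card => u; rewrite !inE /bad eqbF_neg.
rewrite /good; case: ext hu => hu; rewrite ?/external_bisection ?/internal_bisection hb /=.
  rewrite /almost_external; apply: le_trans hu; rewrite ler_nat.
  apply: subset_leq_card; apply/fintype.subsetP => v; rewrite !inE /unhappy same.
  by have := compl v; lia.
rewrite /almost_internal; apply: le_trans hu; rewrite ler_nat.
apply: subset_leq_card; apply/fintype.subsetP => v; rewrite !inE /unhappy opp.
by have := compl v; lia.
Qed.

Section OneGraph.

Variables (n : nat) (ext : bool) (E : graph n).
Hypothesis n0 : (0 < n)%N.
Hypothesis EP : E \subset pairs n.

Lemma halt_prob_program_ge :
  (typical R ext E)%:R <= halt_prob R (word_bits 12 n)
    (fun s => good ext E (output n s)) (initial (program ext) E) <= 1.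
Proof.
have [t [s' [i [hex hout hrd hi _]]]] := program_spec R ext n0 EP.
rewrite /initial (halt_prob_exec _ _ hex); case: (boolP (typical _ _ _)) => ty; last first.
  by rewrite ler_nat lern1 leq_b1.
suff -> : good ext E (output n s') by rewrite lexx.
rewrite hout; apply: good_unhappy; first exact: bisection_rebalanced.
exact: typical_unhappy.
Qed.

Lemma typical_good : typical R ext E -> exists chi, good ext E chi.
Proof.
move=> ty; have [t [s' [i [_ _ hrd hi _]]]] := program_spec R ext n0 EP.
exists (rebalanced (col ext (levels n) (levels n * levels n) E (initial_colouring n)
  (i * (levels n * levels n)))).
apply: good_unhappy; first exact: bisection_rebalanced.
exact: typical_unhappy.
Qed.

Lemma expected_time_program :
  (expected_time R (word_bits 12 n) (initial (program ext) E)
   <= (530 * n%:R + 40 * degree_weight R E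
        + 752 * flip_bound R E)%:E)%E.
Proof.
have [t [s' [i [hex _ _ _ ht]]]] := program_spec R ext n0 EP.
rewrite /initial (expected_time_exec _ hex) lee_fin; apply: le_trans ht _.
rewrite lerD2r lerD2l ler_wpM2l // /degree_weight natr_sum; apply: ler_sum => v _.
by rewrite -natrX ler_nat ltnW // ltn_expl.
Qed.

End OneGraph.

Section Uniform.

Variables (p : nat -> R) (C K : R).
Hypothesis p01 : forall n, 0 <= p n <= 1.
Hypothesis npC : forall n, n%:R * p n <= C.
Hypothesis potK : forall n (q : R), 0 <= q <= 1 -> n%:R * q <= C ->
  Ex q (pairs n) (fun E => \sum_x (deg E x)%:R * potential R E x) <= K * n%:R.

Let M := expR (63 * C) + 8 * K + 98 * C + (4 * C + expR (63 * C) ^+ 2).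

Lemma levels_gt_n n : (6 <= levels n)%N -> (0 < n)%N.
Proof. by case: n. Qed.

Lemma Pr_atypical ext n : (6 <= levels n)%N ->
  Pr (p n) (pairs n) (fun E => ~~ typical R ext E) <= M / (levels n)%:R.
Proof.
move=> L6; apply: Pr_typical => //; first exact: levels_gt_n.
exact: potK.
Qed.

Lemma success_prob_cvg ext :
  ((fun n => success_prob (program ext) 12 (p n) (@good ext n)) @ \oo --> (1 : R))%classic.
Proof.
apply: (@cvg_levels _ _ M) => n L6; have n0 := levels_gt_n L6.
set S := success_prob _ _ _ _.
have S1 : S <= 1.
  rewrite -(Ex_cst (p n) (pairs n) 1); apply: le_Ex => // E EP.
  by case/andP: (halt_prob_program_ge ext n0 EP).
have S0 : Pr (p n) (pairs n) (typical R ext (n := n)) <= S.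
  by apply: le_Ex => // E EP; case/andP: (halt_prob_program_ge ext n0 EP).
rewrite ler0_norm ?subr_le0 // opprB lerBlDr -lerBlDl.
by apply: le_trans S0; rewrite Pr_compl lerD2l lerN2 Pr_atypical.
Qed.

Lemma average_time_le ext n : (0 < n)%N ->
  (average_time (program ext) 12 n (p n) <=
   ((530 + 40 * expR (63 * C) + 752 * (8 * K)) * n%:R)%:E)%E.
Proof.
move=> n0; pose T (E : graph n) : R := 530 * n%:R + 40 * degree_weight R E
        + 752 * flip_bound R E.
apply: (@le_trans _ _ (Ex (p n) (pairs n) T)%:E).
  rewrite /average_time /Ex -sumEFin; apply: lee_sum => E; rewrite inE => EP.
  rewrite EFinM; apply: lee_wpmul2l; first by rewrite lee_fin; exact: wgt_ge0.
  exact: expected_time_program.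
rewrite lee_fin /T ExD ExD Ex_cst ExZ ExZ.
have : Ex (p n) (pairs n) (@flip_bound R n) <= 8 * (K * n%:R).
  by rewrite /flip_bound ExZ ler_wpM2l ?ler0n // potK.
have := mean_degree_weight (p01 n) (npC n).
move: (Ex _ _ _) (Ex _ _ _) (expR _) => x y z hx hy.
have -> : (530 + 40 * z + 752 * (8 * K)) * n%:R =
  530 * n%:R + 40 * (n%:R * z) + 752 * (8 * (K * n%:R)) by ring.
apply: lerD; last by rewrite ler_wpM2l ?ler0n.
by rewrite lerD2l ler_wpM2l ?ler0n.
Qed.

Lemma program_found ext : found_in_linear_time p (@good ext).
Proof.
exists (program ext), 12; split => //; first exact: success_prob_cvg.
by eexists => n n0; exact: average_time_le.
Qed.

Lemma bisections_exist_cvg : ((fun n => gnp_prob (p n) (fun G : graph n =>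
    [exists chi, internal_bisection (precision n) G chi]
    && [exists chi, external_bisection (precision n) G chi])) @ \oo --> (1 : R))%classic.
Proof.
apply: (@cvg_levels _ _ (M + M)) => n L6; have n0 := levels_gt_n L6.
rewrite gnp_probE; set A := (fun G : graph n => _); rewrite Pr_compl.
set P := Pr _ _ _.
have P0 : 0 <= P by apply: Ex_ge0.
have -> : 1 - P - 1 = - P by ring.
rewrite normrN ger0_norm // mulrDl.
apply: le_trans (lerD (Pr_atypical false L6) (Pr_atypical true L6)).
rewrite /Pr -ExD; apply: le_Ex => // E EP.
rewrite -natrD ler_nat.
case: (boolP (typical R false E)) => [t0|_]; last by case: (A E).
case: (boolP (typical R true E)) => [t1|_]; last by case: (A E).
have [chi0 h0] := typical_good n0 EP t0; have [chi1 h1] := typical_good n0 EP t1.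
suff -> : A E by [].
by apply/andP; split; apply/existsP; [exists chi0 | exists chi1].
Qed.

End Uniform.

Lemma precision_cvg : (precision @ \oo --> (0 : R))%classic.
Proof.
apply: (@cvg_levels _ _ 6) => n _.
by rewrite subr0 ger0_norm // divr_ge0.
Qed.

End Assembly.

Local Open Scope classical_set_scope.
Local Open Scope ring_scope.

Theorem theorem1p5 (R : realType) (p : nat -> R)
    (p01 : forall n, 0 <= p n <= 1)
    (limsup_np : (limn_esup (fun n => (n%:R * p n)%:E) < +oo)%E) :
  exists eps : nat -> R,
    [/\ eps @ \oo --> (0 : R),
        (fun n => gnp_prob (p n) (fun G : graph n =>
           [exists chi, internal_bisection (eps n) G chi]
           && [exists chi, external_bisection (eps n) G chi]))
          @ \oo --> (1 : R),
        found_in_linear_time p (fun n => internal_bisection (n := n) (eps n))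
      & found_in_linear_time p (fun n => external_bisection (n := n) (eps n))].
Proof.
have [C npC] := limn_esup_bounded limsup_np.
have C0 : 0 <= C by have := npC 0%N; rewrite mul0r.
have [K potK] := Ex_potential_le C0.
exists (@precision R); split.
- exact: precision_cvg.
- exact: bisections_exist_cvg p01 npC potK.
- exact: (program_found p01 npC potK false).
- exact: (program_found p01 npC potK true).
Qed.
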